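(* Let $k\in\mathbb{N}$, $x_k=\frac{\sqrt{2k+1}-1}{\sqrt{2k+1}+1}$ and $\alpha_k=\sqrt{2k+1}\,\ln x_k$. Let $a,b$ be positive integers with $b$ odd and $b>4a$. Assume that the equation $\frac{z(z-a)(z-2a)}{(z-(b-2a))(z-(b-a))(z-b)}=\frac{1}{x_k}$ has a unique real solution $z_0>b$, and that the equation $\frac{(z+2a)(z+a)z}{(z+(b-2a))(z+(b-a))(z+b)}=\frac{1}{x_k}$ has a root $z_1$ with $\mathrm{Im}\,z_1>0$. Define $$M_1=\ln\frac{(z_0-(b-2a))^{b-2a}(z_0-(b-a))^{b-a}(z_0-b)^b}{(z_0-2a)^{2a}(z_0-a)^a(b-4a)^{b-4a}(b-2a)^{b-2a}b^b}-\frac{b}{2}\ln x_k,$$ $$M_2=\ln\frac{|z_1+(b-2a)|^{b-2a}|z_1+(b-a)|^{b-a}|z_1+b|^b}{|z_1+2a|^{2a}|z_1+a|^a(b-4a)^{b-4a}(b-2a)^{b-2a}b^b}-\frac{b}{2}\ln x_k,$$ $K_1=-\frac{b-2a}{2}\ln m$ if $k=2m$ and $K_1=-\frac{b-2a}{2}\ln k+\frac{3(b-2a)}{2}\ln 2$ if $k=2m-1$, and $N_1=\lim_{n\to\infty,\ n \text{ odd}}\frac1n\ln\frac{d_{bn}}{\Delta}$ (with $d_{bn}$, $\Delta=\Delta(n)$ as in the context). If $M_2+K_1+N_1<0$, then $$\mu(\alpha_k)\le 1-\frac{M_1+K_1+N_1}{M_2+K_1+N_1}.$$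
   Context: For irrational real $\alpha$, the irrationality measure $\mu(\alpha)$ is the supremum of all $\kappa$ such that $|\alpha-p/q|<q^{-\kappa}$ has infinitely many rational solutions $p/q$. $d_N$ is the least common multiple of $1,\dots,N$; $[\cdot]$ is the floor and $\{\cdot\}$ the fractional part. Let $\Omega$ be the set of $y\in[0,1)$ such that for all real $x$: $\big([x-2ay]-[x-(b-2a)y]-[(b-4a)y]\big)+\big([x-ay]-[x-(b-a)y]-[(b-2a)y]\big)+\big([x]-[x-by]-[by]\big)\ge1$. For odd positive $n$, $\Delta$ is the product of all primes $p>\sqrt{bn}$ with $\{n/p\}\in\Omega$. (The limit defining $N_1$ exists.) *)

(* Defs.v *)
From mathcomp Require Import all_boot all_order all_algebra.
From mathcomp Require Import all_classical all_reals all_analysis.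
From mathcomp Require Import complex.
Set Implicit Arguments. Unset Strict Implicit. Unset Printing Implicit Defensive.
Import Order.TTheory GRing.Theory Num.Theory.
Local Open Scope classical_set_scope.
Local Open Scope ring_scope.

Notation fl x := (Num.floor x).

Definition frac {R : realType} (y : R) : R := y - (fl y)%:~R.

Definition dlcm (N : nat) : nat := \big[lcmn/1%N]_(1 <= i < N.+1) i.

Definition Omega {R : realType} (a b : nat) (y : R) : Prop :=
  0 <= y < 1 /\
  forall x : R,
    ((fl (x - (2 * a)%:R * y) - fl (x - (b%:R - (2 * a)%:R) * y)
        - fl ((b%:R - (4 * a)%:R) * y))
   + (fl (x - a%:R * y) - fl (x - (b%:R - a%:R) * y)
        - fl ((b%:R - (2 * a)%:R) * y))
   + (fl x - fl (x - b%:R * y) - fl (b%:R * y)) >= 1)%R.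

(* Delta(n): product of the primes p > sqrt(b n) with {n/p} in Omega.
   Only primes p <= b n can contribute (for p > b n one has {n/p} = n/p < 1/b,
   which is not in Omega), so the (finite) product is taken over p <= b n. *)
Definition Delta (R : realType) (a b n : nat) : nat :=
  \prod_(0 <= p < (b * n).+1 |
          prime p && (Num.sqrt ((b * n)%:R : R) < p%:R)
          && `[< Omega a b (frac (n%:R / p%:R : R)) >]) p.

Definition irr_exponents {R : realType} (alpha : R) : set R :=
  [set kappa : R | infinite_set
     [set r : rat | `|alpha - ratr r| < ((denq r)%:~R : R) `^ (- kappa)]].

Definition irr_measure {R : realType} (alpha : R) : \bar R :=
  ereal_sup [set (kappa%:E) | kappa in irr_exponents alpha].

Definition xk {R : realType} (k : nat) : R :=
  (Num.sqrt ((2 * k + 1)%:R) - 1) / (Num.sqrt ((2 * k + 1)%:R) + 1).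

Definition alphak {R : realType} (k : nat) : R :=
  Num.sqrt ((2 * k + 1)%:R) * ln (xk k).

Definition K1 {R : realType} (a b k : nat) : R :=
  if odd k then - ((b - 2 * a)%:R / 2) * ln (k%:R) + (3 * (b - 2 * a))%:R / 2 * ln 2
  else - ((b - 2 * a)%:R / 2) * ln ((k./2)%:R).

(* Main.v *)
Require Import Defs.
From HB Require Import structures.
From mathcomp Require Import all_boot all_order all_algebra.
From mathcomp Require Import all_classical all_reals all_analysis.
From mathcomp Require Import complex.
From mathcomp Require Import ring lra zify.
Set Implicit Arguments. Unset Strict Implicit. Unset Printing Implicit Defensive.
Import Order.TTheory GRing.Theory Num.Theory.
Import numFieldNormedType.Exports.
Local Open Scope classical_set_scope.
Local Open Scope ring_scope.

(** With h1, h2, h3 the integers such that 2 h_i + 1 = (b - 4a) n, (b - 2a) n, b n, let T be the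
    product of the three odd polynomials C(X + h_i, 2 h_i + 1), and write u = ln x.  The
    sums of T(l) x^l and of T'(l) x^l over l >= 0 are rational functions of x, and expanding them in
    powers of x / (1 - x)^2 = k / 2 shows that, after multiplication by d_(bn) / Delta and a weight
    of growth rate K_1, they give integers q and p with q alpha_k - p proportional to the sum of
    (u T + T')(l) e^(u l).

    The terms T(l) x^l are nonnegative.  Up to polynomial factors they are products of three
    binomial probabilities whose parameters, read off z_0, make them peak at the same l: hence
    the growth rate M_1.

    By Poisson summation the sum of (u T + T')(l) e^(u l) is the sum over r of the Laplace
    transforms of u T + T' at - (u + 2 pi i r), that is, of - 2 pi i r times the transform of T, so
    that the term r = 0 disappears.  The summation may start at any zero of T, in particular near
    - n (Re z_1 + b / 2).  Rotating the ray of integration onto the vertical line through this zero, each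
    remaining term is bounded, up to a power of n, by the maximum of |T| e^(- 2 pi y), which is
    attained near the height y = n Im z_1: hence the rate M_2.  A lemma of Hata on linear forms concludes. *)

(** * Power series with polynomial coefficients *)

(** No integral is taken: [zsum] and [laplace] are finite algebraic expressions, Poisson summation
    is first an exact identity over the N-th roots of x, and letting N grow replaces integrals and
    their estimates. Three points shape the rest. The sum must start at a double zero of T, so that
    u T + T' vanishes there and the terms decay like 1 / r^2 uniformly in N; the bound Re z_1 > a -
    b, extracted from the arguments in the equation of z_1, guarantees this. The estimate of |T|
    along the vertical line must leave a margin e below e^(2 pi y), which makes the transform with r
    = 1 bounded uniformly; this costs a factor e^(O(e n)), and e is chosen last. Finally, the
    logarithm of |T| e^(- 2 pi y) has as derivative a sum of six arctangents minus 2 pi, and one of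
    the six lengths may be negative. The sum is then not monotone, and an argument on the sign of
    its deviation from 2 pi replaces concavity. *)

Section Zsum.
Variable F : fieldType.
Implicit Types (P Q : {poly F}) (X : F) (i j l m n N : nat).

Definition fdiff P : {poly F} := P \Po ('X + 1) - P.

Lemma fdiff_linear : linear fdiff.
Proof. by move=> c P Q; rewrite /fdiff comp_polyD comp_polyZ scalerBr opprD addrACA. Qed.

HB.instance Definition _ := GRing.isLinear.Build F {poly F} {poly F} _ fdiff fdiff_linear.

Lemma size_XD1 : size ('X + 1 : {poly F}) = 2.
Proof. by rewrite -[1]opprK -polyC1 -polyCN size_XsubC. Qed.

Lemma size_fdiff P : (size (fdiff P) <= (size P).-1)%N.
Proof.
have [->|P0] := eqVneq P 0; first by rewrite linear0 size_poly0.
have sc : size (P \Po ('X + 1)) = size P.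
  by rewrite size_comp_poly2 ?size_XD1.
have lc : lead_coef (P \Po ('X + 1)) = lead_coef P.
  rewrite lead_coef_comp ?size_XD1 //.
  by rewrite -[1]opprK -polyC1 -polyCN lead_coefXsubC expr1n mulr1.
have sl : (size (fdiff P) <= size P)%N.
  by rewrite (leq_trans (size_polyD _ _)) // size_polyN sc maxnn.
have sP : (0 < size P)%N by rewrite size_poly_gt0.
apply/leq_sizeP => j hj.
have [hlt|hge] := ltnP j (size P).
  have -> : j = (size P).-1 by move: hj hlt sP; lia.
  by move: lc; rewrite !lead_coefE sc coefB => ->; rewrite subrr.
by rewrite nth_default // (leq_trans sl).
Qed.

Lemma size_iter_fdiff P i : (size (iter i fdiff P) <= size P - i)%N.
Proof.
elim: i => [|i IH]; first by rewrite subn0.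
by rewrite iterS (leq_trans (size_fdiff _)) //; move: IH; lia.
Qed.

Lemma iter_fdiff_linear i : linear (iter i fdiff).
Proof. by elim: i => // i IH c P Q; rewrite !iterS IH linearP. Qed.

(* The rational function of X with power series [sum_l P(l) X^l]; by the junk value [1 / 0 = 0] it is [0] at [X = 1]. *)
Definition zsum X P : F :=
  \sum_(i < size P) (iter i fdiff P).[0] * (X ^+ i / (1 - X) ^+ i.+1).

Lemma zsum_widen n X P : (size P <= n)%N ->
  zsum X P = \sum_(i < n) (iter i fdiff P).[0] * (X ^+ i / (1 - X) ^+ i.+1).
Proof.
move=> hn; rewrite /zsum -(big_mkord xpredT (fun i =>
  (iter i fdiff P).[0] * (X ^+ i / (1 - X) ^+ i.+1))).
rewrite -(big_mkord xpredT (fun i =>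
  (iter i fdiff P).[0] * (X ^+ i / (1 - X) ^+ i.+1))).
rewrite (big_cat_nat (n := size P) (p := n)) //= [X in _ = _ + X]big1_seq ?addr0 //.
move=> i /andP[_]; rewrite mem_index_iota => /andP[h1 h2].
have : (size (iter i fdiff P) <= 0)%N by rewrite (leq_trans (size_iter_fdiff _ _)) // leqn0 subn_eq0.
by rewrite leqn0 size_poly_eq0 => /eqP ->; rewrite horner0 mul0r.
Qed.

Lemma zsum_linear X : linear_for *%R (zsum X).
Proof.
move=> c P Q; pose n := maxn (size (c *: P + Q)) (maxn (size P) (size Q)).
rewrite !(@zsum_widen n) /n ?leq_max ?leqnn ?orbT // mulr_sumr -big_split /=.
by apply: eq_bigr => i _; rewrite iter_fdiff_linear hornerD hornerZ mulrDl mulrA.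
Qed.

HB.instance Definition _ X := GRing.isLinear.Build F {poly F} F _ (zsum X) (zsum_linear X).

Lemma comp_fdiff P : P \Po ('X + 1) = P + fdiff P.
Proof. by rewrite /fdiff [RHS]addrC subrK. Qed.

(** [zsum] sums the Newton expansion of P term by term; splitting off its constant term is summation
    by parts. As [fdiff] lowers the degree, this identity drives the inductions on the size of P. *)
Lemma zsum_fdiff X P : X != 1 -> (1 - X) * zsum X P = P.[0] + X * zsum X (fdiff P).
Proof.
move=> X1; have X1' : 1 - X != 0 by rewrite subr_eq0 eq_sym.
rewrite (@zsum_widen (size P).+1 X P) // (@zsum_widen (size P) X (fdiff P)); last first.
  by rewrite (leq_trans (size_fdiff _)) // leq_pred.
rewrite big_ord_recl /= mulrDr expr0 expr1 div1r mulrCA divff // mulr1; congr (_ + _).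
rewrite !mulr_sumr; apply: eq_bigr => i _.
rewrite -iterSr /bump /= add1n !exprS; field.
by rewrite expf_neq0.
Qed.

Lemma zsum_rec X P : X != 1 -> zsum X P = P.[0] + X * zsum X (P \Po ('X + 1)).
Proof.
move=> X1; rewrite comp_fdiff linearD /= mulrDr addrCA -zsum_fdiff //; ring.
Qed.

(** The recurrence determines phi on P from its value on [fdiff P], hence everywhere by induction on
    the degree. Other expressions of the same rational function are thus recognized without any
    convergence. *)
Lemma zsum_unique X (phi : {poly F} -> F) : X != 1 -> linear_for *%R phi ->
  (forall P, phi P = P.[0] + X * phi (P \Po ('X + 1))) -> phi =1 zsum X.
Proof.
move=> X1 lphi rphi P.
have X1' : 1 - X != 0 by rewrite subr_eq0 eq_sym.
have phiD A B : phi (A + B) = phi A + phi B by rewrite -[A]scale1r lphi mul1r scale1r.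
have phi0 : phi 0 = 0 by apply: (@addrI _ (phi 0)); rewrite -phiD !addr0.
elim: {P}(size P) {-2}P (leqnn (size P)) => [|n IH] P hP.
  by move: hP; rewrite leqn0 size_poly_eq0 => /eqP ->; rewrite phi0 linear0.
apply: (mulfI X1'); rewrite zsum_fdiff // -IH.
  by rewrite mulrBl mul1r {1}rphi comp_fdiff phiD; ring.
by rewrite (leq_trans (size_fdiff _)) //; move: hP; lia.
Qed.

Lemma comp_XDnat P l m :
  (P \Po ('X + l%:R%:P)) \Po ('X + m%:R%:P) = P \Po ('X + (l + m)%:R%:P).
Proof.
by rewrite -comp_polyA comp_polyD comp_polyX comp_polyC natrD polyCD -addrA [m%:R%:P + _]addrC.
Qed.

Lemma zsum_shift m X P : X != 1 ->
  zsum X P = \sum_(l < m) P.[l%:R] * X ^+ l + X ^+ m * zsum X (P \Po ('X + m%:R%:P)).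
Proof.
move=> X1; elim: m => [|m IH]; first by rewrite big_ord0 add0r addr0 comp_polyXr mul1r.
rewrite big_ord_recr /= IH -addrA; congr (_ + _).
rewrite zsum_rec // horner_comp hornerD hornerX hornerC add0r.
have -> : 'X + 1 = 'X + 1%:R%:P :> {poly F} by rewrite polyC1.
rewrite comp_XDnat addn1 mulrDr exprSr; ring.
Qed.

(* Substitute for Poisson summation: as [N] grows, each N-th root of X contributes a Laplace transform of P. *)
Lemma zsum_roots N X (w : 'I_N -> F) P : (0 < N)%N -> N%:R != 0 :> F -> X != 1 ->
  (forall r, w r ^+ N = X) ->
  (forall l, (0 < l < N)%N -> \sum_r w r ^+ l = 0) ->
  zsum X P = N%:R^-1 * \sum_r zsum (w r) (P \Po (N%:R^-1 *: 'X)).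
Proof.
move=> N0 NF X1 wN ws; symmetry.
have w1 r : w r != 1 by apply: contra_neq X1 => e; rewrite -(wN r) e expr1n.
apply: (@zsum_unique X (fun P => N%:R^-1 * \sum_r zsum (w r) (P \Po (N%:R^-1 *: 'X))) X1 _ _ P) => [c A B|{}P].
  rewrite [c * _]mulrCA -mulrDr [c * _]mulr_sumr -big_split /=; congr (_ * _); apply: eq_bigr => r _.
  by rewrite comp_polyD comp_polyZ linearP.
(* Shifting each summand by N steps brings out [w r ^+ N = X], which is the recurrence for X; among
   the N boundary terms, orthogonality of the roots leaves only the one at 0. *)
under eq_bigr => r _.
  rewrite (zsum_shift N) // wN.
  rewrite (_ : (P \Po _) \Po _ = (P \Po ('X + 1)) \Po (N%:R^-1 *: 'X)); last first.
    rewrite -!comp_polyA; congr (P \Po _).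
    rewrite comp_polyZ comp_polyX comp_polyD comp_polyX -(polyC1 F) comp_polyC scalerDr.
    by rewrite -[_ *: _%:P]mul_polyC -polyCM mulVf.
  over.
rewrite big_split /= mulrDr -mulr_sumr; congr (_ + _); last by rewrite mulrCA.
rewrite exchange_big /= (bigD1 (Ordinal N0)) //= [X in _ + X]big1 => [|l l0].
  under eq_bigr do rewrite expr0 mulr1.
  rewrite sumr_const card_ord addr0 -[P.[0] in RHS](mulKf NF) mulr_natl.
  by rewrite horner_comp hornerZ hornerX mulr0.
rewrite -mulr_sumr ws ?mulr0 // ltn_ord andbT lt0n.
by apply: contra l0 => /eqP e; apply/eqP/val_inj.
Qed.
End Zsum.

Lemma map_fdiff (F K : fieldType) (f : {rmorphism F -> K}) (P : {poly F}) :
  map_poly f (fdiff P) = fdiff (map_poly f P).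
Proof. by rewrite /fdiff rmorphB /= map_comp_poly rmorphD /= map_polyX rmorph1. Qed.

Lemma zsum_map (F K : fieldType) (f : {rmorphism F -> K}) (X : F) (P : {poly F}) :
  zsum (f X) (map_poly f P) = f (zsum X P).
Proof.
rewrite /zsum size_map_poly rmorph_sum; apply: eq_bigr => i _.
rewrite rmorphM /= fmorph_div !rmorphXn rmorphB rmorph1; congr (_ * _).
rewrite -horner_map rmorph0; congr horner.
by elim: (i : nat) => //= j ->; rewrite map_fdiff.
Qed.

Local Notation normc := Normc.normc.

(** * Limits of complex sequences and convergence of the power series *)

Section ComplexLimits.
Variable R : realType.
Implicit Types (z w : R[i]) (e : R).

Lemma normc_ge0 z : 0 <= normc z.
Proof. by case: z => a b; rewrite sqrtr_ge0. Qed.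

Lemma normc_real e : normc (e%:C)%C = `|e|.
Proof. by rewrite /= expr0n /= addr0 sqrtr_sqr. Qed.

Lemma ler_normc_sum (I : Type) (r : seq I) (P : pred I) (f : I -> R[i]) :
  normc (\sum_(i <- r | P i) f i) <= \sum_(i <- r | P i) normc (f i).
Proof.
elim/big_rec2: _ => [|i y z _ h]; first by rewrite Normc.normc0.
by rewrite (le_trans (le_normcD _ _)) // lerD2l.
Qed.

Lemma normcX z n : normc (z ^+ n) = normc z ^+ n.
Proof. by elim: n => [|n IH]; rewrite ?Normc.normc1 // !exprS Normc.normcM IH. Qed.

Lemma normc_nat n : normc (n%:R : R[i]) = n%:R.
Proof. by rewrite -(rmorph_nat (real_complex R)) normc_real normr_nat. Qed.

Lemma cvg0_le (u v : nat -> R) : (forall n, 0 <= u n <= v n) ->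
  v @ \oo --> 0 -> u @ \oo --> 0.
Proof. by move=> h; apply: squeeze_cvgr (@cvg_cst _ _ _ _ _); apply: nearW. Qed.

(* The library's topology on the complex numbers is that of the regular module [R[i]^o]. *)
Definition cvgC (u : nat -> R[i]) (l : R[i]) := (u : nat -> R[i]^o) @ \oo --> (l : R[i]^o).

Lemma cvgC_norm u l : cvgC u l <-> (fun n => normc (u n - l)) @ \oo --> (0 : R).
Proof.
split => [h|/cvgr0Pnorm_lt h].
  apply/cvgr0Pnorm_lt => e e0.
  have := (@cvgrPdist_lt _ _ _ _ _ _ _).1 h (e%:C)%C; rewrite ltcR => /(_ _ e0); apply: filterS => n.
  by rewrite distrC -[X in X < _ -> _]/((normc _)%:C)%C ltcR ger0_norm // normc_ge0.
apply/cvgrPdist_lt => e e0.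
have e1 : complex.Im e = 0 by apply: ger0_Im; apply: ltW.
have e2 : 0 < complex.Re e by move: e0; rewrite ltcE => /andP[].
have := h _ e2; apply: filterS => n.
rewrite distrC -[`|_ - l|]/((normc _)%:C)%C ltcE /= e1 eqxx /=.
by apply: le_lt_trans; rewrite ler_norm.
Qed.

Lemma cvgC_cst l : cvgC (fun=> l) l.
Proof. exact: cvg_cst. Qed.

Lemma cvgCD u v l m : cvgC u l -> cvgC v m -> cvgC (fun n => u n + v n) (l + m).
Proof. exact: cvgD. Qed.

Lemma cvgCM u v l m : cvgC u l -> cvgC v m -> cvgC (fun n => u n * v n) (l * m).
Proof. exact: cvgM. Qed.

Lemma cvgCV u l : l != 0 -> cvgC u l -> cvgC (fun n => (u n)^-1) l^-1.
Proof. by move=> l0 h; apply: cvgV. Qed.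

Lemma cvgCX u l k : cvgC u l -> cvgC (fun n => u n ^+ k) (l ^+ k).
Proof.
move=> h; elim: k => [|k IH]; first exact: cvgC_cst.
by under eq_fun do rewrite exprS; rewrite exprS; apply: cvgCM.
Qed.

Lemma cvgC_sum (I : Type) (r : seq I) (P : pred I) (f : I -> nat -> R[i]) (l : I -> R[i]) :
  (forall i, P i -> cvgC (f i) (l i)) ->
  cvgC (fun n => \sum_(i <- r | P i) f i n) (\sum_(i <- r | P i) l i).
Proof.
move=> h; elim: r => [|i r IH].
  rewrite big_nil [X in cvgC X _](_ : _ = fun=> 0); first exact: cvgC_cst.
  by apply/funext => n; rewrite big_nil.
rewrite big_cons; case: ifP => [Pi|nPi].
  rewrite [X in cvgC X _](_ : _ = fun n => f i n + \sum_(j <- r | P j) f j n).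
    exact: cvgCD (h i Pi) IH.
  by apply/funext => n; rewrite big_cons Pi.
rewrite [X in cvgC X _](_ : _ = fun n => \sum_(j <- r | P j) f j n) //.
by apply/funext => n; rewrite big_cons nPi.
Qed.

Lemma cvgR_sum (I : Type) (r : seq I) (P : pred I) (f : I -> nat -> R) (l : I -> R) :
  (forall i, P i -> f i @ \oo --> l i) ->
  (fun n => \sum_(i <- r | P i) f i n) @ \oo --> \sum_(i <- r | P i) l i.
Proof.
move=> h; elim: r => [|i r IH].
  by under eq_fun do rewrite big_nil; rewrite big_nil; apply: cvg_cst.
under eq_fun do rewrite big_cons; rewrite big_cons; case: ifP => // Pi.
by apply: cvgD => //; apply: h.
Qed.

Lemma cvgC_real (u : nat -> R) (l : R) : u @ \oo --> l ->
  cvgC (fun n => (u n)%:C%C) l%:C%C.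
Proof.
move=> h; apply/cvgC_norm; under eq_fun do rewrite -rmorphB normc_real.
by apply/norm_cvg0P; apply/subr_cvg0.
Qed.

Lemma cvgC_normc u l : cvgC u l -> (fun n => normc (u n)) @ \oo --> normc l.
Proof.
move=> /cvgC_norm h; apply/subr_cvg0; apply/norm_cvg0P; apply: cvg0_le h => n.
rewrite normr_ge0 /= ler_norml lerBlDr.
rewrite -[X in _ && (X <= _)](congr1 (@Normc.normc R) (subrK l (u n))) le_normcD andbT.
rewrite lerNl opprB lerBlDr -(opprB l) normcN.
by rewrite -[X in X <= _](congr1 (@Normc.normc R) (subrK (u n) l)) le_normcD.
Qed.

Lemma cvgC_le u l (v : nat -> R) (m : R) : cvgC u l -> v @ \oo --> m ->
  (forall n, normc (u n) <= v n) -> normc l <= m.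
Proof.
move=> /cvgC_normc hu hv h.
by rewrite -(cvg_lim (@Rhausdorff R) hu) -(cvg_lim (@Rhausdorff R) hv);
  apply: ler_lim; [apply: cvgP hu|apply: cvgP hv|apply: nearW].
Qed.

Lemma cvg_exprn_geometric k (r : R) : 0 <= r < 1 ->
  (fun n => n%:R ^+ k * r ^+ n) @ \oo --> 0.
Proof.
(* q lies between r and 1 and is positive, so that its logarithm is meaningful even when r = 0.
   Bounding the power k + 1 instead of k leaves the decay 1 / n. *)
move=> /andP[r0 r1]; pose q := (1 + r) / 2; pose d := - ln q.
have q0 : 0 < q by rewrite /q; lra.
have q1 : q < 1 by rewrite /q; lra.
have rq : r <= q by rewrite /q; lra.
have d0 : 0 < d by rewrite oppr_gt0 ln_lt0 ?q0.
pose K := k.+1`!%:R / d ^+ k.+1.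
have K0 : 0 <= K by rewrite divr_ge0 // exprn_ge0 // ltW.
apply: (@cvg0_le _ (fun n => (2 * (K + 1)) * n.+1%:R^-1)); last first.
  rewrite -[X in _ --> X](mulr0 (2 * (K + 1))); apply: cvgMl_tmp.
  exact: cvg_harmonic.
move=> n; apply/andP; split; first by rewrite mulr_ge0 ?exprn_ge0.
have [->|n0] := posnP n.
  apply: (@le_trans _ _ 1); last by rewrite invr1 mulr1; lra.
  by case: (k) => [|j]; rewrite ?expr0 ?mul1r // exprS !mul0r.
have n0' : 0 < n%:R :> R by rewrite ltr0n.
have h1 : r ^+ n <= expR (- (n%:R * d)).
  rewrite /d mulrN opprK expRM_natl lnK ?posrE //.
  by rewrite lerXn2r // ?nnegrE // ltW.
have h2 : (n%:R * d) ^+ k.+1 / k.+1`!%:R <= expR (n%:R * d).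
  by rewrite (le_trans _ (expR_ge1Dxn k _)) ?lerDr // mulr_ge0 // ltW.
have f0 : 0 < (k.+1)`!%:R :> R by rewrite ltr0n fact_gt0.
have h3 : n%:R ^+ k.+1 * expR (- (n%:R * d)) <= K.
  rewrite expRN ler_pdivrMr ?expR_gt0 // /K mulrAC ler_pdivlMr ?exprn_gt0 //.
  by rewrite -exprMn -ler_pdivrMl // mulrC.
have h3' : n%:R ^+ k.+1 * expR (- (n%:R * d)) <= K + 1 by rewrite (le_trans h3) // lerDl.
have h4 : n%:R * (n%:R ^+ k * r ^+ n) <= K + 1.
  by rewrite mulrA -exprS (le_trans _ h3') // ler_wpM2l // exprn_ge0.
have h5 : n%:R^-1 <= 2 / n.+1%:R :> R.
  rewrite ler_pdivlMr ?ltr0n // mulrC ler_pdivrMr //.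
  by rewrite -natrM ler_nat; move: n0; clear; lia.
apply: (@le_trans _ _ ((K + 1) * n%:R^-1)); first by rewrite ler_pdivlMr // mulrC.
by rewrite [2 * _]mulrC -mulrA ler_wpM2l // addr_ge0.
Qed.

Lemma cvgC_horner_geometric (P : {poly R[i]}) z : normc z < 1 ->
  cvgC (fun n => P.[n%:R] * z ^+ n) 0.
Proof.
move=> z1; apply/cvgC_norm.
apply: (@cvg0_le _ (fun n => \sum_(j < size P) normc P`_j * (n%:R ^+ j * normc z ^+ n))).
  move=> n; rewrite normc_ge0 subr0 horner_coef mulr_suml (le_trans (ler_normc_sum _ _ _)) //.
  by apply: ler_sum => j _; rewrite !Normc.normcM !normcX normc_nat mulrA.
rewrite [X in _ --> X](_ : 0 = \sum_(j < size P) normc P`_j * 0); last first.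
  by rewrite big1 // => j _; rewrite mulr0.
apply: cvgR_sum => j _; apply: cvgMl_tmp; apply: cvg_exprn_geometric.
by rewrite normc_ge0.
Qed.

(** Summation by parts on the partial sums gives the same recurrence as [zsum_fdiff], up to a
    boundary term P(N) z^N that tends to 0; induction on the degree concludes. *)
Lemma cvgC_zsum (P : {poly R[i]}) z : normc z < 1 ->
  cvgC (fun n => \sum_(l < n) P.[l%:R] * z ^+ l) (zsum z P).
Proof.
move=> z1; have zn1 : z != 1.
  by apply: contraTneq z1 => ->; rewrite Normc.normc1 ltxx.
have z1' : 1 - z != 0 by rewrite subr_eq0 eq_sym.
elim: {P}(size P) {-2}P (leqnn (size P)) => [|n IH] P hP.
  move: hP; rewrite leqn0 size_poly_eq0 => /eqP ->; rewrite linear0.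
  rewrite [X in cvgC X _](_ : _ = fun=> 0); first exact: cvgC_cst.
  by apply/funext => N; rewrite big1 // => l _; rewrite horner0 mul0r.
have -> : zsum z P = (P.[0] + z * zsum z (fdiff P) + (-1) * 0) / (1 - z).
  by rewrite mulr0 addr0 -zsum_fdiff // mulrC mulKf.
rewrite [X in cvgC X _](_ : _ = fun N => (P.[0] +
    z * (\sum_(l < N) (fdiff P).[l%:R] * z ^+ l) + (-1) * (P.[N%:R] * z ^+ N)) / (1 - z)); last first.
  apply/funext => N; apply: (mulIf z1'); rewrite mulfVK //.
  elim: N => [|N IHN]; first by rewrite !big_ord0 mulr0 mul0r expr0; ring.
  rewrite !big_ord_recr /= mulrDl IHN /fdiff hornerD hornerN horner_comp hornerD hornerX.
  by rewrite -polyC1 hornerC -natr1 exprS; ring.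
apply: cvgCM; last exact: cvgC_cst.
apply: cvgCD; last first.
  by apply: cvgCM; [exact: cvgC_cst|exact: cvgC_horner_geometric].
apply: cvgCD; first exact: cvgC_cst.
apply: cvgCM; first exact: cvgC_cst.
by apply: IH; apply: leq_trans (size_fdiff _) _; rewrite -subn1 leq_subLR add1n.
Qed.
End ComplexLimits.

(** * The complex exponential, built from the real functions *)

Section ComplexExponential.
Variable R : realType.
Implicit Types (a b c d t : R).

Definition cexp a b : R[i] := ((expR a * cos b) +i* (expR a * sin b))%C.

Lemma cexpD a b c d : cexp (a + c) (b + d) = cexp a b * cexp c d.
Proof.
rewrite /cexp; simpc; rewrite expRD cosD sinD.
by apply/eqP; rewrite eq_complex /=; apply/andP; split; apply/eqP; ring.
Qed.

Lemma cexp0 : cexp 0 0 = 1.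
Proof. by rewrite /cexp expR0 cos0 sin0 mulr0 mulr1. Qed.

Lemma cexpX a b n : cexp a b ^+ n = cexp (n%:R * a) (n%:R * b).
Proof.
elim: n => [|n IH]; first by rewrite !mul0r cexp0.
by rewrite exprS IH -cexpD -natr1 !mulrDl !mul1r ![_ + a]addrC ![_ + b]addrC.
Qed.

Lemma normc_cexp a b : Normc.normc (cexp a b) = expR a.
Proof.
by rewrite /= !exprMn -mulrDr cos2Dsin2 mulr1 sqrtr_sqr gtr0_norm ?expR_gt0.
Qed.

Lemma conjc_cexp a b : ((cexp a b)^*)%C = cexp a (- b).
Proof. by rewrite /cexp /= cosN sinN mulrN. Qed.

Lemma cexp_real a : cexp a 0 = (expR a)%:C%C.
Proof. by rewrite /cexp cos0 sin0 mulr0 mulr1. Qed.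

Lemma cexp_period a b : cexp a (b + pi *+ 2) = cexp a b.
Proof. by rewrite /cexp cosD2pi sinD2pi. Qed.

Lemma cvgC_pair (u v : nat -> R) a b : u @ \oo --> a -> v @ \oo --> b ->
  cvgC (fun n => (u n +i* v n)%C) (a +i* b)%C.
Proof.
move=> hu hv.
have e (x y : R) : (x +i* y)%C = (x%:C + 'i * y%:C)%C by simpc.
rewrite [X in cvgC X](_ : _ = fun n => ((u n)%:C + 'i * (v n)%:C)%C); last first.
  by apply/funext => n.
rewrite e; apply: cvgCD; first exact: cvgC_real.
by apply: cvgCM; [exact: cvgC_cst|exact: cvgC_real].
Qed.

Lemma cvg_derive_inv (f : R -> R) d : is_derive (0 : R) (1 : R) f d ->
  (fun n => n.+1%:R * (f n.+1%:R^-1 - f 0)) @ \oo --> d.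
Proof.
move=> [df <-].
have h : h^-1 *: (f (h *: 1 + 0) - f 0) @[h --> (0 : R)^'] --> 'D_1 f 0 := df.
have := (cvgr_dnbhsP _ _ _).1 h (fun n => n.+1%:R^-1).
rewrite [X in _ -> X @ _ --> _](_ : _ = (fun n => n.+1%:R * (f n.+1%:R^-1 - f 0))); last first.
  by apply/funext => n; rewrite /= invrK [_ *: 1]mulr1 addr0.
by apply; split => [n|]; [rewrite invr_eq0 pnatr_eq0|exact: cvg_harmonic].
Qed.

Lemma cvgC_cexp1 a b :
  cvgC (fun n => n.+1%:R * (1 - cexp (a / n.+1%:R) (b / n.+1%:R))) (- (a +i* b)%C).
Proof.
pose f t := 1 - expR (a * t) * cos (b * t).
pose g t := - (expR (a * t) * sin (b * t)).
have df : is_derive (0 : R) (1 : R) f (- a).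
  apply: trigger_derive; rewrite ?mulr0 ?expR0 ?cos0 ?sin0 /GRing.scale /=; ring.
have dg : is_derive (0 : R) (1 : R) g (- b).
  apply: trigger_derive; rewrite ?mulr0 ?expR0 ?cos0 ?sin0 /GRing.scale /=; ring.
have -> : (- (a +i* b))%C = ((- a) +i* (- b))%C by simpc.
rewrite [X in cvgC X](_ : _ = fun n : nat => ((n.+1%:R * (f n.+1%:R^-1 - f 0)) +i*
    (n.+1%:R * (g n.+1%:R^-1 - g 0)))%C); last first.
  apply/funext => n; rewrite /f /g /cexp !mulr0 expR0 cos0 sin0.
  rewrite -(rmorph_nat (real_complex R)); simpc.
  by apply/eqP; rewrite eq_complex /=; apply/andP; split; apply/eqP; ring.
by apply: cvgC_pair; apply: cvg_derive_inv.
Qed.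

Lemma cvg_inv_succ : (fun n => n.+1%:R^-1 : R) @ \oo --> (0 : R).
Proof. exact: cvg_harmonic. Qed.

Lemma cvgC_cexp0 a b : cvgC (fun n => cexp (a / n.+1%:R) (b / n.+1%:R)) 1.
Proof.
have h := cvgCM (cvgC_real cvg_inv_succ) (@cvgC_cexp1 a b).
have := cvgCD (@cvgC_cst R 1) (cvgCM (@cvgC_cst R (-1)) h).
rewrite rmorph0 mul0r mulr0 addr0; congr (cvgC _ _); apply/funext => n.
rewrite fmorphV rmorph_nat mulKf ?pnatr_eq0 //; ring.
Qed.

(** A crude Jordan inequality; only the order of magnitude matters. On [0, 1] the mean value theorem
    and cos >= 1/2 give t / 2; beyond 1, sin t >= sin 1 >= 1/2 while t < 2. *)
Lemma sin_ge t : 0 <= t <= pi / 2 -> t / 4 <= sin t.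
Proof.
move=> /andP[t0 t1].
have tl2 : t < 2 by rewrite (le_lt_trans t1) // pihalf_lt2.
have sle (x : R) : 0 <= x -> sin x <= x.
  move=> x0; have [->|xn0] := eqVneq x 0; first by rewrite sin0.
  have xp : 0 < x by rewrite lt0r xn0.
  have [c hc] := @MVT R sin cos 0 x xp (fun c _ => is_derive_sin c)
    (continuous_subspaceT (@continuous_sin R)).
  by rewrite sin0 !subr0 => ->; rewrite ler_piMl // cos_le1.
have sge (x : R) : 0 <= x <= 1 -> x / 2 <= sin x.
  move=> /andP[x0 x1].
  have [->|xn0] := eqVneq x 0; first by rewrite sin0 mul0r.
  have xp : 0 < x by rewrite lt0r xn0.
  have [c hc] := @MVT R sin cos 0 x xp (fun c _ => is_derive_sin c)
    (continuous_subspaceT (@continuous_sin R)).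
  rewrite sin0 !subr0 => ->; rewrite mulrC ler_wpM2r //.
  move: hc; rewrite in_itv /= => /andP[c0 c1].
  have -> : c = (c / 2) *+ 2 by rewrite -mulr_natr; field.
  rewrite cos_mulr2n cos2sin2.
  have s1 : sin (c / 2) <= c / 2 by apply: sle; rewrite divr_ge0 // ltW.
  have s0 : 0 <= sin (c / 2) by apply: sin_ge0_pi; have := pi_ge2 R; lra.
  have : sin (c / 2) ^+ 2 <= (1 / 2) ^+ 2 by rewrite lerXn2r ?nnegrE //; lra.
  rewrite -mulr_natr; lra.
have [tl|tg] := leP t 1; first by have := @sge t; rewrite t0 tl => /(_ isT) h; lra.
have s1 : 1 / 2 <= sin 1 :> R by apply: sge; lra.
have pi2 := pi_ge2 R.
have : sin 1 < sin t by rewrite ltr_sin // in_itv /=; apply/andP; split; lra.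
lra.
Qed.

Lemma normc_1Bcexp a b : a <= 0 -> 0 <= b <= pi ->
  expR (a / 2) * (b / 4) <= Normc.normc (1 - cexp a b).
Proof.
move=> a0 /andP[b0 b1].
have hs : b / 8 <= sin (b / 2).
  have := @sin_ge (b / 2); have -> : b / 2 / 4 = b / 8 by lra.
  by apply; apply/andP; split; lra.
have -> : 1 - cexp a b = ((1 - expR a * cos b) +i* (- (expR a * sin b)))%C.
  by rewrite /cexp; simpc.
rewrite /= -[X in X <= _]ger0_norm ?mulr_ge0 ?expR_ge0 ?divr_ge0 // -sqrtr_sqr ler_sqrt; last first.
  by rewrite addr_ge0 ?sqr_ge0.
(* The half-angle form separates the radial part, which is dropped, from the angular part, bounded
   below by [sin_ge]. *)
have -> : (1 - expR a * cos b) ^+ 2 + (- (expR a * sin b)) ^+ 2 =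
    (1 - expR a) ^+ 2 + 4 * expR a * sin (b / 2) ^+ 2.
  have -> : b = (b / 2) *+ 2 by rewrite -mulr_natr; field.
  rewrite cos_mulr2n sin_mulr2n -[_ / 2 *+ 2]mulr_natr mulfK ?pnatr_eq0 //.
  have := cos2sin2 (b / 2).
  set s := sin _; set E := expR a; set c := cos _ => h.
  have -> : (- (E * ((c * s) *+ 2))) ^+ 2 = 4 * E ^+ 2 * s ^+ 2 * c ^+ 2 by ring.
  rewrite h; ring.
have -> : expR a = expR (a / 2) ^+ 2 by rewrite -expRM_natl; congr expR; lra.
set E := expR _; set s := sin _ in hs *.
have hs2 : (b / 8) ^+ 2 <= s ^+ 2 by rewrite lerXn2r ?nnegrE //; lra.
have E2 : 0 <= E ^+ 2 by rewrite sqr_ge0.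
have h : E ^+ 2 * (b / 8) ^+ 2 <= E ^+ 2 * s ^+ 2 by rewrite ler_wpM2l.
have -> : (E * (b / 4)) ^+ 2 = 4 * (E ^+ 2 * (b / 8) ^+ 2) by field.
have := sqr_ge0 (1 - E ^+ 2); lra.
Qed.
End ComplexExponential.

Lemma coef_fdiff_Xn (F : fieldType) n : (fdiff ('X^(n.+1) : {poly F}))`_n = n.+1%:R.
Proof.
rewrite /fdiff comp_Xn_poly addrC exprDn coefD coefN coefXn eqn_leq ltnn andbF oppr0 add0r coef_sum.
under eq_bigr => i _ do rewrite expr1n mulr1 coefMn coefXn.
rewrite (bigD1 (Ordinal (isT : 1 < n.+2)%N)) //= subSS subn0 eqxx bin1 big1 ?addr0 // => i i1.
case: eqP => [e|]; last by rewrite mul0rn.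
by case/eqP: i1; apply: val_inj; move: e; case: i => /= i; lia.
Qed.

Lemma iter_fdiff_lead (F : fieldType) (P : {poly F}) i : (size P <= i.+1)%N ->
  (iter i (@fdiff F) P).[0] = P`_i * i`!%:R.
Proof.
elim: i P => [|i IH] P hP; first by rewrite /= horner_coef0 mulr1.
have hf : (size (fdiff P) <= i.+1)%N.
  by apply: leq_trans (size_fdiff _) _; rewrite -subn1 leq_subLR add1n.
rewrite iterSr IH // factS natrM mulrA; congr (_ * _).
have eP : P = P`_i.+1 *: 'X^(i.+1) + take_poly i.+1 P.
  rewrite -{1}(poly_take_drop i.+1 P) addrC; congr (_ + _).
  by rewrite [drop_poly _ _]size1_polyC ?coef_drop_poly ?add0n ?mul_polyC //
    size_drop_poly leq_subLR addn1.
rewrite {1}eP linearP /= coefD coefZ coef_fdiff_Xn [X in _ + X]nth_default ?addr0 //.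
apply: leq_trans (size_fdiff _) _; have := size_take_poly i.+1 P.
by case: (size _) => //.
Qed.

(** * Laplace transforms and Poisson summation *)

Section ScaledSums.
Variable R : realType.
Implicit Types (P Q : {poly R[i]}) (a b : R) (s : R[i]).

(** The closed form of the integral of P(y) e^(- s y) over y >= 0, extended to all s other than 0.
    Rotating the ray of integration then becomes the algebraic identity [laplace_rot]. *)
Definition laplace P s : R[i] := \sum_(i < size P) P`_i * i`!%:R / s ^+ i.+1.

(** The Riemann sum of step 1 / N, with N = n + 1, for the Laplace transform of P at - (a + i b),
    read as a rational function so that it also makes sense where the series diverges. *)
Definition rho a b n P : R[i] :=
  n.+1%:R^-1 * zsum (cexp (a / n.+1%:R) (b / n.+1%:R)) (P \Po (n.+1%:R^-1 *: 'X)).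

(** This is i! times the Stirling number of the second kind S(j, i). *)
Definition dcoef i j : R[i] := (iter i (@fdiff R[i]) 'X^j).[0].

(** This is N^i times the i-th difference at 0 of P(X / N). The truncated exponent is harmless,
    because [dcoef i j] vanishes when j < i. *)
Definition rcoef n P i := \sum_(j < size P) P`_j * n.+1%:R^-1 ^+ (j - i) * dcoef i j.

Lemma dcoef_lt i j : (j < i)%N -> dcoef i j = 0.
Proof.
move=> ji; have : (size (iter i (@fdiff R[i]) 'X^j) <= 0)%N.
  by apply: leq_trans (size_iter_fdiff _ _) _; rewrite size_polyXn leqn0 subn_eq0.
by rewrite leqn0 size_poly_eq0 /dcoef => /eqP ->; rewrite horner0.
Qed.

Lemma dcoef_diag i : dcoef i i = i`!%:R.
Proof. by rewrite /dcoef iter_fdiff_lead ?size_polyXn // coefXn eqxx mul1r. Qed.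

Lemma size_comp_scale P n : size (P \Po (n.+1%:R^-1 *: 'X)) = size P.
Proof. by rewrite size_comp_poly2 // size_scale ?size_polyX // invr_eq0 pnatr_eq0. Qed.

Lemma iter_fdiff_sum i k (c : 'I_k -> R[i]) (Q : 'I_k -> {poly R[i]}) :
  iter i (@fdiff R[i]) (\sum_j c j *: Q j) = \sum_j c j *: iter i (@fdiff R[i]) (Q j).
Proof.
elim/big_rec2: _ => [|j A B _ <-]; last exact: iter_fdiff_linear.
by elim: i => //= i ->; rewrite linear0.
Qed.

(** The powers of N are distributed so that each factor converges: [rcoef] to i! times a coefficient
    of P, and N (1 - w) to - (a + i b). *)
Lemma rhoE a b n P :
  rho a b n P = \sum_(i < size P) rcoef n P i *
    (cexp (a / n.+1%:R) (b / n.+1%:R) ^+ i / (n.+1%:R * (1 - cexp (a / n.+1%:R) (b / n.+1%:R))) ^+ i.+1).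
Proof.
rewrite /rho /zsum size_comp_scale mulr_sumr; apply: eq_bigr => i _.
set w := cexp _ _.
set N := n.+1%:R; have N0 : N != 0 by rewrite pnatr_eq0.
have -> : (iter i (@fdiff _) (P \Po (N^-1 *: 'X))).[0] = N^-1 ^+ i * rcoef n P i.
  have -> : P \Po (N^-1 *: 'X) = \sum_(j < size P) (P`_j * N^-1 ^+ j) *: 'X^j.
    rewrite comp_polyE; apply: eq_bigr => j _.
    by rewrite exprZn scalerA.
  rewrite iter_fdiff_sum horner_sum mulr_sumr; apply: eq_bigr => j _.
  rewrite hornerZ -/(dcoef i j); have [ji|ij] := ltnP j i.
    by rewrite dcoef_lt ?mulr0.
  have -> : N^-1 ^+ j = N^-1 ^+ i * N^-1 ^+ (j - i) by rewrite -exprD subnKC.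
  ring.
have -> : ((N * (1 - w)) ^+ i.+1)^-1 = N^-1 * N^-1 ^+ i * ((1 - w) ^+ i.+1)^-1.
  by rewrite exprMn invfM -exprS exprVn.
ring.
Qed.

Lemma normc_rcoef n P i : normc (rcoef n P i) <= \sum_(j < size P) normc (P`_j) * normc (dcoef i j).
Proof.
apply: le_trans (ler_normc_sum _ _ _) _; apply: ler_sum => j _.
rewrite !Normc.normcM -mulrA ler_wpM2l ?normc_ge0 // ler_piMl ?normc_ge0 //.
rewrite normcX Normc.normcV normc_nat exprn_ile1 ?invr_ge0 // invf_le1 ?ltr0n //.
by rewrite ler1n.
Qed.

Lemma cvgC_inv_succ : cvgC (fun n => (n.+1%:R)^-1) (0 : R[i]).
Proof.
rewrite -[0](rmorph0 (real_complex R)) [X in cvgC X](_ : _ = fun n => (n.+1%:R^-1)%:C%C).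
  exact/cvgC_real/cvg_inv_succ.
by apply/funext => n; rewrite fmorphV rmorph_nat.
Qed.

Lemma cvgC_rcoef P i : (i < size P)%N -> cvgC (fun n => rcoef n P i) (P`_i * i`!%:R).
Proof.
move=> iP.
have -> : P`_i * i`!%:R = \sum_(j < size P) P`_j * 0 ^+ (j - i) * dcoef i j.
  rewrite (bigD1 (Ordinal iP)) //= subnn mulr1 dcoef_diag big1 ?addr0 // => j ji.
  have [h|h|e] := ltngtP j i.
  - by rewrite dcoef_lt ?mulr0.
  - by rewrite expr0n subn_eq0 leqNgt h mulr0 mul0r.
  - by case/eqP: ji; apply: val_inj.
apply: cvgC_sum => j _; apply: cvgCM; last exact: cvgC_cst.
apply: cvgCM; first exact: cvgC_cst.
exact/cvgCX/cvgC_inv_succ.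
Qed.

Lemma cvgC_rho a b P : (a +i* b)%C != 0 ->
  cvgC (fun n => rho a b n P) (laplace P (- (a +i* b)%C)).
Proof.
move=> ab0; rewrite [X in cvgC X](funext (fun n => rhoE a b n P)).
apply: cvgC_sum => i _; rewrite -[X in cvgC _ X]mulrA.
have -> : P`_i * (i`!%:R / (- (a +i* b)%C) ^+ i.+1) =
  (P`_i * i`!%:R) * (1 ^+ i / (- (a +i* b)%C) ^+ i.+1) by rewrite expr1n div1r mulrA.
apply: cvgCM; first exact: cvgC_rcoef.
apply: cvgCM; first exact/cvgCX/cvgC_cexp0.
apply: cvgCV; first by rewrite expf_neq0 // oppr_eq0.
exact/cvgCX/cvgC_cexp1.
Qed.

(* A nonzero constant coefficient would only give the decay 1/r. *)
Lemma rho_decay a P : a <= 0 -> P.[0] = 0 ->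
  {C : R | 0 <= C & forall r n, (0 < r)%N -> (r.*2 <= n)%N ->
    normc (rho a (pi *+ 2 * r%:R) n P) <= C / r%:R ^+ 2}.
Proof.
move=> a0 P0; pose c := expR (a / 2).
have c0 : 0 < c by rewrite expR_gt0.
pose K i := \sum_(j < size P) normc (P`_j) * normc (dcoef i j).
have K0 i : 0 <= K i by rewrite sumr_ge0 // => j _; rewrite mulr_ge0 ?normc_ge0.
exists (\sum_(i < size P) K i * c^-1 ^+ i.+1).
  by rewrite sumr_ge0 // => i _; rewrite mulr_ge0 // exprn_ge0 // invr_ge0 ltW.
move=> r n r0 rn; rewrite rhoE mulr_suml (le_trans (ler_normc_sum _ _ _)) //.
apply: ler_sum => -[i iP] _ /=; rewrite Normc.normcM.
have r0' : 0 < r%:R :> R by rewrite ltr0n.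
case: i iP => [|i] iP.
  suff -> : rcoef n P 0 = 0.
    by rewrite Normc.normc0 mul0r divr_ge0 ?exprn_ge0 // mulr_ge0 // exprn_ge0 // invr_ge0 ltW.
  rewrite /rcoef (bigD1 (Ordinal iP)) //= -horner_coef0 P0 !mul0r add0r big1 // => -[[|j] jP] j0.
    by case/eqP: j0; apply: val_inj.
  by rewrite /dcoef /= hornerXn expr0n mulr0.
rewrite -[X in _ <= X]mulrA; apply: ler_pM; rewrite ?normc_ge0 ?normc_rcoef //.
rewrite Normc.normcM Normc.normcV !normcX normc_cexp.
set D := Normc.normc _.
have N0 : 0 < n.+1%:R :> R by rewrite ltr0n.
have pi2 := pi_ge2 R.
(* Since 2 r <= n, the angle 2 pi r / N is at most pi, and [normc_1Bcexp] applies; c serves for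
   every N because a <= 0. *)
have Dr : c * r%:R <= D.
  rewrite /D Normc.normcM normc_nat mulrC -ler_pdivrMl // mulrC.
  have h2 : 2 * r%:R <= n.+1%:R :> R by rewrite -natrM ler_nat mul2n (leq_trans rn).
  have rN0 : 0 <= r%:R / n.+1%:R :> R by rewrite divr_ge0.
  have rN : r%:R / n.+1%:R <= 1 / 2 :> R by rewrite ler_pdivrMr //; lra.
  have pix : 2 * (r%:R / n.+1%:R) <= pi * (r%:R / n.+1%:R) :> R by rewrite ler_wpM2r.
  have hc : c <= expR (a / n.+1%:R / 2).
    rewrite ler_expR ler_wpM2r ?invr_ge0 // ler_pdivlMr //.
    by rewrite -[X in _ <= X]mulr1 ler_wnM2l // ler1n.
  rewrite -mulrA -[pi *+ 2]mulr_natl; apply: le_trans (@normc_1Bcexp R (a / n.+1%:R) _ _ _).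
  - rewrite mulrCA [_^-1 * _]mulrC; apply: ler_pM => //; first exact: ltW.
    by move: pix; move: (r%:R / n.+1%:R) => x; lra.
  - by rewrite mulr_le0_ge0 // invr_ge0 ltW.
  - have := ler_wpM2l (pi_ge0 R) rN; have := mulr_ge0 (pi_ge0 R) rN0.
    by move: (r%:R / n.+1%:R) => x; lra.
have D0 : 0 < D by rewrite (lt_le_trans _ Dr) // mulr_gt0.
rewrite exprVn -invfM -[X in _ <= X]mul1r; apply: ler_pM.
- by rewrite exprn_ge0 // expR_ge0.
- by rewrite invr_ge0 exprn_ge0 // ltW.
- by rewrite exprn_ile1 ?expR_ge0 // expR_le1 mulr_le0_ge0 // invr_ge0 ltW.
have Dp : 0 < D ^+ i.+2 by apply: exprn_gt0.
have cp : 0 < c ^+ i.+2 * r%:R ^+ 2 by apply: mulr_gt0; apply: exprn_gt0.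
rewrite lef_pV2 ?posrE //.
apply: le_trans (_ : (c * r%:R) ^+ i.+2 <= _); last first.
  by rewrite lerXn2r // nnegrE ltW // mulr_gt0.
rewrite exprMn ler_wpM2l ?exprn_ge0 ?(ltW c0) //.
by rewrite ler_weXn2l // ler1n.
Qed.
End ScaledSums.

Section LaplaceTransforms.
Variable R : realType.
Implicit Types (P Q H : {poly R[i]}) (a b c d u S e y : R) (s : R[i]).

Lemma horner_scaleX P n l : (P \Po (n.+1%:R^-1 *: 'X)).[l%:R] = P.[(l%:R / n.+1%:R)%:C%C].
Proof.
rewrite horner_comp hornerZ hornerX; congr (_.[_]).
by rewrite mulrC rmorphM fmorphV !rmorph_nat.
Qed.

(** Termwise comparison of two convergent Riemann sums; in the limit it plays the role of the
    triangle inequality for integrals. The weight y^2 reflects the double zero of the polynomial in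
    the application. *)
Lemma normc_rho_le H c d e S n : 0 < c -> 0 < e ->
  (forall y, 0 <= y -> normc H.[y%:C%C] <= S * y ^+ 2 * expR ((c - e) * y)) ->
  normc (rho (- c) (- d) n H) <= S * normc (rho (- e) 0 n 'X^2).
Proof.
move=> c0 e0 hH; rewrite /rho !Normc.normcM mulrCA ler_wpM2l ?normc_ge0 //.
have N0 : 0 < n.+1%:R :> R by rewrite ltr0n.
have hw a b : 0 < a -> normc (cexp (- a / n.+1%:R) b) < 1.
  by move=> a0; rewrite normc_cexp expR_lt1 mulNr oppr_lt0 divr_gt0.
have cl := @cvgC_zsum R (H \Po (n.+1%:R^-1 *: 'X)) _ (hw c (- d / n.+1%:R) c0).
have cr := @cvgC_zsum R ('X^2 \Po (n.+1%:R^-1 *: 'X)) _ (hw e (0 / n.+1%:R) e0).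
have hr := cvgC_normc cr; have {}hr := @cvgMl_tmp _ _ _ _ _ S _ hr.
apply: (cvgC_le cl (hr _)) => L; rewrite /=.
have -> : \sum_(l < L) ('X^2 \Po (n.+1%:R^-1 *: 'X)).[l%:R] * cexp (- e / n.+1%:R) (0 / n.+1%:R) ^+ l =
    (\sum_(l < L) (l%:R / n.+1%:R) ^+ 2 * expR (- e * (l%:R / n.+1%:R)))%:C%C.
  rewrite rmorph_sum; apply: eq_bigr => l _; rewrite horner_scaleX hornerXn.
  rewrite cexpX mul0r mulr0 cexp_real -rmorphXn -rmorphM; congr (_ * expR _)%:C%C.
  by rewrite mulrCA.
rewrite normc_real ger0_norm; last first.
  by rewrite sumr_ge0 // => l _; rewrite mulr_ge0 ?sqr_ge0 ?expR_ge0.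
rewrite (le_trans (ler_normc_sum _ _ _)) // mulr_sumr; apply: ler_sum => l _.
rewrite Normc.normcM horner_scaleX cexpX normc_cexp.
have y0 : 0 <= l%:R / n.+1%:R :> R by rewrite divr_ge0 // ltW.
apply: le_trans (ler_wpM2r (expR_ge0 _) (hH _ y0)) _.
rewrite -!mulrA -expRD.
by have -> : (c - e) * (l%:R / n.+1%:R) + l%:R * (- c / n.+1%:R) = - e * (l%:R / n.+1%:R) by field.
Qed.

Lemma laplaceE m P s : (size P <= m)%N -> laplace P s = \sum_(i < m) P`_i * i`!%:R / s ^+ i.+1.
Proof.
move=> h; rewrite /laplace (big_ord_widen m (fun i => P`_i * i`!%:R / s ^+ i.+1) h) big_mkcond.
apply: eq_bigr => i _; case: ltnP => // hi.
by rewrite nth_default // !mul0r.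
Qed.

Lemma laplaceX2 s : laplace 'X^2 s = 2 / s ^+ 3.
Proof.
rewrite (@laplaceE 3) ?size_polyXn // 3!big_ord_recr big_ord0 /= !coefXn /= !mul0r !add0r.
by rewrite mul1r.
Qed.

Lemma laplace_deriv P s : P.[0] = 0 -> s != 0 -> laplace P^`() s = s * laplace P s.
Proof.
move=> P0 s0; rewrite (@laplaceE (size P)); last first.
  have [->|nz] := eqVneq P 0; first by rewrite deriv0.
  by rewrite ltnW // lt_size_deriv.
rewrite (@laplaceE (size P).+1 P) // big_ord_recl -horner_coef0 P0 !mul0r add0r mulr_sumr.
apply: eq_bigr => i _; rewrite coef_deriv lift0 factS natrM [s ^+ i.+2]exprS invfM -mulr_natr.
rewrite !mulrA; field.
by rewrite expf_neq0.
Qed.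

Lemma laplaceD P Q s : laplace (P + Q) s = laplace P s + laplace Q s.
Proof.
pose m := maxn (size (P + Q)) (maxn (size P) (size Q)).
rewrite !(@laplaceE m) ?leq_max ?leqnn ?orbT // -big_split; apply: eq_bigr => i _.
by rewrite coefD !mulrDl.
Qed.

Lemma laplaceZ k P s : laplace (k *: P) s = k * laplace P s.
Proof.
rewrite (@laplaceE (size P)) ?size_scale_leq // mulr_sumr; apply: eq_bigr => i _.
by rewrite coefZ !mulrA.
Qed.

(** The change of variable y -> i y in the transform, that is, the rotation of the ray of
    integration by a right angle. *)
Lemma laplace_rot P s : laplace (P \Po ('i%C *: 'X)) ('i%C * s) = - 'i%C * laplace P s.
Proof.
have i2 := sqr_i R; have i0 : 'i%C != 0 :> R[i] by apply/negP => /eqP/(congr1 (@complex.Im R))/eqP; rewrite oner_eq0.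
have e : P \Po ('i%C *: 'X) = \poly_(j < size P) (P`_j * 'i%C ^+ j).
  by rewrite comp_polyE poly_def; apply: eq_bigr => j _; rewrite exprZn scalerA.
rewrite (@laplaceE (size P)); last by rewrite e size_poly.
rewrite mulr_sumr; apply: eq_bigr => j _; rewrite e coef_poly ltn_ord exprMn ['i%C ^+ j.+1]exprS !invfM.
have -> : - 'i%C = 'i%C^-1 :> R[i] by apply: (mulIf i0); rewrite mulVf // mulNr -expr2 i2 opprK.
have A0 : 'i%C ^+ j != 0 :> R[i] by rewrite expf_neq0.
set A := 'i%C ^+ j in A0 *.
rewrite -[RHS]mul1r -(mulfV A0); ring.
Qed.
End LaplaceTransforms.

Lemma sum_invsq_le (R : realType) K M : (0 < K)%N ->
  \sum_(K.+1 <= j < M) (j%:R ^+ 2)^-1 <= K%:R^-1 :> R.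
Proof.
move=> K0; have K0' : 0 < K%:R :> R by rewrite ltr0n.
have [h|h] := leqP M K.+1; first by rewrite big_geq // invr_ge0 ltW.
suff H m : (K <= m)%N -> \sum_(K.+1 <= j < m.+1) (j%:R ^+ 2)^-1 <= K%:R^-1 - m%:R^-1 :> R.
  have hM : (K <= M.-1)%N by move: h; case: (M) => // m; rewrite ltnS => /ltnW.
  have := H _ hM; rewrite (ltn_predK h) => /le_trans; apply.
  by rewrite gerBl invr_ge0.
elim: m => [|m IH] Km; first by move: Km K0; rewrite leqn0 => /eqP ->.
have [e|Km'] := eqVneq K m.+1; first by rewrite e big_geq // subrr.
have {}Km : (K <= m)%N by rewrite -ltnS ltn_neqAle Km' Km.
rewrite big_nat_recr //=.
apply: le_trans (lerD (IH Km) (lexx _)) _.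
have m0 : 0 < m%:R :> R by rewrite ltr0n (leq_trans K0).
have m1 : 0 < m.+1%:R :> R by rewrite ltr0n.
suff : (m.+1%:R ^+ 2)^-1 <= m%:R^-1 - m.+1%:R^-1 :> R.
  by move=> h'; apply: le_trans (lerD (lexx _) h') _; rewrite addrA subrK.
have -> : m%:R^-1 - m.+1%:R^-1 = (m%:R * m.+1%:R)^-1 :> R.
  by rewrite -natr1; field; rewrite natr1 !gt_eqF.
by rewrite lef_pV2 ?posrE ?exprn_gt0 ?mulr_gt0 // expr2 ler_pM2r // ler_nat leqnSn.
Qed.

(** The number of roots is odd, so that r = 0 is the only index not paired with another one by r ->
    N - r. *)
Lemma sum_conj_bound (R : realType) (F : nat -> R[i]) M :
  (forall j, (0 < j <= M)%N -> Normc.normc (F (M.*2.+1 - j)%N) = Normc.normc (F j)) ->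
  Normc.normc (\sum_(j < M.*2.+1) F j) <=
    Normc.normc (F 0%N) + 2 * \sum_(1 <= j < M.+1) Normc.normc (F j).
Proof.
move=> hF; rewrite -(big_mkord xpredT F) (big_cat_nat (n := M.+1)) //=; last first.
  by rewrite ltnS -addnn leq_addr.
rewrite big_ltn //.
have e : \sum_(M.+1 <= j < M.*2.+1) Normc.normc (F j) = \sum_(1 <= j < M.+1) Normc.normc (F j).
  rewrite big_nat_rev /= (_ : \sum_(M.+1 <= _ < _) _ =
    \sum_(1 + M <= i < M.+1 + M) Normc.normc (F (M.+1 + M.*2.+1 - i.+1)%N)); last by rewrite add1n [(M.+1 + M)%N]addSn addnn.
  rewrite big_addn addnK; apply: eq_big_nat => j /andP[j1 jM].
  by rewrite -[RHS]hF ?j1 //; congr (Normc.normc (F _)); move: j1 jM; rewrite -addnn; lia.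
rewrite (le_trans (le_normcD _ _)) //.
have := ler_normc_sum (index_iota 1 M.+1) xpredT F.
have := ler_normc_sum (index_iota M.+1 M.*2.+1) xpredT F; rewrite e.
have := le_normcD (F 0%N) (\sum_(1 <= j < M.+1) F j).
rewrite /=; lra.
Qed.

Section RootsOfUnityAverages.
Variable R : realType.
Implicit Types (P Q H : {poly R[i]}) (a b c d u S e y : R) (s : R[i]).

Lemma sum_root_powers u n l : (0 < l < n.+1)%N ->
  \sum_(r < n.+1) cexp (u / n.+1%:R) (pi *+ 2 * r%:R / n.+1%:R) ^+ l = 0 :> R[i].
Proof.
move=> /andP[l0 ln]; have N0 : 0 < n.+1%:R :> R by rewrite ltr0n.
pose z := cexp 0 (l%:R * (pi *+ 2 / n.+1%:R)) : R[i].
under eq_bigr => r _.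
  have -> : cexp (u / n.+1%:R) (pi *+ 2 * r%:R / n.+1%:R) ^+ l =
      cexp (l%:R * (u / n.+1%:R)) 0 * z ^+ r.
    rewrite /z !cexpX -cexpD mulr0 addr0 add0r; congr cexp; ring.
  over.
rewrite -mulr_sumr; apply/eqP; rewrite mulf_eq0; apply/orP; right.
(* Half the argument of z is pi l / N, strictly between 0 and pi, so its sine does not vanish. *)
have z1 : z != 1.
  apply/eqP => /(congr1 (@complex.Re R)) /=; rewrite expR0 mul1r.
  set t := l%:R * _; have -> : t = (t / 2) *+ 2 by rewrite -mulr_natr; field.
  rewrite cos_mulr2n cos2sin2 => h.
  have : sin (t / 2) ^+ 2 = 0 by move: h; rewrite -mulr_natr; lra.
  move/eqP; rewrite sqrf_eq0; apply/negP; rewrite gt_eqF // sin_gt0_pi //.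
  have -> : t / 2 = pi * (l%:R / n.+1%:R) by rewrite /t -mulr_natr; field; rewrite gt_eqF.
  have p0 := pi_gt0 R.
  by rewrite mulr_gt0 ?divr_gt0 ?ltr0n //= gtr_pMr // ltr_pdivrMr // mul1r ltr_nat.
have := subrX1 z n.+1; rewrite cexpX mulr0.
have -> : n.+1%:R * (l%:R * (pi *+ 2 / n.+1%:R)) = pi *+ 2 * l%:R :> R.
  by field; rewrite gt_eqF.
have -> : cexp 0 (pi *+ 2 * l%:R) = 1 :> R[i].
  elim: (l) => [|j IH]; first by rewrite mulr0 cexp0.
  by rewrite -natr1 mulrDr mulr1 cexp_period.
by rewrite subrr => /esym/eqP; rewrite mulf_eq0 subr_eq0 (negPf z1).
Qed.

(** Poisson summation at finite level: the numbers e^((u + 2 pi i r) / N) are the N-th roots of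
    e^u. *)
Lemma zsum_rho u n P : u < 0 ->
  zsum (expR u)%:C%C P = \sum_(r < n.+1) rho u (pi *+ 2 * r%:R) n P.
Proof.
move=> u0; have N0 : n.+1%:R != 0 :> R by rewrite pnatr_eq0.
rewrite (@zsum_roots _ n.+1 _ (fun r => cexp (u / n.+1%:R) (pi *+ 2 * r%:R / n.+1%:R))) //.
- by rewrite mulr_sumr.
- by rewrite -(rmorph1 (real_complex R)) (inj_eq (@complexI R)) lt_eqF // expR_lt1.
- move=> r; rewrite cexpX -cexp_real; have -> : n.+1%:R * (u / n.+1%:R) = u :> R by field.
  have -> : n.+1%:R * (pi *+ 2 * r%:R / n.+1%:R) = pi *+ 2 * r%:R :> R by field.
  elim: (r : nat) => [|j IH]; first by rewrite mulr0.
  by rewrite -natr1 mulrDr mulr1 cexp_period.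
- by move=> l hl; apply: sum_root_powers.
Qed.

Lemma normc_conj s : normc (s^*)%C = normc s.
Proof. by case: s => x y; rewrite /= sqrrN. Qed.

Lemma rho_conj u b n (P : {poly R}) :
  rho u (- b) n (map_poly (real_complex R) P) = ((rho u b n (map_poly (real_complex R) P))^*)%C.
Proof.
have conjM (x y : R[i]) : ((x * y)^*)%C = (x^*)%C * (y^*)%C by exact: rmorphM.
pose cj := [the {rmorphism R[i] -> R[i]} of @conjc R].
rewrite /rho conjM conjc_inv conjc_nat -(zsum_map cj) [cj _]conjc_cexp mulNr; congr (_ * zsum _ _).
have -> : n.+1%:R^-1 = (n.+1%:R^-1)%:C%C :> R[i] by rewrite fmorphV rmorph_nat.
rewrite -(map_polyX (real_complex R)) -map_polyZ -map_comp_poly -map_poly_comp.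
by apply: eq_map_poly => x; rewrite /= -[x%:C%C in LHS](conjc_real x).
Qed.

Lemma normc_rho_opp u b n (P : {poly R}) :
  normc (rho u (- b) n (map_poly (real_complex R) P)) =
  normc (rho u b n (map_poly (real_complex R) P)).
Proof. exact: etrans (congr1 (@Normc.normc R) (rho_conj u b n P)) (normc_conj _). Qed.

Lemma rho_period u b n Q :
  rho u (n.+1%:R * (pi *+ 2) + b) n Q = rho u b n Q.
Proof.
have e : (n.+1%:R * (pi *+ 2) + b) / n.+1%:R = b / n.+1%:R + pi *+ 2 :> R.
  by rewrite mulrDl mulrAC divff ?pnatr_eq0 // mul1r addrC.
by rewrite /rho e cexp_period.
Qed.

Lemma normc_rho_sym u n r (P : {poly R}) : (r <= n.+1)%N ->
  normc (rho u (pi *+ 2 * (n.+1 - r)%:R) n (map_poly (real_complex R) P)) =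
  normc (rho u (pi *+ 2 * r%:R) n (map_poly (real_complex R) P)).
Proof.
move=> rn; apply: etrans (normc_rho_opp u (pi *+ 2 * r%:R) n P).
apply: (congr1 (@Normc.normc R)); apply: etrans (rho_period u (- (pi *+ 2 * r%:R)) n _).
have e : pi *+ 2 * (n.+1 - r)%:R = n.+1%:R * (pi *+ 2) - pi *+ 2 * r%:R :> R.
  by rewrite natrB // mulrBr mulrC.
by rewrite e.
Qed.
End RootsOfUnityAverages.

(** * From the averages over roots of unity to an estimate of the sum *)

Section PoissonBound.
Variable R : realType.
Implicit Types (H : {poly R[i]}) (P Q : {poly R}) (a b c d u S e y : R) (s : R[i]).

(** The limit of [normc_rho_le] as the step tends to 0; the factor 2 / e^3 is the transform of X^2
    at e. *)
Lemma laplace_bound H c d e S : 0 < c -> 0 < e ->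
  (forall y, 0 <= y -> normc H.[y%:C%C] <= S * y ^+ 2 * expR ((c - e) * y)) ->
  normc (laplace H (c +i* d)%C) <= S * (2 / e ^+ 3).
Proof.
move=> c0 e0 hH.
have n1 : ((- c) +i* (- d))%C != 0 :> R[i].
  by apply/eqP => /(congr1 (@complex.Re R)) /= /eqP; rewrite oppr_eq0 gt_eqF.
have n2 : ((- e) +i* 0)%C != 0 :> R[i].
  by apply/eqP => /(congr1 (@complex.Re R)) /= /eqP; rewrite oppr_eq0 gt_eqF.
have hl := @cvgC_rho R _ _ H n1; have hr := cvgC_normc (@cvgC_rho R _ _ 'X^2 n2).
have {}hr := @cvgMl_tmp _ _ _ _ _ S _ hr.
have := cvgC_le hl (hr _) (fun n => @normc_rho_le R H c d e S n c0 e0 hH); move: hl hr => _ _.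
have -> : - ((- c) +i* (- d))%C = (c +i* d)%C by simpc.
have -> : - ((- e) +i* 0)%C = e%:C%C by simpc.
rewrite laplaceX2 Normc.normcM Normc.normcV normcX normc_real normc_nat gtr0_norm //.
exact.
Qed.

Lemma laplace_shift (Q : {poly R[i]}) (v s : R[i]) : Q.[0] = 0 -> s != 0 ->
  laplace (v *: Q + Q^`()) s = (v + s) * laplace Q s.
Proof. by move=> Q0 s0; rewrite laplaceD laplaceZ laplace_deriv // mulrDl. Qed.

(** Dominated convergence by hand: the terms beyond K + 1 are bounded uniformly in N by [rho_decay],
    finitely many terms pass to the limit as N grows, and only then does K grow. *)
Lemma zsum_laplace_bound (P : {poly R}) u A : u < 0 -> P.[0] = 0 ->
  let PC := map_poly (real_complex R) P in
  (forall K, normc (laplace PC (- (u%:C%C))) +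
    2 * \sum_(1 <= r < K.+2) normc (laplace PC (- (u +i* (pi *+ 2 * r%:R))%C)) <= A) ->
  `|zsum (expR u) P| <= A.
Proof.
move=> u0 P0 PC hA.
have PC0 : PC.[0] = 0 by have := horner_map (real_complex R) P 0; rewrite P0 !rmorph0.
have [C C0 hC] := rho_decay (ltW u0) PC0.
pose F M r := rho u (pi *+ 2 * r%:R) M.*2 PC.
have zF M : `|zsum (expR u) P| <= normc (F M 0%N) + 2 * \sum_(1 <= r < M.+1) normc (F M r).
  rewrite -normc_real -(zsum_map (real_complex R)) (@zsum_rho R u M.*2) //.
  apply: (@sum_conj_bound R (F M)) => j /andP[j0 jM]; apply: normc_rho_sym.
  by rewrite (leq_trans jM) // -addnn ltnW // ltnS leq_addr.
have unz r : (u +i* (pi *+ 2 * r%:R))%C != 0 :> R[i].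
  by apply/eqP => /(congr1 (@complex.Re R)) /= /eqP; rewrite lt_eqF.
have dbl : (fun M : nat => M.*2) @ \oo --> \oo.
  move=> B [N _ hN]; exists N => // M /= NM; apply: hN => /=.
  by rewrite (leq_trans NM) // -addnn leq_addr.
have limF r : (fun M => normc (F M r)) @ \oo --> normc (laplace PC (- (u +i* (pi *+ 2 * r%:R))%C)).
  have := cvgC_normc (@cvgC_rho R _ _ PC (unz r)).
  by move=> h; apply: (cvg_comp _ _ dbl h).
have hK K : `|zsum (expR u) P| <= A + 2 * C / K.+1%:R.
  have lim1 : (fun M => normc (F M 0%N) + 2 * \sum_(1 <= r < K.+2) normc (F M r) + 2 * C / K.+1%:R) @ \oo -->
     normc (laplace PC (- (u +i* (pi *+ 2 * 0%:R))%C)) +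
     2 * \sum_(1 <= r < K.+2) normc (laplace PC (- (u +i* (pi *+ 2 * r%:R))%C)) + 2 * C / K.+1%:R.
    apply: cvgD; last exact: cvg_cst.
    apply: cvgD; first exact: limF.
    by apply: cvgMl_tmp; apply: cvgR_sum => r _; apply: limF.
  have := hA K; rewrite -[X in _ + _ <= X -> _](addrK (2 * C / K.+1%:R)) lerBrDr; apply: le_trans.
  have -> : u%:C%C = (u +i* (pi *+ 2 * 0%:R))%C :> R[i] by rewrite mulr0.
  apply: (cvgr_to_ge lim1); exists K.+1 => // M /= KM.
  apply: le_trans (zF M) _; rewrite (big_cat_nat (n := K.+2)) //= mulrDr addrA lerD2l -mulrA.
  rewrite ler_wpM2l //; apply: le_trans (_ : \sum_(K.+2 <= r < M.+1) C / r%:R ^+ 2 <= _).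
    rewrite big_nat_cond [X in _ <= X]big_nat_cond; apply: ler_sum => r /andP[/andP[r1 r2] _].
    apply: hC; first by rewrite (leq_trans _ r1).
    by rewrite leq_double -ltnS.
  by rewrite -mulr_sumr ler_wpM2l // sum_invsq_le.
have lim2 : (fun K : nat => A + 2 * C / K.+1%:R) @ \oo --> A + 2 * C * 0.
  apply: cvgD; first exact: cvg_cst.
  by apply: cvgMl_tmp; exact: cvg_inv_succ.
rewrite mulr0 addr0 in lim2; apply: (cvgr_to_ge lim2); apply: nearW => K; exact: hK.
Qed.

(** After rotation, the r-th transform is taken at a point of real part 2 pi r, against a growth of
    e^((2 pi - e) y): its margin is e for r = 1 and 2 pi (r - 1) + e in general. The two zeros at 0
    make u Q + Q' vanish there and justify the integration by parts. *)
Theorem poisson_bound (Q : {poly R}) u S e : u < 0 -> 0 < e -> 0 <= S ->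
  Q.[0] = 0 -> Q^`().[0] = 0 ->
  (forall y, 0 <= y -> normc (map_poly (real_complex R) Q).['i%C * y%:C%C] <=
     S * y ^+ 2 * expR ((pi *+ 2 - e) * y)) ->
  `|zsum (expR u) (u *: Q + Q^`())| <= 4 * S * (pi *+ 2 / e ^+ 3 + 2).
Proof.
move=> u0 e0 S0 Q0 Q1 hQ.
have P0 : (u *: Q + Q^`()).[0] = 0 by rewrite hornerD hornerZ Q0 Q1 mulr0 addr0.
apply: (zsum_laplace_bound u0 P0) => K.
set QC := map_poly _ Q in hQ.
have QC0 : QC.[0] = 0 by have := horner_map (real_complex R) Q 0; rewrite Q0 !rmorph0.
have -> : map_poly (real_complex R) (u *: Q + Q^`()) = u%:C%C *: QC + QC^`().
  by rewrite rmorphD /= map_polyZ deriv_map.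
rewrite laplace_shift //; last by rewrite oppr_eq0 -[0](rmorph0 (real_complex R)) (inj_eq (@complexI R)) lt_eqF.
rewrite subrr mul0r Normc.normc0 add0r.
have pi2 := pi_ge2 R.
have piD : pi *+ 2 = 2 * pi :> R by rewrite mulr_natl.
have hB r : normc (laplace (u%:C%C *: QC + QC^`()) (- (u +i* (pi *+ 2 * r.+1%:R))%C)) <=
    pi *+ 2 * r.+1%:R * (S * (2 / (pi *+ 2 * r%:R + e) ^+ 3)).
  set s := - _.
  have s0 : s != 0.
    by rewrite oppr_eq0; apply/eqP => /(congr1 (@complex.Re R)) /= /eqP; rewrite lt_eqF.
  rewrite laplace_shift // Normc.normcM.
  have -> : u%:C%C + s = - ('i%C * (pi *+ 2 * r.+1%:R)%:C%C).
    by rewrite /s; simpc.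
  have ni : normc 'i%C = 1 :> R by rewrite /= expr0n expr1n add0r sqrtr1.
  rewrite normcN Normc.normcM ni mul1r normc_real ger0_norm; last first.
    by rewrite mulr_ge0 // mulrn_wge0 // pi_ge0.
  apply: ler_wpM2l; first by rewrite mulr_ge0 // mulrn_wge0 // pi_ge0.
  have -> : normc (laplace QC s) = normc (laplace (QC \Po ('i%C *: 'X)) ('i%C * s)).
    by rewrite laplace_rot Normc.normcM normcN ni mul1r.
  have -> : 'i%C * s = ((pi *+ 2 * r.+1%:R) +i* (- u))%C by rewrite /s; simpc.
  apply: laplace_bound.
  - by rewrite mulr_gt0 ?ltr0n // piD; lra.
  - by rewrite ltr_wpDl // mulr_ge0 // mulrn_wge0 // pi_ge0.
  - move=> y y0; rewrite horner_comp hornerZ hornerX.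
    have -> : pi *+ 2 * r.+1%:R - (pi *+ 2 * r%:R + e) = pi *+ 2 - e.
      by rewrite -natr1; ring.
    exact: hQ.
suff H (G : nat -> R) :
    (forall r, G r.+1 <= pi *+ 2 * r.+1%:R * (S * (2 / (pi *+ 2 * r%:R + e) ^+ 3))) ->
    2 * \sum_(1 <= r < K.+2) G r <= 4 * S * (pi *+ 2 / e ^+ 3 + 2).
  exact: (H (fun r => normc (laplace (u%:C%C *: QC + QC^`()) (- (u +i* (pi *+ 2 * r%:R))%C))) hB).
move=> {}hB; rewrite big_ltn // mulrDr.
have h1 := hB 0%N; rewrite mulr0 add0r mulr1 in h1.
have h2 : \sum_(2 <= r < K.+2) G r <= 4 * S.
  rewrite big_add1.
  apply: le_trans (_ : \sum_(1 <= r < K.+1) 2 * S * (r%:R ^+ 2)^-1 <= _).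
    rewrite big_nat_cond [X in _ <= X]big_nat_cond; apply: ler_sum => r /andP[/andP[r1 r2] _].
    apply: le_trans (hB r) _.
    have r0 : 1 <= r%:R :> R by rewrite ler1n.
    (* For r >= 1 the cube in the denominator beats the numerator by 1 / r^2 independently of e;
       only the first transform feels the small margin. *)
    have -> : pi *+ 2 * r.+1%:R * (S * (2 / (pi *+ 2 * r%:R + e) ^+ 3)) =
      2 * S * (pi *+ 2 * r.+1%:R / (pi *+ 2 * r%:R + e) ^+ 3) by ring.
    apply: ler_wpM2l; first by rewrite mulr_ge0.
    rewrite -natr1; move: r0; set x : R := r%:R => x1.
    have p4 : 4 <= pi *+ 2 :> R by rewrite piD; lra.
    move: p4; set p : R := pi *+ 2 => p4.
    have p0 : 0 < p by lra.
    have d0 : 0 < p * x by rewrite mulr_gt0 //; lra.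
    have x2 : 0 < x ^+ 2 by rewrite exprn_gt0 //; lra.
    rewrite ler_pdivrMr; last by rewrite exprn_gt0 // addr_gt0.
    rewrite [X in _ <= X]mulrC ler_pdivlMr //.
    apply: le_trans (_ : (p * x) ^+ 3 <= _); last first.
      by rewrite lerXn2r ?nnegrE ?lerDl ?(ltW e0) ?(ltW d0) // addr_ge0 ?(ltW e0) ?(ltW d0).
    have -> : (p * x) ^+ 3 = p * (p * p * x) * x ^+ 2 by ring.
    apply: ler_wpM2r; first exact: ltW.
    apply: ler_wpM2l; first exact: ltW.
    have : 4 * 4 <= p * p by apply: ler_pM.
    nra.
  rewrite -mulr_sumr.
  have : \sum_(1 <= r < K.+1) (r%:R ^+ 2)^-1 <= 2 :> R.
    case: K {h1 hB} => [|K]; first by rewrite big_geq.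
    rewrite big_ltn // expr1n invr1.
    by have := @sum_invsq_le R 1 K.+2 isT; rewrite invr1; lra.
  move=> h; apply: le_trans (ler_wpM2l _ h) _; first by rewrite mulr_ge0.
  lra.
have -> : 4 * S * (pi *+ 2 / e ^+ 3 + 2) = 2 * (pi *+ 2 * (S * (2 / e ^+ 3))) + 2 * (4 * S) by ring.
by apply: lerD; apply: ler_wpM2l.
Qed.
End PoissonBound.

(** * Irrationality measures *)

Section IrrationalityMeasure.
Variable R : realType.
Implicit Types (alpha sigma tau d x y : R) (q p : nat -> int) (r : rat) (m : nat).

Definition oddn m : R := m.*2.+1%:R.

Lemma oddnS m : oddn m.+1 = oddn m + 2.
Proof. by rewrite /oddn doubleS -natrD addn2. Qed.

Lemma oddn_gt0 m : 0 < oddn m.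
Proof. by rewrite ltr0n. Qed.

(* No determinant is needed: let m1 be the first large index with [q m * r <> p m]. Since [q (m1 - 1) * r = p (m1 - 1)], the distance to r is so small that m1 is bounded in terms of the denominator of r. *)
Lemma rational_distance alpha sigma tau d q p M : 0 <= sigma -> 0 < d -> 3 * d < tau ->
  (forall m, (M <= m)%N -> expR ((sigma - d) * oddn m) <= `|(q m)%:~R| <= expR ((sigma + d) * oddn m)) ->
  (forall m, (M <= m)%N -> `|(q m)%:~R * alpha - (p m)%:~R| <= expR (- ((tau - d) * oddn m))) ->
  {C : R | forall r, ratr r != alpha ->
    expR (- ((sigma + d) / (tau - 3 * d) * (ln (2 * (denq r)%:~R) + C)) - ln (2 * (denq r)%:~R))
      <= `|alpha - ratr r|}.
Proof.
(* The first summand covers the case m1 = M; the second pays for the step of 2 from [oddn (m1 - 1)]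
   to [oddn m1]. *)
move=> s0 d0 d3 hq hp; exists (oddn M * tau + 2 * (sigma + tau)) => r ra.
set Q : R := (denq r)%:~R; have Q1 : 1 <= Q by rewrite /Q ler1z; have := denq_gt0 r; lia.
have Q2 : 0 < 2 * Q by lra.
have L0 : 0 <= ln (2 * Q) by rewrite ln_ge0 //; lra.
have eL : (2 * Q)^-1 = expR (- ln (2 * Q)) by rewrite expRN lnK.
have tau0 : 0 < tau - 3 * d by lra.
have tau1 : 0 < tau - d by lra.
(* For such m, |q alpha - p| is at most 1 / (2 Q), half the least nonzero value that |q r - p| can
   take. *)
pose small m := (M <= m)%N && (ln (2 * Q) <= (tau - d) * oddn m).
have exs : exists m, small m.
  pose B := Num.bound (ln (2 * Q) / (tau - d)).
  exists (maxn M B); rewrite /small leq_maxl /= [_ * oddn _]mulrC -ler_pdivrMr //.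
  have : ln (2 * Q) / (tau - d) < B%:R by apply: archi_boundP; rewrite divr_ge0 // ltW.
  move=> /ltW /le_trans; apply; rewrite /oddn ler_nat.
  by rewrite (leq_trans (leq_maxr M B)) // -addnn -addSn leq_addl.
have small_mono m m' : (m <= m')%N -> small m -> small m'.
  move=> mm /andP[h1 h2]; rewrite /small (leq_trans h1 mm) (le_trans h2) //.
  by rewrite ler_wpM2l ?(ltW tau1) // /oddn ler_nat ltnS leq_double.
pose nz m := small m && ((q m)%:~R * ratr r != (p m)%:~R :> R).
have dist m : (M <= m)%N -> (q m)%:~R * ratr r = (p m)%:~R :> R ->
    `|alpha - ratr r| <= expR (- ((sigma + tau - 2 * d) * oddn m)).
  move=> Mm e; have /andP[ql _] := hq _ Mm; have := hp _ Mm.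
  rewrite -e -mulrBr normrM => h.
  have E0 := expR_gt0 ((sigma - d) * oddn m).
  have : expR ((sigma - d) * oddn m) * `|alpha - ratr r| <= expR (- ((tau - d) * oddn m)).
    by apply: le_trans h; rewrite ler_wpM2r.
  rewrite mulrC -ler_pdivlMr // -expRB => /le_trans; apply.
  by rewrite ler_expR; lra.
have exnz : exists m, nz m.
  apply: contrapT => /forallNP hno; have [m0 hm0] := exs.
  suff : `|alpha - ratr r| = 0 by move/eqP; rewrite normr_eq0 subr_eq0 eq_sym (negPf ra).
  (* If q r = p for all large m, the distance is below every e^(- c n), hence 0; the inequality 1 +
     t <= e^t reduces this to the Archimedean property. *)
  have hd m : (m0 <= m)%N -> `|alpha - ratr r| * (1 + (sigma + tau - 2 * d) * oddn m) <= 1.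
    move=> mm; have sm := small_mono _ _ mm hm0.
    have Mm : (M <= m)%N by case/andP: sm.
    have e : (q m)%:~R * ratr r = (p m)%:~R :> R.
      by apply/eqP/negPn/negP => ne; apply: (hno m); rewrite /nz sm ne.
    have := dist _ Mm e; rewrite expRN -[X in _ <= X]div1r ler_pdivlMr ?expR_gt0 //.
    by apply: le_trans; rewrite ler_wpM2l // expR_ge1Dx.
  apply/eqP; rewrite eq_le normr_ge0 andbT leNgt; apply/negP => a0.
  pose B := maxn m0 (Num.bound ((`|alpha - ratr r| * (sigma + tau - 2 * d))^-1)).
  have st : 0 < sigma + tau - 2 * d by lra.
  have P0 : 0 < `|alpha - ratr r| * (sigma + tau - 2 * d) by rewrite mulr_gt0.
  have := hd B (leq_maxl _ _); rewrite mulrDr mulr1 mulrA leNgt; apply/negP/negPn.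
  rewrite (@lt_trans _ _ (`|alpha - ratr r| * (sigma + tau - 2 * d) * oddn B)) ?ltrDr //.
  rewrite mulrC -ltr_pdivrMr // div1r (lt_le_trans (archi_boundP _)) ?invr_ge0 ?(ltW P0) //.
  rewrite /oddn ler_nat (leq_trans (leq_maxr m0 _)) // -/B -addnn -addSn leq_addl //.
pose m1 := ex_minn exnz.
have [/andP[sm1 ne1] minm1] : nz m1 /\ forall m, nz m -> (m1 <= m)%N by rewrite /m1; case: ex_minnP.
have /andP[Mm1 Lm1] := sm1.
have low : expR (- ((sigma + d) * oddn m1) - ln (2 * Q)) <= `|alpha - ratr r|.
  have /andP[_ qu] := hq _ Mm1.
  have h1 : Q^-1 <= `|(q m1)%:~R * ratr r - (p m1)%:~R|.
    have Q0 : 0 < Q by lra.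
    have e : ((q m1)%:~R * ratr r - (p m1)%:~R) * Q = (q m1 * numq r - p m1 * denq r)%:~R.
      by rewrite rmorphB !rmorphM mulrBl -mulrA /ratr mulfVK // gt_eqF.
    rewrite -div1r ler_pdivrMr // -[X in _ * X](gtr0_norm Q0) -normrM e -intr_norm ler1z.
    have : q m1 * numq r - p m1 * denq r != 0.
      apply: contraNneq ne1 => z; move/eqP: e; rewrite z mulf_eq0 (gt_eqF Q0) orbF.
      by rewrite subr_eq0.
    by rewrite -normr_gt0; clear; lia.
  have h2 := hp _ Mm1.
  have h3 : expR (- ((tau - d) * oddn m1)) <= (2 * Q)^-1 by rewrite eL ler_expR lerN2.
  have h4 : (2 * Q)^-1 <= `|(q m1)%:~R * (alpha - ratr r)|.
    have e : (q m1)%:~R * ratr r - (p m1)%:~R =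
       ((q m1)%:~R * alpha - (p m1)%:~R) - (q m1)%:~R * (alpha - ratr r) by ring.
    have := ler_normB ((q m1)%:~R * alpha - (p m1)%:~R) ((q m1)%:~R * (alpha - ratr r)).
    rewrite -e => h5; have e2 : Q^-1 = 2 * (2 * Q)^-1 by field; rewrite gt_eqF //; lra.
    by move: h1 h2 h3 h5; rewrite e2; lra.
  rewrite expRD -eL expRN mulrC ler_pdivrMr ?expR_gt0 //.
  by apply: le_trans h4 _; rewrite normrM mulrC ler_wpM2l.
apply: (le_trans _ low); rewrite ler_expR lerD2r lerN2.
rewrite -mulrA ler_wpM2l //; first lra.
rewrite mulrC ler_pdivlMr //.
have oM := oddn_gt0 M.
have dM : 0 <= d * oddn M by rewrite mulr_ge0 // ltW.
have [e|lt] := eqVneq M m1; first by rewrite -e; lra.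
have {}lt : (M < m1)%N by rewrite ltn_neqAle lt.
move: (minm1 m1.-1) low; rewrite -(ltn_predK lt) /= oddnS; set m := m1.-1 => minm low.
have Mm : (M <= m)%N by rewrite /m -ltnS (ltn_predK lt).
have om := oddn_gt0 m.
have dm : 0 <= d * oddn m by rewrite mulr_ge0 // ltW.
have tM : 0 <= oddn M * tau by rewrite mulr_ge0 ?(ltW oM) //; lra.
have [sm|nsm] := boolP (small m); last first.
  by move: nsm; rewrite /small Mm /= -ltNge; lra.
have e : (q m)%:~R * ratr r = (p m)%:~R :> R.
  apply/eqP/negPn/negP => ne; have := minm; rewrite /nz sm ne => /(_ isT).
  by rewrite ltnn.
by have := le_trans low (dist _ Mm e); rewrite ler_expR; lra.
Qed.
End IrrationalityMeasure.

Section Hata.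
Variable R : realType.
Implicit Types (alpha sigma tau d x y : R) (q p : nat -> int) (r : rat) (m : nat).

Lemma finite_rat_bounded (B D : nat) :
  finite_set [set r : rat | (`|numq r| <= B)%N /\ (`|denq r| <= D)%N].
Proof.
pose f (x : nat * nat) : rat := (x.1%:Z - B%:Z)%:~R / x.2%:Z%:~R.
apply: (@sub_finite_set _ _ (f @` (`I_(2 * B).+1 `*` `I_D.+1))).
  move=> r [/= hn hd]; exists (absz (numq r + B%:Z), absz (denq r)).
    by split; rewrite /= ltnS //; move: hn; clear; lia.
  have d0 := denq_gt0 r.
  rewrite /f /= -[RHS]divq_num_den; congr (_%:~R / _%:~R); last by move: d0; clear; lia.
  by move: hn; clear; lia.
by apply: finite_image; apply: finite_setX; apply: finite_II.
Qed.

(** For kappa > 1 + sigma / tau, the lower bound of [rational_distance] has an exponent below kappa;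
    the denominators of the solutions are then bounded, and so are their numerators. *)
Theorem hata alpha sigma tau q p : 0 < tau ->
  (forall d, 0 < d -> \forall m \near \oo,
     expR ((sigma - d) * oddn R m) <= `|(q m)%:~R| <= expR ((sigma + d) * oddn R m)) ->
  (forall d, 0 < d -> \forall m \near \oo,
     `|(q m)%:~R * alpha - (p m)%:~R| <= expR (- ((tau - d) * oddn R m))) ->
  (irr_measure alpha <= (1 + sigma / tau)%:E)%E.
Proof.
move=> t0 hq hp.
have s0 : 0 <= sigma.
  rewrite leNgt; apply/negP => sn.
  have sn2 : 0 < - sigma / 2 by lra.
  have [M _ /(_ M (leqnn M))] := hq _ sn2 => /andP[h1 h2].
  have om := @oddn_gt0 R M.
  have : `|(q M)%:~R| < 1 :> R.
    by apply: le_lt_trans h2 _; rewrite expR_lt1 pmulr_llt0 //; lra.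
  rewrite -intr_norm ltrz1 => q0; have q00 : q M = 0 by move: q0; clear; lia.
  by move: h1; rewrite q00 normr0 leNgt expR_gt0.
apply: ge_ereal_sup => _ [kappa hk <-]; rewrite lee_fin leNgt; apply/negP => kb.
have st0 : 0 <= sigma / tau by rewrite divr_ge0 // ltW.
have g0 : 0 < (kappa - 1) * tau - sigma by rewrite subr_gt0 -ltr_pdivrMr //; lra.
set g := _ - sigma in g0.
have k1 : 0 < 2 * (1 + 3 * (kappa - 1)) by lra.
(* With this d, (kappa - 1) (tau - 3 d) - (sigma + d) is at least g / 2, so the perturbed exponent 1
   + th stays below kappa. *)
pose d := Num.min (tau / 6) (g / (2 * (1 + 3 * (kappa - 1)))).
have d0 : 0 < d by rewrite lt_min !divr_gt0.
have d6 : d <= tau / 6 by rewrite ge_min lexx.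
have d3 : 3 * d < tau by lra.
have dg : d * (2 * (1 + 3 * (kappa - 1))) <= g.
  by rewrite -ler_pdivlMr // ge_min lexx orbT.
pose th := (sigma + d) / (tau - 3 * d).
have t3 : 0 < tau - 3 * d by lra.
have thk : 0 < kappa - (1 + th).
  suff : th < kappa - 1 by lra.
  by rewrite ltr_pdivrMr //; move: dg g0; rewrite /g; lra.
have th0 : 0 <= th by rewrite divr_ge0 //; lra.
have [M1 _ hM1] := hq _ d0; have [M2 _ hM2] := hp _ d0.
have [C hC] := @rational_distance R alpha sigma tau d q p (maxn M1 M2) s0 d0 d3
  (fun m h => hM1 m (leq_trans (leq_maxl _ _) h)) (fun m h => hM2 m (leq_trans (leq_maxr _ _) h)).
pose c := (1 + th) * ln 2 + th * C.
pose D := Num.bound (expR (c / (kappa - (1 + th)))).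
pose B := Num.bound ((`|alpha| + 1) * D%:R).
(* A rational equal to alpha escapes [rational_distance], but there is at most one. *)
apply: hk; apply: (@sub_finite_set _ _ ([set r | (`|numq r| <= B)%N /\ (`|denq r| <= D)%N] `|`
   [set r | ratr r = alpha])); last first.
  rewrite finite_setU; split; first exact: finite_rat_bounded.
  have [[r0 hr0]|no] := pselect (exists r0, ratr r0 = alpha).
    apply: (@sub_finite_set _ _ [set r0]); last exact: finite_set1.
    by move=> r /= e; apply: (fmorph_inj (@ratr R)); rewrite /= e hr0.
  rewrite (_ : [set r | _] = set0) //; first by apply/seteqP; split => // r e; apply: no; exists r.
move=> r /= hr; have [e|ne] := eqVneq (ratr r) alpha; [by right|left].
have Q1 : 1 <= (denq r)%:~R :> R by rewrite ler1z; have := denq_gt0 r; clear; lia.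
set Q : R := (denq r)%:~R in hr Q1 *.
have Q0 : 0 < Q by lra.
have lQ : 0 <= ln Q by rewrite ln_ge0.
have k0 : 0 < kappa by lra.
have hQ : Q < expR (c / (kappa - (1 + th))).
  rewrite -[Q]lnK ?posrE // ltr_expR ltr_pdivlMr //.
  have := le_lt_trans (hC r ne) hr; rewrite -/Q -/th /powR gt_eqF // ltr_expR.
  rewrite lnM ?posrE // /c; lra.
have QD : Q < D%:R by apply: lt_trans hQ (archi_boundP _); rewrite expR_ge0.
have dD : (`|denq r| <= D)%N.
  by move: QD; rewrite /Q -[D%:R]/(D%:Z%:~R) ltr_int => /ltW; rewrite -(gtz0_abs (denq_gt0 r)) lez_nat.
split => //.
have ra : `|ratr r| < `|alpha| + 1.
  have h1 : `|alpha - ratr r| < 1.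
    apply: lt_le_trans hr _; rewrite powRN invf_le1 ?powR_gt0 //.
    by rewrite -[1](powRr0 Q) ler_powR // ltW.
  have -> : ratr r = alpha - (alpha - ratr r) by ring.
  by apply: le_lt_trans (ler_normB _ _) _; rewrite ltrD2l.
have : `|(numq r)%:~R| < B%:R :> R.
  have -> : (numq r)%:~R = ratr r * Q :> R by rewrite /ratr mulfVK // gt_eqF.
  rewrite normrM (gtr0_norm Q0); apply: lt_trans (archi_boundP _); last by rewrite mulr_ge0 // addr_ge0.
  by apply: ltr_pM => //; exact: ltW.
rewrite -intr_norm -[B%:R]/(B%:Z%:~R) ltr_int => /ltW; clear; lia.
Qed.
End Hata.

(** * Arithmetic of the linear forms *)

Section Binomials.
Variable R : realType.
Implicit Types (P Q : {poly R}) (x y : R).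

Definition ffp N : {poly R} := \prod_(i < N) ('X - i%:R%:P).
Definition binp N : {poly R} := (N`!%:R)^-1 *: ffp N.

Lemma fact_neq0 N : N`!%:R != 0 :> R.
Proof. by rewrite pnatr_eq0 -lt0n fact_gt0. Qed.

Lemma size_ffp N : size (ffp N) = N.+1.
Proof.
by rewrite /ffp (size_prod_XsubC (index_enum 'I_N) (fun i : 'I_N => i%:R : R)) /index_enum -enumT size_enum_ord.
Qed.

Lemma size_binp N : size (binp N) = N.+1.
Proof. by rewrite /binp size_scale ?size_ffp // invr_eq0 fact_neq0. Qed.

Lemma ffp_shift N : ffp N.+1 \Po ('X + 1) = ('X + 1) * ffp N.
Proof.
rewrite /ffp big_ord_recl rmorphM /= comp_polyB comp_polyX comp_polyC subr0; congr (_ * _).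
rewrite rmorph_prod; apply: eq_bigr => i _ /=.
rewrite comp_polyB comp_polyX comp_polyC /bump /= add1n -natr1 polyCD polyC1; ring.
Qed.

Lemma binp_shift N : binp N.+1 \Po ('X + 1) = binp N.+1 + binp N.
Proof.
rewrite /binp comp_polyZ ffp_shift {2}/ffp big_ord_recr /= -/(ffp N).
have -> : (N`!%:R)^-1 *: ffp N = (N.+1`!%:R)^-1 *: (N.+1%:R *: ffp N).
  by rewrite scalerA factS natrM invfM mulrAC mulVf ?mul1r // pnatr_eq0.
rewrite -scalerDr; congr (_ *: _); rewrite -mul_polyC -natr1 polyCD polyC1; ring.
Qed.

Lemma binp_nat N A : (binp N).[A%:R] = 'C(A, N)%:R.
Proof.
elim: N A => [|N IH] A.
  by rewrite bin0 /binp /ffp big_ord0 fact0 invr1 scale1r hornerC.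
elim: A => [|A IHA].
  by rewrite bin0n /= /binp hornerZ /ffp big_ord_recl hornerM hornerXsubC subrr mul0r mulr0.
rewrite binS natrD -IHA -IH -hornerD -binp_shift horner_comp hornerD hornerX.
by rewrite -polyC1 hornerC natr1.
Qed.

(** This is the operator identity D = ln (1 + Delta), with Delta the forward difference, applied to
    C(X, N). It displays the denominators 1, ..., N and keeps the same upper index A in every
    binomial coefficient, so that divisibility by a prime survives differentiation. *)
Lemma deriv_binp_nat N A :
  (binp N)^`().[A%:R] = \sum_(l < N) (-1) ^+ l / l.+1%:R * 'C(A, N - l.+1)%:R.
Proof.
elim: N A => [|N IH] A.
  by rewrite /binp /ffp big_ord0 big_ord0 fact0 invr1 scale1r derivC horner0.
elim: A => [|A IHA].
  rewrite big_ord_recr /= subnn bin0 mulr1 big1 ?add0r => [|l _]; last first.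
    by rewrite bin0n subSS subn_eq0 leqNgt ltn_ord mulr0.
  rewrite /binp derivZ hornerZ /ffp big_ord_recl derivM subr0 derivX mul1r hornerD hornerM hornerX.
  rewrite mul0r addr0 horner_prod factS natrM.
  have -> : \prod_(i < N) ('X - (lift ord0 i)%:R%:P).[0] = (-1) ^+ N * N`!%:R :> R.
    rewrite fact_prod natr_prod -(big_mkord xpredT (fun i => ('X - i.+1%:R%:P).[0] : R)) big_add1 /=.
    rewrite -{2}(subn0 N) -prodr_const_nat -big_split /=; apply: eq_bigr => i _.
    by rewrite hornerXsubC sub0r mulN1r.
  have : N.+1%:R != 0 :> R by rewrite pnatr_eq0.
  by move: (N.+1%:R : R) => c c0; field; rewrite c0 fact_neq0.
have -> : (binp N.+1)^`().[A.+1%:R] = (binp N.+1)^`().[A%:R] + (binp N)^`().[A%:R].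
  rewrite -hornerD -derivD -binp_shift deriv_comp hornerM horner_comp derivD derivX -polyC1 derivC addr0.
  by rewrite hornerC mulr1 hornerD hornerX hornerC natr1.
rewrite IHA IH !big_ord_recr /= subnn !bin0 -addrA [_ + \sum_(l < N) _]addrC addrA -big_split /=.
congr (_ + _); apply: eq_bigr => l _.
by rewrite subSn // binS natrD mulrDr.
Qed.

(** Its zeros are the 2 h + 1 integers from - h to h. *)
Definition cbin h : {poly R} := binp h.*2.+1 \Po ('X + h%:R%:P).

Lemma horner_shift P c x : (P \Po ('X + c%:P)).[x] = P.[x + c].
Proof. by rewrite horner_comp hornerD hornerX hornerC. Qed.

Lemma cbin_nat h m : (cbin h).[m%:R] = 'C(m + h, h.*2.+1)%:R.
Proof. by rewrite /cbin horner_shift -natrD binp_nat. Qed.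

Lemma deriv_cbin_nat h m : (cbin h)^`().[m%:R] =
  \sum_(l < h.*2.+1) (-1) ^+ l / l.+1%:R * 'C(m + h, h.*2.+1 - l.+1)%:R.
Proof.
rewrite /cbin deriv_comp derivD derivX derivC addr0 mulr1.
by rewrite horner_shift -natrD deriv_binp_nat.
Qed.

Lemma size_shift P c : size (P \Po ('X + c%:P)) = size P.
Proof. by rewrite size_comp_poly2 // -[c]opprK polyCN size_XsubC. Qed.

Lemma size_cbin h : size (cbin h) = h.*2.+2.
Proof. by rewrite /cbin size_shift size_binp. Qed.

Lemma hornerN_cbin h x : (cbin h).[- x] = - (cbin h).[x].
Proof.
rewrite /cbin !horner_shift /binp !hornerZ -mulrN; congr (_ * _).
rewrite /ffp !horner_prod -[RHS]mulN1r.
have -> : (-1 : R) = \prod_(i < h.*2.+1) (-1).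
  by rewrite prodr_const card_ord -addnn -addSn exprD exprS mulN1r mulNr -expr2 -exprM mulnC exprM sqrrN expr1n expr1n.
rewrite -big_split /= (reindex_inj rev_ord_inj) /=; apply: eq_bigr => i _.
rewrite !hornerXsubC subSS natrB; last by rewrite -ltnS.
have -> : h.*2%:R = h%:R + h%:R :> R by rewrite -addnn natrD.
ring.
Qed.
End Binomials.

(** * Integral expansions of odd and even polynomials *)

Section SymmetricExpansion.
Variable R : realType.
Implicit Types (P Q : {poly R}) (x y : R).
Local Notation binp := (@binp R).
Local Notation cbin := (@cbin R).

Lemma zsum_binp x N : x != 1 -> zsum x (binp N) = x ^+ N / (1 - x) ^+ N.+1.
Proof.
move=> x1; have x1' : 1 - x != 0 by rewrite subr_eq0 eq_sym.
elim: N => [|N IH]; apply: (mulfI x1'); rewrite zsum_fdiff // -[(_.[0])]/((_).[0%:R]) binp_nat.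
  have -> : binp 0 = 1%:P by rewrite /binp /ffp big_ord0 fact0 invr1 scale1r.
  by rewrite /fdiff comp_polyC subrr linear0 mulr0 addr0 expr1 div1r mulfV.
have -> : fdiff (binp N.+1) = binp N by rewrite /fdiff binp_shift addrC addKr.
rewrite bin0n add0r IH !exprS; field.
by rewrite ?expf_neq0 ?x1'.
Qed.

Lemma zsum_binp_shift x N h : x != 0 -> x != 1 -> (h <= N)%N ->
  zsum x (binp N \Po ('X + h%:R%:P)) = x ^+ (N - h) / (1 - x) ^+ N.+1.
Proof.
move=> x0 x1 hN; have xh : x ^+ h != 0 by rewrite expf_neq0.
have := zsum_shift h (binp N) x1; rewrite zsum_binp // big1 => [|l _]; last first.
  by rewrite binp_nat bin_small ?mul0r // (leq_trans (ltn_ord l)).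
rewrite add0r -{1}(subnKC hN) exprD -mulrA => /(mulfI xh) <-.
by [].
Qed.

Lemma zsum_cbin x h : x != 0 -> x != 1 -> zsum x (cbin h) = (x / (1 - x) ^+ 2) ^+ h.+1.
Proof.
move=> x0 x1; rewrite /cbin zsum_binp_shift //; last by rewrite -addnn leqW // leq_addl.
have -> : (h.*2.+1 - h)%N = h.+1 by rewrite -addnn -addSn addnK.
by rewrite expr_div_n -exprM mul2n.
Qed.

(** The even companion of [cbin h], equal to X / (h + 1) times it; written as a sum of two
    binomials, it visibly takes integer values at integers. *)
Definition ebin h : {poly R} :=
  (binp h.*2.+2 \Po ('X + h.+1%:R%:P)) + (binp h.*2.+2 \Po ('X + h%:R%:P)).

Lemma zsum_ebin x h : x != 0 -> x != 1 ->
  zsum x (ebin h) = (1 + x) / (1 - x) * (x / (1 - x) ^+ 2) ^+ h.+1.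
Proof.
move=> x0 x1; have x1' : 1 - x != 0 by rewrite subr_eq0 eq_sym.
rewrite (_ : zsum x (ebin h) = zsum x (binp h.*2.+2 \Po ('X + h.+1%:R%:P)) +
  zsum x (binp h.*2.+2 \Po ('X + h%:R%:P))); last by rewrite /ebin linearD.
rewrite !zsum_binp_shift //; try by rewrite -addnn; clear; lia.
have -> : (h.*2.+2 - h.+1)%N = h.+1 by rewrite -addnn; clear; lia.
have -> : (h.*2.+2 - h)%N = h.+2 by rewrite -addnn; clear; lia.
rewrite expr_div_n -exprM mul2n doubleS !exprS; field.
by rewrite ?expf_neq0 ?x1'.
Qed.

Lemma ebin_nat h m : (ebin h).[m%:R] = ('C(m + h.+1, h.*2.+2) + 'C(m + h, h.*2.+2))%:R.
Proof. by rewrite /ebin hornerD !horner_shift -!natrD !binp_nat natrD. Qed.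

Lemma hornerN_ebin h x : (ebin h).[- x] = (ebin h).[x].
Proof.
have key y : (binp h.*2.+2).[- y + h.+1%:R] = (binp h.*2.+2).[y + h%:R].
  rewrite /binp !hornerZ; congr (_ * _); rewrite /ffp !horner_prod.
  have -> : \prod_(i < h.*2.+2) ('X - i%:R%:P).[- y + h.+1%:R] =
     \prod_(i < h.*2.+2) (-1) * \prod_(i < h.*2.+2) (- ('X - i%:R%:P).[- y + h.+1%:R]) :> R.
    by rewrite -big_split; apply: eq_bigr => i _ /=; rewrite mulN1r opprK.
  have -> : \prod_(i < h.*2.+2) (-1) = 1 :> R.
    by rewrite prodr_const card_ord -doubleS -mul2n exprM sqrrN expr1n expr1n.
  rewrite mul1r (reindex_inj rev_ord_inj) /=; apply: eq_bigr => i _.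
  rewrite !hornerXsubC subSS natrB; last by rewrite -ltnS.
  have -> : h.*2.+1%:R = h%:R + h%:R + 1 :> R by rewrite -natr1 -addnn natrD.
  by rewrite -natr1; ring.
rewrite /ebin !hornerD !horner_shift key addrC; congr (_ + _).
by rewrite -[in RHS](opprK x) key.
Qed.

(** The matrix of the values of [bas h] at 1, ..., K is integral and triangular with unit diagonal,
    so the coefficients are found one by one; they start after the last zero of P. *)
Lemma tri_expand (bas : nat -> {poly R}) P m K :
  (forall h mu, (0 < mu <= h)%N -> (bas h).[mu%:R] = 0) ->
  (forall h, (bas h).[h.+1%:R] = 1) ->
  (forall h mu, (bas h).[mu%:R] \is a Num.int) ->
  (forall mu, (0 < mu <= K)%N -> P.[mu%:R] \is a Num.int) ->
  (forall mu, (0 < mu <= m)%N -> P.[mu%:R] = 0) ->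
  exists t : nat -> int, (forall h, (h < m)%N -> t h = 0) /\
    forall mu, (0 < mu <= K)%N -> P.[mu%:R] = \sum_(h < K) (t h)%:~R * (bas h).[mu%:R].
Proof.
move=> b0 b1 bi Pi P0; elim: K Pi => [|K IH] Pi.
  by exists (fun=> 0); split=> // mu; rewrite leqn0 lt0n => /andP[/negPf ->].
have [|t [t0 ht]] := IH _.
  by move=> mu /andP[h1 h2]; apply: Pi; rewrite h1 ltnW.
have /intrP[z hz] : P.[K.+1%:R] - \sum_(h < K) (t h)%:~R * (bas h).[K.+1%:R] \is a Num.int.
  rewrite rpredB ?Pi ?ltnS ?leqnn // rpred_sum // => h _.
  by rewrite rpredM ?bi // intr_int.
exists (fun h => if h == K then z else t h); split=> [h hm|mu /andP[mu0 muK]].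
  case: eqP => [eh|_]; last exact: t0.
  have : z%:~R = 0 :> R.
    rewrite -hz P0 ?big1 ?subr0 // -?eh // => i _.
    by rewrite t0 ?mul0r // (ltn_trans (ltn_ord i)) // -eh.
  by move/eqP; rewrite intr_eq0 => /eqP.
rewrite big_ord_recr /= eqxx.
have -> : \sum_(i < K) (if i == K :> nat then z else t i)%:~R * (bas i).[mu%:R] =
   \sum_(i < K) (t i)%:~R * (bas i).[mu%:R] :> R.
  by apply: eq_bigr => i _; rewrite ltn_eqF.
move: muK; rewrite leq_eqVlt => /orP[/eqP ->|muK].
  by rewrite b1 mulr1 -hz addrC subrK.
by rewrite ht ?mu0 // (b0 K mu) ?mulr0 ?addr0 ?mu0.
Qed.

Lemma sym_poly_eq0 P K : (size P <= K.*2.+1)%N ->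
  (forall mu, (mu <= K)%N -> P.[mu%:R] = 0 /\ P.[- mu%:R] = 0) -> P = 0.
Proof.
move=> sP h; pose rs := [seq (mu%:R : R) | mu <- iota 0 K.+1] ++ [seq (- mu%:R : R) | mu <- iota 1 K].
apply: (@roots_geq_poly_eq0 _ _ rs).
- apply/allP => x; rewrite mem_cat => /orP[] /mapP[mu]; rewrite mem_iota => /andP[m0 mK] ->.
    by rewrite rootE (h mu _).1 //; move: mK; clear; lia.
  by rewrite rootE (h mu _).2 //; move: mK; clear; lia.
- rewrite ?uniq_rootsE cat_uniq; apply/and3P; split.
  + by rewrite map_inj_uniq ?iota_uniq // => i j /eqP; rewrite eqr_nat => /eqP.
  + apply/hasPn => x /mapP[mu]; rewrite mem_iota => /andP[m0 _] ->.
    apply/negP => /mapP[nu _] /eqP; rewrite -subr_eq0 -opprD oppr_eq0 -natrD pnatr_eq0 addn_eq0.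
    by rewrite -leqn0 leqNgt m0.
  + by rewrite map_inj_uniq ?iota_uniq // => i j /oppr_inj /eqP; rewrite eqr_nat => /eqP.
- by rewrite size_cat !size_map !size_iota (leq_trans sP) // -addnn addSn.
Qed.

(** Parity carries the equality from 1, ..., K over to the negatives, which makes 2 K + 1 points
    together with 0. The vanishing of the first m coefficients is what lets a power of k / 2 be
    divided out later. *)
Lemma sym_expand (sg : R) (bas : nat -> {poly R}) P m K :
  (forall h mu, (mu <= h)%N -> (bas h).[mu%:R] = 0) ->
  (forall h, (bas h).[h.+1%:R] = 1) ->
  (forall h mu, (bas h).[mu%:R] \is a Num.int) ->
  (forall h x, (bas h).[- x] = sg * (bas h).[x]) ->
  (forall h, size (bas h) <= h.*2.+3)%N ->
  (forall x, P.[- x] = sg * P.[x]) -> (size P <= K.*2.+1)%N ->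
  (forall mu, (0 < mu <= K)%N -> P.[mu%:R] \is a Num.int) ->
  (forall mu, (mu <= m)%N -> P.[mu%:R] = 0) ->
  exists t : nat -> int, (forall h, (h < m)%N -> t h = 0) /\
    P = \sum_(h < K) (t h)%:~R *: bas h.
Proof.
move=> b0 b1 bi bs bz Ps Pz Pi P0.
have [t [t0 ht]] := @tri_expand bas P m K (fun h mu hm => b0 h mu (andP hm).2) b1 bi Pi
  (fun mu hm => P0 mu (andP hm).2).
exists t; split=> //; apply/eqP; rewrite -subr_eq0; apply/eqP.
set S := \sum_(h < K) _.
have Ss x : (P - S).[- x] = sg * (P - S).[x].
  rewrite !hornerD !hornerN Ps mulrBr; congr (_ - _).
  rewrite /S !horner_sum mulr_sumr; apply: eq_bigr => i _.
  by rewrite !hornerZ bs mulrCA.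
apply: (@sym_poly_eq0 _ K) => [|mu muK].
  rewrite (leq_trans (size_polyD _ _)) // size_polyN geq_max Pz /=.
  rewrite (leq_trans (size_sum _ _ _)) //; apply/bigmax_leqP => i _.
  rewrite (leq_trans (size_scale_leq _ _)) // (leq_trans (bz i)) //.
  by rewrite ltnS -doubleS leq_double.
suff e : (P - S).[mu%:R] = 0 by rewrite Ss e mulr0.
rewrite hornerD hornerN /S horner_sum; under eq_bigr do rewrite hornerZ.
case: mu muK => [|mu] muK; last by rewrite ht ?muK // subrr.
by rewrite P0 // big1 ?subr0 // => i _; rewrite b0 // mulr0.
Qed.
End SymmetricExpansion.

(** The last digit in Lucas's theorem, by induction on that digit of A: in N C(A, N) = A C(A - 1, N
    - 1) the factor N is prime to p. *)
Lemma dvdn_bin_digit p N A : prime p -> (A %% p < N %% p)%N -> (p %| 'C(A, N))%N.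
Proof.
move=> pp; have p1 := prime_gt1 pp.
elim: {A}(A %% p)%N {-2}A N (erefl (A %% p)%N) => [|k IH] A N eA hN.
  case: N hN => [|N hN]; first by rewrite mod0n ltn0.
  have ndiv : ~~ (p %| N.+1)%N by rewrite /dvdn -lt0n (leq_ltn_trans _ hN).
  have : (p %| N.+1 * 'C(A, N.+1))%N.
    case: A eA hN => [|A] eA hN; first by rewrite bin0n muln0.
    by rewrite -mul_bin_diag dvdn_mulr // /dvdn eA.
  by rewrite Euclid_dvdM // (negPf ndiv).
case: N hN => [|N hN]; first by rewrite mod0n ltn0.
have ndiv : ~~ (p %| N.+1)%N by rewrite /dvdn -lt0n (leq_ltn_trans _ hN).
have : (p %| N.+1 * 'C(A, N.+1))%N.
  case: A eA hN => [|A] eA hN; first by rewrite bin0n muln0.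
  have eA' : (A %% p = k)%N.
    have := divn_eq A.+1 p; rewrite eA addnS => -[->].
    by rewrite modnMDl modn_small // (leq_trans _ (ltn_pmod A.+1 (ltnW p1))) // eA ltnW.
  have eN' : (N.+1 %% p).-1 = (N %% p)%N.
    have := divn_eq N.+1 p; case: (N.+1 %% p)%N (ltn_pmod N.+1 (ltnW p1)) hN => // r rp _.
    by rewrite addnS => -[->]; rewrite modnMDl modn_small // ltnW.
  rewrite -mul_bin_diag dvdn_mull // IH // -eN' eA'.
  by move: hN; rewrite eA; case: (N.+1 %% p)%N.
by rewrite Euclid_dvdM // (negPf ndiv).
Qed.

Lemma prod_primes_dvd (s : seq nat) (P : pred nat) m : uniq s ->
  (forall p, p \in s -> P p -> prime p /\ (p %| m)%N) ->
  (\prod_(p <- s | P p) p %| m)%N.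
Proof.
elim: s => [|p s IH] /=; first by rewrite big_nil dvd1n.
move=> /andP[ps us] h; rewrite big_cons.
have {}IH : (\prod_(p <- s | P p) p %| m)%N.
  by apply: IH => // q qs; apply: h; rewrite inE qs orbT.
case: ifP => // Pp; have [pp pm] := h p (mem_head _ _) Pp.
rewrite Gauss_dvd ?pm //; rewrite big_seq_cond; apply: (big_ind (coprime p)).
- exact: coprimen1.
- by move=> x y hx hy; rewrite coprimeMr hx.
- move=> q /andP[qs Pq]; have [pq _] := h q (mem_behead (s := p :: s) qs) Pq.
  by rewrite prime_coprime // dvdn_prime2 //; apply: contraNneq ps => ->.
Qed.

(** * From the condition on {n/p} to residues modulo p *)

Section Brackets.
Variable R : realType.
Implicit Types (x y : R).

Lemma floor_natdiv (A N p : nat) : (0 < p)%N -> (N %% p <= A %% p)%N ->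
  fl (A%:R / p%:R : R) - fl ((A%:R - N%:R) / p%:R : R) - fl (N%:R / p%:R : R) = 0.
Proof.
move=> p0 hle; have p0' : 0 < p%:R :> R by rewrite ltr0n.
have fdiv (z : int) (r : nat) : (r < p)%N -> fl ((z%:~R * p%:R + r%:R) / p%:R : R) = z.
  move=> rp; apply: floor_def; rewrite mulrDl mulfK ?gt_eqF // rmorphD.
  apply/andP; split; first by rewrite lerDl divr_ge0.
  by rewrite ltrD2l ltr_pdivrMr // mul1r ltr_nat.
have eA : A%:R = (A %/ p)%N%:Z%:~R * p%:R + (A %% p)%N%:R :> R by rewrite -natrM -natrD -divn_eq.
have eN : N%:R = (N %/ p)%N%:Z%:~R * p%:R + (N %% p)%N%:R :> R by rewrite -natrM -natrD -divn_eq.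
have eAN : A%:R - N%:R = ((A %/ p)%N%:Z - (N %/ p)%N%:Z)%:~R * p%:R + (A %% p - N %% p)%N%:R :> R.
  by rewrite eA eN natrB // rmorphB; ring.
rewrite eAN {1}eA eN !fdiv ?ltn_pmod //; first by rewrite opprB; lia.
by rewrite (leq_ltn_trans (leq_subr _ _)) ?ltn_pmod.
Qed.

(** The three brackets defining [Omega], at x = (mu + h3) / p, count the carries modulo p in the
    three binomials of T(mu). If no residue of mu + h_i is below that of 2 h_i + 1, all three vanish
    and their sum cannot be at least 1. *)
Lemma Omega_digits (a b n p mu : nat) : odd b -> odd n -> (4 * a < b)%N -> (0 < p)%N ->
  Omega a b (Defs.frac (n%:R / p%:R : R)) ->
  [|| ((mu + ((b - 4 * a) * n)./2) %% p < ((b - 4 * a) * n) %% p)%N,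
      ((mu + ((b - 2 * a) * n)./2) %% p < ((b - 2 * a) * n) %% p)%N |
      ((mu + (b * n)./2) %% p < (b * n) %% p)%N].
Proof.
move=> ob on ab p0 [_ h]; apply/negPn/negP; rewrite !negb_or -!leqNgt => /and3P[h1 h2 h3].
have p0' : p%:R != 0 :> R by rewrite pnatr_eq0 -lt0n.
set f := fl (n%:R / p%:R : R).
have flD x (z : int) : fl (x + z%:~R) = fl x + z.
  by apply: floor_def; rewrite !rmorphD /=; have := floor_itv x; rewrite rmorphD /=; lra.
have e1 : ((b * n)./2 = ((b - 4 * a) * n)./2 + 2 * a * n)%N.
  have -> : (b * n = (b - 4 * a) * n + (2 * a * n).*2)%N.
    by rewrite -mul2n -{1}(subnK (ltnW ab)); ring.
  by rewrite halfD odd_double andbF add0n doubleK.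
have e2 : ((b * n)./2 = ((b - 2 * a) * n)./2 + a * n)%N.
  have ab2 : (2 * a <= b)%N by move: ab; clear; lia.
  have -> : (b * n = (b - 2 * a) * n + (a * n).*2)%N.
    by rewrite -mul2n -{1}(subnK ab2); ring.
  by rewrite halfD odd_double andbF add0n doubleK.
(* Replacing {n/p} by n / p shifts the three floors by integers whose contributions cancel. *)
have B (c d : nat) (D : R) : D = d%:R - c%:R ->
    fl (((mu + (b * n)./2)%:R / p%:R) - c%:R * Defs.frac (n%:R / p%:R) : R)
  - fl (((mu + (b * n)./2)%:R / p%:R) - d%:R * Defs.frac (n%:R / p%:R) : R)
  - fl (D * Defs.frac (n%:R / p%:R) : R) =
    fl (((mu + (b * n)./2)%:R - c%:R * n%:R) / p%:R : R)
  - fl (((mu + (b * n)./2)%:R - d%:R * n%:R) / p%:R : R)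
  - fl (D * n%:R / p%:R : R).
  move=> ->; rewrite /Defs.frac -/f.
  have -> : (mu + (b * n)./2)%:R / p%:R - c%:R * (n%:R / p%:R - f%:~R) =
    ((mu + (b * n)./2)%:R - c%:R * n%:R) / p%:R + (c%:Z * f)%:~R :> R by rewrite rmorphM /=; ring.
  have -> : (mu + (b * n)./2)%:R / p%:R - d%:R * (n%:R / p%:R - f%:~R) =
    ((mu + (b * n)./2)%:R - d%:R * n%:R) / p%:R + (d%:Z * f)%:~R :> R by rewrite rmorphM /=; ring.
  have -> : (d%:R - c%:R) * (n%:R / p%:R - f%:~R) =
    (d%:R - c%:R) * n%:R / p%:R + (- ((d%:Z - c%:Z) * f))%:~R :> R by rewrite rmorphN rmorphM rmorphB /=; ring.
  rewrite !flD; ring.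
have ab2 : (2 * a <= b)%N by move: ab; clear; lia.
have ab1 : (a <= b)%N by move: ab; clear; lia.
have := h ((mu + (b * n)./2)%:R / p%:R).
rewrite -(natrB _ ab2) -(natrB _ ab1).
rewrite (B (2 * a)%N (b - 2 * a)%N); last by rewrite natrB // !natrM; ring.
rewrite (B a (b - a)%N); last by rewrite !natrB // !natrM; ring.
have := B 0%N b b%:R (esym (subr0 _)); rewrite !mul0r !subr0 => ->.
have Z (c N : nat) (D d : R) : (mu + (b * n)./2 = mu + N./2 + c * n)%N -> D * n%:R = N%:R ->
    d - c%:R = D -> (N %% p <= (mu + N./2) %% p)%N ->
    fl (((mu + (b * n)./2)%:R - c%:R * n%:R) / p%:R : R)
  - fl (((mu + (b * n)./2)%:R - d * n%:R) / p%:R : R)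
  - fl (D * n%:R / p%:R : R) = 0.
  move=> eA eD ed hle; rewrite eD; have := floor_natdiv p0 hle.
  have -> : (mu + (b * n)./2)%:R - c%:R * n%:R = (mu + N./2)%:R :> R.
    by rewrite eA natrD natrM addrK.
  have -> // : (mu + (b * n)./2)%:R - d * n%:R = (mu + N./2)%:R - N%:R :> R.
  by rewrite eA -eD -ed natrD natrM; ring.
rewrite (Z (2 * a)%N ((b - 4 * a) * n)%N) //; last 3 first.
- by rewrite e1 addnA.
- by rewrite [RHS]natrM natrB ?(ltnW ab).
- by rewrite natrB // !natrM; ring.
rewrite (Z a ((b - 2 * a) * n)%N) //; last 3 first.
- by rewrite e2 addnA.
- by rewrite [RHS]natrM natrB.
- by rewrite !natrB // !natrM; ring.
have := Z 0%N (b * n)%N b%:R b%:R; rewrite mul0r !subr0 => -> //; first by rewrite mul0n addn0.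
by rewrite natrM.
Qed.
End Brackets.

(** * Integrality of the derivative after division by Delta *)

Section Denominators.
Variable R : realType.
Local Notation cbin := (@cbin R).

Definition half1 (a b n : nat) := ((b - 4 * a) * n)./2.
Definition half2 (a b n : nat) := ((b - 2 * a) * n)./2.
Definition half3 (b n : nat) := (b * n)./2.

Definition Tpol a b n : {poly R} := cbin (half1 a b n) * cbin (half2 a b n) * cbin (half3 b n).

Definition Lam a b n : R := (dlcm (b * n))%:R / (Delta R a b n)%:R.

Lemma dvdn_dlcm N l : (0 < l <= N)%N -> (l %| dlcm N)%N.
Proof.
move=> /andP[l0 lN]; rewrite /dlcm (big_rem l) /= ?dvdn_lcml //.
by rewrite mem_index_iota l0 ltnS.
Qed.

Lemma dlcm_gt0 N : (0 < dlcm N)%N.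
Proof.
rewrite /dlcm big_seq_cond; elim/big_ind: _ => // [x y x0 y0|i].
  by rewrite lcmn_gt0 x0.
by rewrite andbT mem_index_iota => /andP[].
Qed.

Lemma Delta_gt0 a b n : (0 < Delta R a b n)%N.
Proof.
rewrite /Delta; elim/big_ind: _ => // [x y x0 y0|i /andP[/andP[/prime_gt0 //]]].
by rewrite muln_gt0 x0.
Qed.

Lemma Lam_gt0 a b n : 0 < Lam a b n.
Proof. by rewrite divr_gt0 // ltr0n ?dlcm_gt0 ?Delta_gt0. Qed.

Definition dbin (d h mu : nat) : int :=
  \sum_(l < h.*2.+1) (-1) ^+ l * ((d %/ l.+1)%N%:Z * 'C(mu + h, h.*2.+1 - l.+1)%:Z).

Lemma dbinE d h mu : (forall l, (0 < l <= h.*2.+1)%N -> (l %| d)%N) ->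
  (dbin d h mu)%:~R = d%:R * (cbin h)^`().[mu%:R] :> R.
Proof.
move=> hd; rewrite deriv_cbin_nat /dbin rmorph_sum mulr_sumr; apply: eq_bigr => l _.
rewrite !rmorphM rmorphXn rmorphN1 /=.
have ld : (l.+1 %| d)%N by apply: hd; rewrite ltn_ord.
have -> : d%:R = (d %/ l.+1)%:R * l.+1%:R :> R by rewrite -natrM divnK.
have l0 : l.+1%:R != 0 :> R by rewrite pnatr_eq0.
rewrite -!pmulrn; move: l0; set c := l.+1%:R => l0.
by rewrite mulrA -[RHS]mulrA; field.
Qed.

(** Either p divides l + 1, and the lower index of the binomial keeps its residue modulo p, so the
    binomial is divisible by p; or it does not, and p survives in d / (l + 1). *)
Lemma dvd_dbin p d h mu : prime p -> (p %| d)%N -> (forall l, (0 < l <= h.*2.+1)%N -> (l %| d)%N) ->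
  ((mu + h) %% p < h.*2.+1 %% p)%N -> (p%:Z %| dbin d h mu)%Z.
Proof.
move=> pp pd hd hdig; apply: rpred_sum => l _; rewrite dvdz_mull // -PoszM.
rewrite dvdzE /=; have [pl|pl] := boolP (p %| l.+1)%N.
  apply: dvdn_mull; apply: dvdn_bin_digit => //.
  have e : (h.*2.+1 = h.*2.+1 - l.+1 + l.+1)%N by rewrite subnK.
  have <- : (h.*2.+1 %% p = (h.*2.+1 - l.+1) %% p)%N by rewrite {1}e -modnDmr (eqP pl) addn0.
  by [].
apply: dvdn_mulr; have ld : (l.+1 %| d)%N by apply: hd; rewrite ltn_ord.
by move: pd; rewrite -{1}(divnK ld) Euclid_dvdM // (negPf pl) orbF.
Qed.

Lemma half_odd N : odd N -> (N./2.*2.+1 = N)%N.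
Proof. by move=> oN; rewrite -[RHS]odd_double_half oN. Qed.

Lemma odd_mulB a b n c : odd b -> odd n -> (c * 2 * a <= b)%N -> odd ((b - c * 2 * a) * n).
Proof. by move=> ob on h; rewrite oddM on oddB // ob mulnAC oddM andbF. Qed.

Lemma halves a b n : odd b -> odd n -> (4 * a < b)%N ->
  [/\ (half1 a b n).*2.+1 = ((b - 4 * a) * n)%N, (half2 a b n).*2.+1 = ((b - 2 * a) * n)%N &
      (half3 b n).*2.+1 = (b * n)%N].
Proof.
move=> ob on ab; split; apply: half_odd.
- by apply: (@odd_mulB a b n 2) => //; exact: ltnW.
- by apply: (@odd_mulB a b n 1) => //; move: ab; clear; lia.
- by rewrite oddM ob.
Qed.

Lemma half_le a b n : (half1 a b n <= half2 a b n)%N && (half2 a b n <= half3 b n)%N.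
Proof. by rewrite !half_leq // leq_mul2r ?leq_subr ?leq_sub2l ?orbT // leq_mul2r orbT. Qed.

(** For each prime of Delta one of the three factors is divisible by it, whether differentiated and
    multiplied by d or not; hence so is each of the three terms of the product rule. *)
Lemma Lam_deriv_int a b n mu : odd b -> odd n -> (4 * a < b)%N ->
  Lam a b n * (Tpol a b n)^`().[mu%:R] \is a Num.int.
Proof.
move=> ob on ab; have [e1 e2 e3] := halves ob on ab.
set h1 := half1 a b n in e1 *; set h2 := half2 a b n in e2 *; set h3 := half3 b n in e3 *.
have /andP[h12 h23] := half_le a b n; rewrite -/h1 -/h2 -/h3 in h12 h23.
set d := dlcm (b * n).
have dl h l : (h <= h3)%N -> (0 < l <= h.*2.+1)%N -> (l %| d)%N.
  move=> hh /andP[l0 lh]; apply: dvdn_dlcm; rewrite l0 -e3 (leq_trans lh) //.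
  by rewrite ltnS leq_double.
have d1 l := dl h1 l (leq_trans h12 h23); have d2 l := dl h2 l h23; have d3 l := dl h3 l (leqnn _).
pose c h := 'C(mu + h, h.*2.+1)%:Z.
pose E := dbin d h1 mu * c h2 * c h3 + c h1 * dbin d h2 mu * c h3 + c h1 * c h2 * dbin d h3 mu.
have hE : d%:R * (Tpol a b n)^`().[mu%:R] = E%:~R :> R.
  rewrite /E !rmorphD !rmorphM /= !dbinE // /Tpol -/h1 -/h2 -/h3 !derivM !hornerE /= !cbin_nat -!pmulrn.
  ring.
have DE : ((Delta R a b n)%:Z %| E)%Z.
  rewrite dvdzE /Delta; apply: prod_primes_dvd; first exact: iota_uniq.
  move=> p; rewrite mem_index_iota => /andP[_ pN] /andP[/andP[pp _] /asboolP hO].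
  split=> //; rewrite -[p]/(absz p%:Z) -dvdzE.
  have pd : (p %| d)%N by apply: dvdn_dlcm; rewrite prime_gt0.
  have cdig h : ((mu + h) %% p < h.*2.+1 %% p)%N -> (p%:Z %| c h)%Z.
    by move=> hh; rewrite dvdzE; apply: dvdn_bin_digit.
  have := Omega_digits mu ob on ab (prime_gt0 pp) hO.
  rewrite -/(half1 a b n) -/(half2 a b n) -/(half3 b n) -/h1 -/h2 -/h3 -e1 -e2 -e3.
  have M x y z : [|| (p%:Z %| x)%Z, (p%:Z %| y)%Z | (p%:Z %| z)%Z] -> (p%:Z %| x * y * z)%Z.
    by case/or3P => hx; [apply/dvdz_mulr/dvdz_mulr|apply/dvdz_mulr/dvdz_mull|apply: dvdz_mull].
  case/or3P => hdig; have hc := cdig _ hdig; rewrite /E !rpredD //; apply: M.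
  - by rewrite (dvd_dbin pp pd d1 hdig).
  - by rewrite hc.
  - by rewrite hc.
  - by rewrite hc orbT.
  - by rewrite (dvd_dbin pp pd d2 hdig) orbT.
  - by rewrite hc orbT.
  - by rewrite hc !orbT.
  - by rewrite hc !orbT.
  - by rewrite (dvd_dbin pp pd d3 hdig) !orbT.
have D0 : (Delta R a b n)%:R != 0 :> R by rewrite pnatr_eq0 -lt0n Delta_gt0.
have -> : Lam a b n * (Tpol a b n)^`().[mu%:R] = (E %/ (Delta R a b n)%:Z)%Z%:~R.
  apply: (mulIf D0); rewrite /Lam mulrAC mulfVK // hE.
  by rewrite -{1}(divzK DE) rmorphM.
exact: intr_int.
Qed.
End Denominators.

(** * The integers q and p *)

Section LinearForms.
Variable R : realType.
Local Notation cbin := (@cbin R).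
Local Notation ebin := (@ebin R).
Local Notation xk := (@xk R).

Lemma Lam_int a b n : Lam R a b n \is a Num.int.
Proof.
have Dd : (Delta R a b n %| dlcm (b * n))%N.
  rewrite /Delta; apply: prod_primes_dvd; first exact: iota_uniq.
  move=> p; rewrite mem_index_iota => /andP[_ pN] /andP[/andP[pp _] _]; split=> //.
  by apply: dvdn_dlcm; rewrite prime_gt0.
by rewrite /Lam -{1}(divnK Dd) natrM mulfK ?natr_int // pnatr_eq0 -lt0n Delta_gt0.
Qed.

Definition sqrtk k : R := Num.sqrt (2 * k + 1)%:R.

Lemma sqrtk_gt1 k : (1 <= k)%N -> 1 < sqrtk k.
Proof.
move=> k1; rewrite /sqrtk -[X in X < _]sqrtr1 ltr_sqrt ?ltr0n ?addn1 // ltr1n.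
by move: k1; clear; lia.
Qed.

Lemma sqr_sqrtk k : sqrtk k ^+ 2 = (2 * k + 1)%:R.
Proof. by rewrite /sqrtk sqr_sqrtr. Qed.

Lemma xk_gt0 k : (1 <= k)%N -> 0 < xk k.
Proof. by move=> /sqrtk_gt1 s1; rewrite divr_gt0 // -/(sqrtk k); lra. Qed.

Lemma xk_lt1 k : (1 <= k)%N -> xk k < 1.
Proof. by move=> /sqrtk_gt1 s1; rewrite ltr_pdivrMr -/(sqrtk k); lra. Qed.

Lemma xk_ratio k : (1 <= k)%N -> (1 + xk k) / (1 - xk k) = sqrtk k.
Proof.
move=> /sqrtk_gt1 s1; rewrite /xk -/(sqrtk k).
have h1 : sqrtk k + 1 != 0 by rewrite gt_eqF //; lra.
have -> : 1 - (sqrtk k - 1) / (sqrtk k + 1) = 2 / (sqrtk k + 1) by field.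
have -> : 1 + (sqrtk k - 1) / (sqrtk k + 1) = 2 * sqrtk k / (sqrtk k + 1) by field.
by field.
Qed.

Lemma xk_quad k : (1 <= k)%N -> xk k / (1 - xk k) ^+ 2 = k%:R / 2.
Proof.
move=> k1; have s1 := sqrtk_gt1 k1.
have h1 : sqrtk k + 1 != 0 by rewrite gt_eqF //; lra.
have -> : 1 - xk k = 2 / (sqrtk k + 1) by rewrite /xk -/(sqrtk k); field.
have -> : k%:R = (sqrtk k ^+ 2 - 1) / 2.
  by rewrite sqr_sqrtk natrD natrM; field.
by rewrite /xk -/(sqrtk k); field.
Qed.

(** It makes the powers (k/2)^(h+1), ..., (k/2)^K integral: the common factor k^(h+1), or
    (k/2)^(h+1), is divided out, and for odd k the power 2^K clears the denominators. *)
Definition Wgt k h K : R :=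
  if odd k then 2 ^+ K / k%:R ^+ h.+1 else (k./2%:R ^+ h.+1)^-1.

Lemma Wgt_gt0 k h K : (1 <= k)%N -> 0 < Wgt k h K.
Proof.
move=> k1; rewrite /Wgt; case: ifP => ok.
  by rewrite divr_gt0 ?exprn_gt0 // ltr0n.
by rewrite invr_gt0 exprn_gt0 // ltr0n; move: k1 ok; case: k => [|[|k]].
Qed.

Lemma Wgt_int k h K j : (1 <= k)%N -> (h <= j < K)%N ->
  Wgt k h K * (k%:R / 2) ^+ j.+1 \is a Num.int.
Proof.
move=> k1 /andP[hj jK]; rewrite /Wgt; case: ifP => ok.
  have kn : k%:R ^+ h.+1 != 0 :> R by rewrite expf_neq0 // pnatr_eq0 -lt0n.
  have -> : 2 ^+ K / k%:R ^+ h.+1 * (k%:R / 2) ^+ j.+1 = (2 ^ (K - j.+1) * k ^ (j - h))%:R :> R.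
    have e1 : 2 ^+ K = 2 ^+ (K - j.+1) * 2 ^+ j.+1 :> R by rewrite -exprD subnK.
    have e2 : k%:R ^+ j.+1 = k%:R ^+ (j - h) * k%:R ^+ h.+1 :> R by rewrite -exprD addnS subnK.
    have tn : 2 ^+ j.+1 != 0 :> R by rewrite expf_neq0 // pnatr_eq0.
    rewrite natrM !natrX expr_div_n e1 e2; move: kn tn.
    set A := k%:R ^+ h.+1; set B := 2 ^+ j.+1 => kn tn.
    by field; rewrite ?kn ?tn.
  exact: natr_int.
have k2 : k%:R / 2 = k./2%:R :> R.
  by rewrite -{1}(odd_double_half k) ok add0n -muln2 natrM mulfK // pnatr_eq0.
have kn : k./2%:R ^+ h.+1 != 0 :> R.
  by rewrite expf_neq0 // pnatr_eq0; move: k1 ok; case: (k) => [|[|]].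
rewrite k2 -{1}(subnK hj) -addnS exprD [_ * _ ^+ h.+1]mulrC mulKf // -natrX.
exact: natr_int.
Qed.

Lemma expansion_int k h K (t : nat -> int) : (1 <= k)%N -> (forall j, (j < h)%N -> t j = 0) ->
  Wgt k h K * \sum_(j < K) (t j)%:~R * (k%:R / 2) ^+ j.+1 \is a Num.int.
Proof.
move=> k1 t0; rewrite mulr_sumr rpred_sum // => j _; have [jh|hj] := ltnP j h.
  by rewrite t0 // mul0r mulr0 rpred0.
by rewrite mulrCA rpredM ?intr_int // Wgt_int // hj ltn_ord.
Qed.

Lemma cbin_eq0 h mu : (mu <= h)%N -> (cbin h).[mu%:R] = 0.
Proof. by move=> muh; rewrite cbin_nat bin_small // -addnn ltnS leq_add2r. Qed.

Lemma hornerN_Tpol a b n x : (Tpol R a b n).[- x] = - (Tpol R a b n).[x].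
Proof. by rewrite /Tpol !hornerM !hornerN_cbin; ring. Qed.

Lemma deriv_even (P : {poly R}) x : (forall y, P.[- y] = - P.[y]) -> P^`().[- x] = P^`().[x].
Proof.
move=> hP; have e : P \Po (- 'X) = - P.
  apply/eqP; rewrite -subr_eq0 opprK; apply/eqP.
  apply: (@sym_poly_eq0 R _ (size (P \Po - 'X + P))); first by rewrite -addnn leqW // leq_addr.
  have z y : (P \Po - 'X + P).[y] = 0 by rewrite hornerD horner_comp hornerN hornerX hP addNr.
  by move=> mu _.
have := congr1 (fun Q : {poly R} => Q^`().[x]) e.
rewrite deriv_comp derivN derivX mulrN1 !derivN !hornerN horner_comp hornerN hornerX.
exact: oppr_inj.
Qed.

(** T is odd of degree 2 [deg] - 1, the degree of [cbin] at index [deg] - 1, the last one in the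
    expansion. *)
Definition deg a b n := (half1 a b n + half2 a b n + half3 b n + 2)%N.

Lemma size_Tpol a b n : (size (Tpol R a b n) <= (deg a b n).*2.+1)%N.
Proof.
rewrite /Tpol (leq_trans (size_polyMleq _ _)) // size_cbin.
have := size_polyMleq (cbin (half1 a b n)) (cbin (half2 a b n)); rewrite !size_cbin /deg -!addnn.
by clear; lia.
Qed.

Lemma linear_form k a b n : (1 <= k)%N -> odd b -> odd n -> (4 * a < b)%N ->
  exists qp : int * int,
   (qp.1%:~R = Lam R a b n * Wgt k (half2 a b n) (deg a b n) * zsum (xk k) (Tpol R a b n)) /\
   (qp.1%:~R * alphak k - qp.2%:~R = Lam R a b n * Wgt k (half2 a b n) (deg a b n) * sqrtk k *
      zsum (xk k) (ln (xk k) *: Tpol R a b n + (Tpol R a b n)^`())).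
Proof.
move=> k1 ob on ab; set h := half2 a b n; set K := deg a b n; set T := Tpol R a b n.
set L := Lam R a b n; set W := Wgt k h K; set x := xk k.
have x0 : x != 0 by rewrite gt_eqF // xk_gt0.
have x1 : x != 1 by rewrite lt_eqF // xk_lt1.
have s0 : sqrtk k != 0 by rewrite gt_eqF //; have := sqrtk_gt1 k1; lra.
have h23 : (h <= half3 b n)%N by case/andP: (half_le a b n).
have [t [t0 tE]] : exists t : nat -> int, (forall j, (j < h)%N -> t j = 0) /\
    T = \sum_(j < K) (t j)%:~R *: cbin j.
  apply: (@sym_expand R (-1)).
  - by move=> j mu; apply: cbin_eq0.
  - by move=> j; rewrite cbin_nat addSn addnn binn.
  - by move=> j mu; rewrite cbin_nat natr_int.
  - by move=> j y; rewrite hornerN_cbin mulN1r.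
  - by move=> j; rewrite size_cbin.
  - by move=> y; rewrite hornerN_Tpol mulN1r.
  - exact: size_Tpol.
  - by move=> mu _; rewrite /T /Tpol !hornerM !cbin_nat -!natrM natr_int.
  - by move=> mu hmu; rewrite /T /Tpol !hornerM (cbin_eq0 hmu) mulr0 mul0r.
(* T' vanishes where two factors of T do, that is, up to [half2]; this determines the power of k in
   the weight. *)
have [e [e0 eE]] : exists e : nat -> int, (forall j, (j < h)%N -> e j = 0) /\
    L *: T^`() = \sum_(j < K) (e j)%:~R *: ebin j.
  apply: (@sym_expand R 1).
  - move=> j mu hmu; rewrite ebin_nat !bin_small // -addnn; move: hmu; clear; lia.
  - move=> j; rewrite ebin_nat addSn addnS addnn binn bin_small ?addn0 //.
    by rewrite addSn addnn.
  - by move=> j mu; rewrite ebin_nat natr_int.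
  - by move=> j y; rewrite hornerN_ebin mul1r.
  - move=> j; rewrite (leq_trans (size_polyD _ _)) // geq_max.
    by rewrite !size_shift !size_binp leqnn.
  - by move=> y; rewrite !hornerZ deriv_even ?mul1r // => z; rewrite hornerN_Tpol.
  - rewrite (leq_trans (size_scale_leq _ _)) // (leq_trans _ (size_Tpol a b n)) //.
    have [->|T0] := eqVneq T 0; first by rewrite deriv0 size_poly0.
    by rewrite ltnW // lt_size_deriv.
  - by move=> mu _; rewrite hornerZ Lam_deriv_int.
  - move=> mu hmu; rewrite hornerZ /T /Tpol !derivM !hornerE /= (cbin_eq0 hmu) (cbin_eq0 (leq_trans hmu h23)).
    by ring.
have zT : zsum x T = \sum_(j < K) (t j)%:~R * (k%:R / 2) ^+ j.+1.
  rewrite tE linear_sum; apply: eq_bigr => j _.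
  by rewrite linearZ /= zsum_cbin // xk_quad.
have zD : L * zsum x T^`() = sqrtk k * \sum_(j < K) (e j)%:~R * (k%:R / 2) ^+ j.+1.
  have -> : L * zsum x T^`() = zsum x (L *: T^`()) by rewrite linearZ.
  rewrite eE linear_sum mulr_sumr; apply: eq_bigr => j _.
  by rewrite linearZ /= zsum_ebin // xk_quad // xk_ratio // mulrCA.
have /intrP[q hq] : L * W * zsum x T \is a Num.int.
  by rewrite -mulrA rpredM ?Lam_int // zT expansion_int.
have /intrP[p hp] : W * \sum_(j < K) (e j)%:~R * (k%:R / 2) ^+ j.+1 \is a Num.int.
  exact: expansion_int.
(* The factor (1 + x) / (1 - x) from [ebin] is sqrt (2 k + 1); multiplied by the one in [alphak], it
   gives the integer 2 k + 1. *)
exists (q, - ((2 * k + 1)%N%:Z * p)) => /=; split; first by rewrite -hq.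
rewrite rmorphN opprK rmorphM /= -hp -hq /alphak -/(sqrtk k) -/x -pmulrn -sqr_sqrtk.
rewrite linearD linearZ /= !mulrDr; congr (_ + _); first by ring.
transitivity (sqrtk k * W * (L * zsum x T^`())); last by ring.
rewrite zD; ring.
Qed.
End LinearForms.

(** * Growth of the coefficients *)

Section RealSeries.
Variable R : realType.
Implicit Types (P Q : {poly R}) (x y p c : R).

Lemma cvg_zsum x P : `|x| < 1 -> (fun n => \sum_(l < n) P.[l%:R] * x ^+ l) @ \oo --> zsum x P.
Proof.
move=> x1; have nx : Normc.normc (x%:C%C) < 1 by rewrite normc_real.
have := @cvgC_zsum R (map_poly (real_complex R) P) _ nx; rewrite zsum_map => /cvgC_norm h.
apply/subr_cvg0; apply/norm_cvg0P; apply: (cvg0_le _ h) => n.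
rewrite normr_ge0 /= -normc_real rmorphB rmorph_sum le_eqVlt; apply/orP; left; apply/eqP.
congr (Normc.normc (_ - _)); apply: eq_bigr => l _.
by rewrite rmorphM rmorphXn -horner_map rmorph_nat.
Qed.

Lemma zsum_ge_term x P l : 0 <= x < 1 -> (forall j : nat, 0 <= P.[j%:R]) ->
  P.[l%:R] * x ^+ l <= zsum x P.
Proof.
move=> /andP[x0 x1] P0; have h := @cvg_zsum x P; rewrite ger0_norm // in h.
apply: (cvgr_to_ge (h x1)); exists l.+1 => // n /= ln.
rewrite (bigD1 (Ordinal ln)) //= lerDl sumr_ge0 // => j _.
by rewrite mulr_ge0 ?exprn_ge0.
Qed.

Lemma zsum_le_zsum x y P Q c : 0 <= x < 1 -> 0 <= y < 1 ->
  (forall l : nat, P.[l%:R] * x ^+ l <= c * (Q.[l%:R] * y ^+ l)) -> zsum x P <= c * zsum y Q.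
Proof.
move=> /andP[x0 x1] /andP[y0 y1] h.
have hP := @cvg_zsum x P; rewrite ger0_norm // in hP.
have hQ := @cvg_zsum y Q; rewrite ger0_norm // in hQ.
have hcQ := @cvgMl_tmp _ _ _ _ _ c _ (hQ y1).
apply: (ler_cvg_to (hP x1) (hcQ _)); apply: nearW => n.
by rewrite /= mulr_sumr; apply: ler_sum => l _.
Qed.

Definition bern p A j : R := 'C(A, j)%:R * (p ^+ j * (1 - p) ^+ (A - j)).

Lemma sum_bern p A : \sum_(j < A.+1) bern p A j = 1.
Proof.
rewrite -[RHS](expr1n _ A) -[1 in RHS](subrK p) exprDn; apply: eq_bigr => j _.
by rewrite /bern [p ^+ j * _]mulrC mulr_natl.
Qed.

Lemma bern_ge0 p A j : 0 <= p <= 1 -> 0 <= bern p A j.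
Proof. by move=> /andP[p0 p1]; rewrite mulr_ge0 // mulr_ge0 ?exprn_ge0 // subr_ge0. Qed.

Lemma bern_le1 p A j : 0 <= p <= 1 -> (j <= A)%N -> bern p A j <= 1.
Proof.
move=> p01 jA; rewrite -(sum_bern p A) (bigD1 (Ordinal (jA : j < A.+1)%N)) //=.
by rewrite lerDl sumr_ge0 // => i _; apply: bern_ge0.
Qed.

Lemma bern_ratio p A j : 0 < p < 1 -> (j < A)%N ->
  bern p A j.+1 * (j.+1%:R * (1 - p)) = bern p A j * ((A - j)%:R * p).
Proof.
move=> p01 jA; rewrite /bern.
have e : 'C(A, j.+1)%:R * j.+1%:R = 'C(A, j)%:R * (A - j)%:R :> R.
  by rewrite -!natrM mulnC mul_bin_left mulnC.
rewrite -(subnSK jA) exprS [(1 - p) ^+ _.+1]exprS.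
transitivity ('C(A, j.+1)%:R * j.+1%:R * (p * p ^+ j * (1 - p) ^+ (A - j.+1) * (1 - p))); first ring.
by rewrite e subnSK //; ring.
Qed.

(* N is the mode of the binomial distribution, so its weight is at least the average. *)
Lemma bern_peak p A N : 0 < p < 1 -> (N <= A)%N -> N%:R <= A.+1%:R * p -> A.+1%:R * p < N.+1%:R ->
  A.+1%:R^-1 <= bern p A N.
Proof.
move=> p01 NA h1 h2; have /andP[p0 p1] := p01.
have p01' : 0 <= p <= 1 by rewrite !ltW.
have q0 : 0 < 1 - p by rewrite subr_gt0.
have up j : (j < A)%N -> j.+1%:R <= A.+1%:R * p -> bern p A j <= bern p A j.+1.
  move=> jA hj; have pos : 0 < j.+1%:R * (1 - p) by rewrite mulr_gt0.
  rewrite -(ler_pM2r pos) (bern_ratio p01 jA) ler_wpM2l ?bern_ge0 //.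
  by rewrite natrB ?(ltnW jA) //; move: hj; rewrite -[A.+1%:R]natr1 -natr1; lra.
have dn j : (j < A)%N -> A.+1%:R * p <= j.+1%:R -> bern p A j.+1 <= bern p A j.
  move=> jA hj; have pos : 0 < j.+1%:R * (1 - p) by rewrite mulr_gt0.
  rewrite -(ler_pM2r pos) (bern_ratio p01 jA) ler_wpM2l ?bern_ge0 //.
  by rewrite natrB ?(ltnW jA) //; move: hj; rewrite -[A.+1%:R]natr1 -natr1; lra.
have U k : (k <= N)%N -> bern p A (N - k) <= bern p A N.
  elim: k => [|k IH] kN; first by rewrite subn0.
  apply: le_trans (IH (ltnW kN)); rewrite -(subnSK kN); apply: up.
    by rewrite subnSK // (leq_trans (leq_subr _ _)).
  by apply: le_trans h1; rewrite ler_nat subnSK // leq_subr.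
have D k : (N + k <= A)%N -> bern p A (N + k) <= bern p A N.
  elim: k => [|k IH] kN; first by rewrite addn0.
  rewrite addnS in kN *; apply: le_trans (IH (ltnW kN)); apply: dn => //.
  by apply: le_trans (ltW h2) _; rewrite ler_nat ltnS leq_addr.
rewrite -div1r ler_pdivrMr // -[X in X <= _](sum_bern p A) mulr_natr.
have -> : bern p A N *+ A.+1 = \sum_(j < A.+1) bern p A N by rewrite sumr_const card_ord.
apply: ler_sum => j _; have [jN|Nj] := leqP j N.
  by rewrite -(subKn jN); apply: U; exact: leq_subr.
have e := subnKC (ltnW Nj); have jA : (j <= A)%N by rewrite -ltnS.
by have := D (j - N)%N; rewrite e => /(_ jA).
Qed.
End RealSeries.

Lemma half_shift b c n : (2 * c <= b)%N -> ((b * n)./2 = ((b - 2 * c) * n)./2 + c * n)%N.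
Proof.
move=> h; have -> : (b * n = (b - 2 * c) * n + (c * n).*2)%N.
  by rewrite -mul2n -{1}(subnK h); ring.
by rewrite halfD odd_double andbF add0n doubleK.
Qed.

(** * Two-sided bounds for the sum of T(l) x^l *)

Section PeakBounds.
Variable R : realType.
Local Notation cbin := (@cbin R).
Implicit Types (x p z : R).

(** The factor that turns a term of the series of [cbin h] at 1 - p into a binomial probability, see
    [cbin_geo]. *)
Definition geo p h : R := (p ^+ h.*2.+1)^-1 * (1 - p) ^+ h.+1.

Lemma geo_gt0 p h : 0 < p < 1 -> 0 < geo p h.
Proof.
move=> /andP[p0 p1]; apply: mulr_gt0; first by rewrite invr_gt0 exprn_gt0.
by rewrite exprn_gt0 // subr_gt0.
Qed.

Lemma geo_div p h : p != 0 -> ((1 - p) / p ^+ 2) ^+ h.+1 = geo p h / p.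
Proof.
move=> p0; rewrite /geo expr_div_n -exprM mul2n doubleS [p ^+ _.+2]exprS invfM.
by rewrite mulrCA mulrA mulrAC -mulrA mulrC.
Qed.

Lemma cbin_geo p h mu : 0 < p < 1 ->
  (cbin h).[mu%:R] * (1 - p) ^+ mu = geo p h * bern p (mu + h) h.*2.+1.
Proof.
move=> /andP[p0 p1]; rewrite cbin_nat /bern /geo.
have [lt|le] := ltnP (mu + h) h.*2.+1; first by rewrite bin_small // !mul0r mulr0.
have pn : p ^+ h.*2.+1 != 0 by rewrite expf_neq0 // gt_eqF.
have -> : (1 - p) ^+ mu = (1 - p) ^+ h.+1 * (1 - p) ^+ (mu + h - h.*2.+1).
  by rewrite -exprD; congr (_ ^+ _); move: le; rewrite -addnn; clear; lia.
move: pn; set P := p ^+ _ => pn; set Q := _ ^+ h.+1; set S := _ ^+ (_ - _).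
by field.
Qed.

Lemma lnGeo p h (n : nat) (B : R) : 0 < p < 1 -> h.*2.+1%:R = B * n%:R ->
  geo p h = expR (n%:R * (B / 2 * ln (1 - p) - B * ln p) + ln (1 - p) / 2).
Proof.
move=> /andP[p0 p1] e; have q0 : 0 < 1 - p by rewrite subr_gt0.
rewrite /geo -{1}(lnK (p0 : p \is Num.pos)) -{1}(lnK (q0 : 1 - p \is Num.pos)).
rewrite -!expRM_natl -expRN -expRD e; congr expR.
have -> : h.+1%:R = (B * n%:R + 1) / 2.
  by rewrite -e -[h.*2.+1%:R]natr1 -natr1 -addnn natrD; field.
by field.
Qed.

Section Fixed.
Variables (a b : nat) (z x : R).
Hypotheses (ob : odd b) (ab : (4 * a < b)%N) (zb : b%:R < z) (x0 : 0 < x) (x1 : x < 1).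
Hypothesis zeq : z * (z - a%:R) * (z - (2 * a)%:R)
    / ((z - (b - 2 * a)%:R) * (z - (b - a)%:R) * (z - b%:R)) = x^-1.

Definition width c : R := b%:R - 2 * c%:R.
(** For c = 2a, a, 0 the corresponding binomial has lower index (b - 2c) n and, at l close to (z -
    b/2) n, upper index close to (z - c) n. This ratio therefore puts all three modes at the same l;
    the equation of z says that the product of the 1 - [prob c] is x. *)
Definition prob c : R := width c / (z - c%:R).

Lemma width_gt0 c : (2 * c < b)%N -> 0 < width c.
Proof. by move=> h; rewrite subr_gt0 -natrM ltr_nat. Qed.

Lemma zc_gt0 c : (c < b)%N -> 0 < z - c%:R.
Proof. by rewrite -(@ltr_nat R) => h; rewrite subr_gt0 (lt_trans h). Qed.

Lemma oneBprob c : (c < b)%N -> 1 - prob c = (z - (b%:R - c%:R)) / (z - c%:R).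
Proof. by move=> cb; have h := zc_gt0 cb; rewrite /prob /width; field; rewrite gt_eqF. Qed.

Lemma prob01 c : (2 * c < b)%N -> 0 < prob c < 1.
Proof.
move=> h; have cb : (c < b)%N by move: h; clear; lia.
rewrite divr_gt0 ?width_gt0 ?zc_gt0 //= ltr_pdivrMr ?zc_gt0 // mul1r /width.
have : 0 <= c%:R :> R by []; move: zb; lra.
Qed.

Let ha : (2 * a < b)%N. Proof. by move: ab; clear; lia. Qed.
Let h2a : (2 * (2 * a) < b)%N. Proof. by move: ab; clear; lia. Qed.
Let h0 : (2 * 0 < b)%N. Proof. by move: ab; clear; lia. Qed.

Lemma prod_oneBprob : (1 - prob (2 * a)) * (1 - prob a) * (1 - prob 0) = x.
Proof.
have b2a : (2 * a < b)%N by []; have ba : (a < b)%N by move: ab; clear; lia.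
have b0 : (0 < b)%N by move: ab; clear; lia.
rewrite !oneBprob // -(invrK x) -zeq invf_div.
have -> : (b - 2 * a)%:R = b%:R - (2 * a)%:R :> R by rewrite natrB // ltnW.
have -> : (b - a)%:R = b%:R - a%:R :> R by rewrite natrB // ltnW.
field; apply/and3P; split; rewrite gt_eqF //.
- by have := zc_gt0 b2a; rewrite natrM.
- exact: zc_gt0.
- by have := zc_gt0 b0; rewrite subr0.
Qed.

Definition growth : R := \sum_(c <- [:: (2 * a)%N; a; 0%N])
  (width c / 2 * ln (1 - prob c) - width c * ln (prob c)).

Lemma geo_prod n : odd n ->
  geo (prob (2 * a)) (half1 a b n) * geo (prob a) (half2 a b n) * geo (prob 0) (half3 b n) =
  expR (n%:R * growth + ln x / 2).
Proof.
move=> on; have [e1 e2 e3] := halves ob on ab.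
have p1 := prob01 h2a; have p2 := prob01 ha; have p3 := prob01 h0.
rewrite (@lnGeo _ _ n (width (2 * a))) //; last first.
  by rewrite e1 natrM natrB ?(ltnW ab) // /width !natrM; ring.
rewrite (@lnGeo _ _ n (width a)) //; last first.
  by rewrite e2 natrM natrB ?(ltnW ha) // /width !natrM; ring.
rewrite (@lnGeo _ _ n (width 0)) //; last by rewrite e3 natrM /width mulr0 subr0.
rewrite -!expRD; congr expR; rewrite /growth !big_cons big_nil.
have q1 : 0 < 1 - prob (2 * a) by rewrite subr_gt0; case/andP: p1.
have q2 : 0 < 1 - prob a by rewrite subr_gt0; case/andP: p2.
have q3 : 0 < 1 - prob 0 by rewrite subr_gt0; case/andP: p3.
have q12 := mulr_gt0 q1 q2.
by rewrite -prod_oneBprob (lnM q12 q3) (lnM q1 q2); field.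
Qed.

(** Two of the probabilities are bounded by 1; the third factor is kept, since its series is summed
    exactly by [zsum_cbin]. No polynomial factor is lost. *)
Lemma zsum_Tpol_le n : odd n ->
  zsum x (Tpol R a b n) <= expR (n%:R * growth + ln x / 2) / prob 0.
Proof.
move=> on; have p1 := prob01 h2a; have p2 := prob01 ha; have p3 := prob01 h0.
have /andP[p30 p31] := p3.
have q1 : 1 - prob 0 != 1 by rewrite lt_eqF // gtrBl.
have q0 : 1 - prob 0 != 0 by rewrite gt_eqF // subr_gt0.
have xx : 0 <= x < 1 by rewrite ltW.
have yy : 0 <= 1 - prob 0 < 1 by rewrite subr_ge0 ltW //= gtrBl.
pose c := geo (prob (2 * a)) (half1 a b n) * geo (prob a) (half2 a b n).
have le : zsum x (Tpol R a b n) <= c * zsum (1 - prob 0) (cbin (half3 b n)).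
  apply: zsum_le_zsum => // l; rewrite /Tpol !hornerM -prod_oneBprob !exprMn.
  have -> u v w u' v' w' : u * v * w * (u' * v' * w') = (u * u') * (v * v') * (w * w') :> R by ring.
  rewrite !(cbin_geo _ _ p1, cbin_geo _ _ p2); apply: ler_wpM2r.
    by rewrite cbin_nat mulr_ge0 // exprn_ge0 // (andP yy).1.
  have b1 : bern (prob (2 * a)) (l + half1 a b n) (half1 a b n).*2.+1 <= 1.
    have [j|j] := leqP (half1 a b n).*2.+1 (l + half1 a b n).
      by apply: bern_le1 => //; rewrite !ltW ?(andP p1).1 ?(andP p1).2.
    by rewrite /bern bin_small // mul0r.
  have b2 : bern (prob a) (l + half2 a b n) (half2 a b n).*2.+1 <= 1.
    have [j|j] := leqP (half2 a b n).*2.+1 (l + half2 a b n).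
      by apply: bern_le1 => //; rewrite !ltW ?(andP p2).1 ?(andP p2).2.
    by rewrite /bern bin_small // mul0r.
  have g1 := geo_gt0 (half1 a b n) p1; have g2 := geo_gt0 (half2 a b n) p2.
  have B1 : 0 <= bern (prob (2 * a)) (l + half1 a b n) (half1 a b n).*2.+1.
    by apply: bern_ge0; rewrite !ltW ?(andP p1).1 ?(andP p1).2.
  have B2 : 0 <= bern (prob a) (l + half2 a b n) (half2 a b n).*2.+1.
    by apply: bern_ge0; rewrite !ltW ?(andP p2).1 ?(andP p2).2.
  have M (u v s t : R) : 0 <= u -> 0 <= v -> 0 <= s -> 0 <= t -> s <= 1 -> t <= 1 ->
      u * s * (v * t) <= u * v.
    move=> u0 v0 s0 t0 s1 t1; rewrite mulrACA -[X in _ <= X]mulr1.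
    by rewrite ler_wpM2l ?mulr_ge0 // mulr_ile1.
  by apply: M => //; apply: ltW.
apply: le_trans le _; rewrite zsum_cbin // -geo_prod // -/c -mulrA ler_wpM2l //.
  by rewrite /c mulr_ge0 // ltW // geo_gt0.
by rewrite subKr geo_div // gt_eqF.
Qed.

(** The single term at the common mode is enough: each of the three probabilities is at least 1 / (A
    + 1) by [bern_peak], with A + 1 <= (z + 1) n. *)
Lemma zsum_Tpol_ge n : odd n ->
  expR (n%:R * growth + ln x / 2) / ((z + 1) * n%:R) ^+ 3 <= zsum x (Tpol R a b n).
Proof.
move=> on; have p1 := prob01 h2a; have p2 := prob01 ha; have p3 := prob01 h0.
have [e1 e2 e3] := halves ob on ab.
have n1 : 1 <= n%:R :> R by rewrite ler1n; case: (n) on.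
have z0 : 0 < z by apply: le_lt_trans zb.
have xx : 0 <= x < 1 by rewrite ltW.
have T0 j : 0 <= (Tpol R a b n).[j%:R] by rewrite /Tpol !hornerM !cbin_nat -!natrM.
pose nu := absz (fl (z * n%:R)).
have zn0 : 0 <= z * n%:R by rewrite mulr_ge0 // ltW.
have nuE : nu%:R = (fl (z * n%:R))%:~R :> R by rewrite -[nu%:R]/(nu%:Z%:~R) /nu gez0_abs // floor_ge0.
have /andP[nu1 nu2] := floor_itv (z * n%:R); rewrite rmorphD /= -nuE in nu1 nu2.
have bnu : (b * n <= nu)%N.
  by rewrite -ltnS -(@ltr_nat R) -natr1 (le_lt_trans _ nu2) // natrM ler_wpM2r // ltW.
pose mu := (nu - half3 b n)%N.
apply: (le_trans _ (zsum_ge_term mu xx T0)).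
have key c h : (2 * c < b)%N -> (h.*2.+1 = (b - 2 * c) * n)%N -> (half3 b n = h + c * n)%N ->
    geo (prob c) h / ((z + 1) * n%:R) <= (cbin h).[mu%:R] * (1 - prob c) ^+ mu.
  move=> cb eh e; have cb' : (c < b)%N by move: cb; clear; lia.
  have hp := prob01 cb; rewrite cbin_geo // ler_wpM2l ?(ltW (geo_gt0 _ _)) //.
  have cbn : (2 * c * n <= b * n)%N by rewrite leq_mul2r (ltnW cb) orbT.
  have eA : (mu + h + c * n = nu)%N.
    rewrite /mu -addnA -e subnK // (leq_trans _ bnu) // -e3 -addnn -addSn leq_addl //.
  have zc := zc_gt0 cb'.
  have NA : (h.*2.+1 <= mu + h)%N.
    by rewrite eh mulnBl leq_subLR; move: cbn bnu eA; rewrite -mulnA; clear; nia.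
  have eAR : (mu + h).+1%:R = nu%:R + 1 - c%:R * n%:R :> R.
    by rewrite -eA -natr1 !natrD natrM; ring.
  have ehR : h.*2.+1%:R = width c * n%:R :> R.
    by rewrite eh natrM natrB ?(ltnW cb) // /width natrM.
  have pz : prob c * (z - c%:R) = width c by rewrite /prob mulfVK // gt_eqF.
  have /andP[hp0 hp1] := hp.
  have c0 : 0 <= c%:R * n%:R :> R by rewrite mulr_ge0.
  apply: (le_trans _ (bern_peak hp NA _ _)).
  - rewrite lef_pV2 ?posrE ?mulr_gt0 //; try lra.
  - rewrite ehR -pz eAR -mulrA mulrC ler_wpM2r ?(ltW hp0) //; lra.
  - rewrite -[h.*2.+2%:R]natr1 ehR -pz eAR.
    have -> : (nu%:R + 1 - c%:R * n%:R) * prob c = prob c * (nu%:R - c%:R * n%:R) + prob c by ring.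
    apply: ler_ltD hp1; rewrite -mulrA ler_wpM2l ?(ltW hp0) //; lra.
have pos : 0 < (z + 1) * n%:R by rewrite mulr_gt0 //; lra.
set D := (z + 1) * n%:R in key pos *.
clearbody D.
rewrite -geo_prod // /Tpol !hornerM -prod_oneBprob !exprMn.
have -> u v w u' v' w' : u * v * w * (u' * v' * w') = (u * u') * (v * v') * (w * w') :> R by ring.
have -> : geo (prob (2 * a)) (half1 a b n) * geo (prob a) (half2 a b n) * geo (prob 0) (half3 b n) / D ^+ 3 =
  (geo (prob (2 * a)) (half1 a b n) / D) * (geo (prob a) (half2 a b n) / D) * (geo (prob 0) (half3 b n) / D).
  by field; rewrite gt_eqF.
have gD p h : 0 < p < 1 -> 0 <= geo p h / D by move=> hp; rewrite divr_ge0 ?ltW ?geo_gt0.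
have k1 := key _ _ h2a; have k2 := key _ _ ha; have k3 := key _ _ h0.
have {}k1 : geo (prob (2 * a)) (half1 a b n) / D <= (cbin (half1 a b n)).[mu%:R] * (1 - prob (2 * a)) ^+ mu.
  apply: k1; rewrite ?e1 ?mulnA //.
  by rewrite /half3 (half_shift n (ltnW h2a)) mulnA.
have {}k2 : geo (prob a) (half2 a b n) / D <= (cbin (half2 a b n)).[mu%:R] * (1 - prob a) ^+ mu.
  apply: k2; rewrite ?e2 //.
  by rewrite /half3 (half_shift n (ltnW ha)).
have {}k3 : geo (prob 0) (half3 b n) / D <= (cbin (half3 b n)).[mu%:R] * (1 - prob 0) ^+ mu.
  by apply: k3; rewrite ?e3 ?muln0 ?subn0 ?mul0n ?addn0.
have g1 := gD _ (half1 a b n) p1; have g2 := gD _ (half2 a b n) p2; have g3 := gD _ (half3 b n) p3.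
apply: (ler_pM _ g3 (ler_pM g1 g2 k1 k2) k3).
by rewrite (mulr_ge0 g1 g2).
Qed.
End Fixed.
End PeakBounds.

(** * Exponential rates along the odd integers *)

Section Rates.
Variable R : realType.
Implicit Types (x p z C d r s : R).
Local Notation oddn := (@oddn R).

Lemma near_poly_exp C k d : 0 < d -> \forall m \near \oo, C * oddn m ^+ k <= expR (d * oddn m).
Proof.
move=> d0.
have h := @cvg_exprn_geometric R k (expR (- d)).
have {}h := h _; rewrite expR_ge0 /= expR_lt1 oppr_lt0 in h; have {}h := h d0.
have od : (fun m : nat => m.*2.+1) @ \oo --> \oo.
  move=> B [N _ hN]; exists N => // M /= NM; apply: hN => /=.
  by rewrite (leq_trans NM) // -addnn -addSn leq_addl.
have {}h := cvg_comp _ _ od h.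
have {}h := @cvgMl_tmp _ _ _ _ _ C _ h; rewrite mulr0 in h.
have {h}h : (fun m => C * (oddn m ^+ k * expR (- d) ^+ m.*2.+1)) @ \oo --> 0 by exact: h.
move/cvgr0Pnorm_lt: h => /(_ _ ltr01); apply: filterS => m /=.
rewrite -expRM_natl mulrN expRN mulrA -/(oddn m) => /ltr_normlW.
by rewrite ltr_pdivrMr ?expR_gt0 // mul1r [oddn m * d]mulrC => /ltW.
Qed.

Definition exp_rate (u : nat -> R) s := forall d, 0 < d -> \forall m \near \oo,
  expR ((s - d) * oddn m) <= u m <= expR ((s + d) * oddn m).

Lemma exp_rateM (u v : nat -> R) r s : exp_rate u r -> exp_rate v s ->
  exp_rate (fun m => u m * v m) (r + s).
Proof.
move=> hu hv d d0; have d2 : 0 < d / 2 by lra.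
near=> m.
have /andP[u1 u2] : expR ((r - d / 2) * oddn m) <= u m <= expR ((r + d / 2) * oddn m).
  by near: m; apply: hu.
have /andP[v1 v2] : expR ((s - d / 2) * oddn m) <= v m <= expR ((s + d / 2) * oddn m).
  by near: m; apply: hv.
have -> : (r + s - d) * oddn m = (r - d / 2) * oddn m + (s - d / 2) * oddn m by field.
have -> : (r + s + d) * oddn m = (r + d / 2) * oddn m + (s + d / 2) * oddn m by field.
rewrite !expRD !ler_pM ?expR_ge0 //.
- by rewrite (le_trans _ u1) ?expR_ge0.
- by rewrite (le_trans _ v1) ?expR_ge0.
Unshelve. all: by end_near. Qed.

Lemma exp_rate_expR r s : exp_rate (fun m => expR (r * oddn m + s)) r.
Proof.
move=> d d0; near=> m.
have h1 : expR s * oddn m ^+ 0 <= expR (d * oddn m) by near: m; apply: near_poly_exp.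
have h2 : expR (- s) * oddn m ^+ 0 <= expR (d * oddn m) by near: m; apply: near_poly_exp.
move: h1 h2; rewrite !mulr1 !ler_expR => h1 h2; lra.
Unshelve. all: by end_near. Qed.

Lemma exp_rate_ln (u : nat -> R) s : (forall m, 0 < u m) ->
  (fun m => (oddn m)^-1 * ln (u m)) @ \oo --> s -> exp_rate u s.
Proof.
move=> u0 /cvgrPdist_le h d d0; have := h d d0; apply: filterS => m.
have om := @oddn_gt0 R m.
rewrite ler_norml; set y := _^-1 * _ => /andP[h1 h2].
have ly : ln (u m) = y * oddn m by rewrite /y mulrAC mulVf ?mul1r // gt_eqF.
rewrite -[u m](lnK (u0 m : u m \is Num.pos)) !ler_expR ly.
by apply/andP; split; apply: ler_wpM2r; rewrite ?(ltW om) //; lra.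
Qed.

Section Growth.
Variables (a b : nat) (z x : R).
Hypotheses (ob : odd b) (ab : (4 * a < b)%N) (zb : b%:R < z) (x0 : 0 < x) (x1 : x < 1).
Hypothesis zeq : z * (z - a%:R) * (z - (2 * a)%:R)
    / ((z - (b - 2 * a)%:R) * (z - (b - a)%:R) * (z - b%:R)) = x^-1.

Lemma exp_rate_zsum : exp_rate (fun m => zsum x (Tpol R a b m.*2.+1)) (growth a b z).
Proof.
move=> d d0; set g := growth a b z; near=> m.
have on : odd m.*2.+1 by rewrite /= odd_double.
have le := zsum_Tpol_le ob ab zb x0 x1 zeq on; have ge := zsum_Tpol_ge ob ab zb x0 x1 zeq on.
rewrite -/g -/(oddn m) in le ge.
have om := @oddn_gt0 R m.
have z0 : 0 < z by apply: le_lt_trans zb.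
have h1 : expR (ln x / 2) / prob b z 0 * oddn m ^+ 0 <= expR (d * oddn m).
  by near: m; apply: near_poly_exp.
have h2 : (z + 1) ^+ 3 / expR (ln x / 2) * oddn m ^+ 3 <= expR (d * oddn m).
  by near: m; apply: near_poly_exp.
apply/andP; split.
  apply: le_trans ge; rewrite exprMn ler_pdivlMr; last first.
    by rewrite mulr_gt0 // exprn_gt0 //; lra.
  have -> : oddn m * g + ln x / 2 = (g - d) * oddn m + (ln x / 2 + d * oddn m) by ring.
  rewrite [X in _ <= X]expRD ler_wpM2l ?expR_ge0 // expRD.
  by move: h2; rewrite mulrAC ler_pdivrMr ?expR_gt0 // [X in _ <= X]mulrC.
apply: le_trans le _.
have -> : (g + d) * oddn m = oddn m * g + d * oddn m by ring.
rewrite !expRD -mulrA ler_wpM2l ?expR_ge0 //.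
by move: h1; rewrite mulr1.
Unshelve. all: by end_near. Qed.

(** Adding b / 2 times the logarithm of the equation of z turns the half-integral exponents into
    those of M_1; this removes ln z and creates the term - (b / 2) ln x. *)
Lemma growthE : (0 < a)%N -> growth a b z =
  ln ((z - (b - 2 * a)%:R) ^+ (b - 2 * a) * (z - (b - a)%:R) ^+ (b - a) * (z - b%:R) ^+ b
        / ((z - (2 * a)%:R) ^+ (2 * a) * (z - a%:R) ^+ a
           * (b - 4 * a)%:R ^+ (b - 4 * a) * (b - 2 * a)%:R ^+ (b - 2 * a)
           * b%:R ^+ b))
    - b%:R / 2 * ln x.
Proof.
move=> a0; have b2a : (2 * a < b)%N by move: ab; clear; lia.
have ba : (a < b)%N by move: ab; clear; lia.
have b0 : (0 < b)%N by move: ab; clear; lia.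
have z0 : 0 < z by apply: le_lt_trans zb.
have zlt c : (c <= b)%N -> 0 < z - c%:R.
  by move=> cb; rewrite subr_gt0 (le_lt_trans _ zb) // ler_nat.
have p1 : 0 < z - (b - 2 * a)%:R by apply: zlt; rewrite leq_subr.
have p2 : 0 < z - (b - a)%:R by apply: zlt; rewrite leq_subr.
have p3 : 0 < z - b%:R by apply: zlt.
have p4 : 0 < z - (2 * a)%:R by apply: zlt; rewrite ltnW.
have p5 : 0 < z - a%:R by apply: zlt; rewrite ltnW.
have p6 : 0 < (b - 4 * a)%:R :> R by rewrite ltr0n subn_gt0.
have p7 : 0 < (b - 2 * a)%:R :> R by rewrite ltr0n subn_gt0.
have p8 : 0 < b%:R :> R by rewrite ltr0n.
have lnx : ln x = - (ln z + ln (z - a%:R) + ln (z - (2 * a)%:R)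
   - (ln (z - (b - 2 * a)%:R) + ln (z - (b - a)%:R) + ln (z - b%:R))).
  have := congr1 (@ln R) zeq; rewrite lnV ?posrE //.
  have m1 := mulr_gt0 z0 p5; have m2 := mulr_gt0 m1 p4.
  have m3 := mulr_gt0 p1 p2; have m4 := mulr_gt0 m3 p3.
  by rewrite (ln_div m2 m4) (lnM m1 p4) (lnM z0 p5) (lnM m3 p3) (lnM p1 p2) => ->; rewrite opprK.
have lnP c : (2 * c < b)%N -> ln (1 - prob b z c) = ln (z - (b - c)%:R) - ln (z - c%:R) /\
    ln (prob b z c) = ln (b - 2 * c)%:R - ln (z - c%:R).
  move=> cb; have cb' : (c < b)%N by move: cb; clear; lia.
  rewrite oneBprob // -(natrB _ (ltnW cb')) ln_div ?posrE ?zlt ?leq_subr ?(ltnW cb') //; split=> //.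
  rewrite /prob /width -natrM -(natrB _ (ltnW cb)) ln_div ?posrE ?zlt ?(ltnW cb') //.
  by rewrite ltr0n subn_gt0.
have h2a : (2 * (2 * a) < b)%N by rewrite mulnA.
have h0 : (2 * 0 < b)%N by [].
rewrite /growth !big_cons big_nil !(lnP _ h2a).1 !(lnP _ h2a).2 !(lnP _ b2a).1 !(lnP _ b2a).2 !(lnP _ h0).1 !(lnP _ h0).2.
rewrite subr0 !subn0 mulnA.
have P (u : R) j : 0 < u -> 0 < u ^+ j by move=> u0; exact: exprn_gt0.
have n1 := mulr_gt0 (P _ (b - 2 * a)%N p1) (P _ (b - a)%N p2).
have n2 := mulr_gt0 n1 (P _ b p3).
have d1 := mulr_gt0 (P _ (2 * a)%N p4) (P _ a p5).
have d2 := mulr_gt0 d1 (P _ (b - 4 * a)%N p6).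
have d3 := mulr_gt0 d2 (P _ (b - 2 * a)%N p7).
have d4 := mulr_gt0 d3 (P _ b p8).
rewrite (ln_div n2 d4) (lnM n1 (P _ b p3)) (lnM (P _ _ p1) (P _ _ p2)).
rewrite (lnM d3 (P _ b p8)) (lnM d2 (P _ _ p7)) (lnM d1 (P _ _ p6)) (lnM (P _ _ p4) (P _ _ p5)).
rewrite !lnXn // -![ln _ *+ _]mulr_natr lnx /width.
have -> : (2 * 2 * a = 4 * a)%N by [].
move: (ln (z - (b - 2 * a)%:R)) (ln (z - (b - a)%:R)) (ln (z - b%:R)) (ln z) (ln (z - a%:R))
  (ln (z - (2 * a)%:R)) (ln (b - 4 * a)%:R) (ln (b - 2 * a)%:R) (ln b%:R) => u1 u2 u3 v1 v2 v3 w1 w2 w3.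
rewrite !natrB ?(ltnW ab) ?(ltnW b2a) ?(ltnW ba) // !natrM.
by field.
Qed.
End Growth.
End Rates.

Section WeightRate.
Variable R : realType.
Local Notation oddn := (@oddn R).

Lemma odd_double1 m : odd m.*2.+1.
Proof. by rewrite /= odd_double. Qed.

Lemma exp_rate_Lam a b (s : R) :
  (fun m : nat => (m.*2.+1%:R)^-1 * ln ((dlcm (b * m.*2.+1))%:R / (Delta R a b m.*2.+1)%:R)) @ \oo --> s ->
  exp_rate (fun m => Lam R a b m.*2.+1) s.
Proof. by move=> h; apply: exp_rate_ln => // m; apply: Lam_gt0. Qed.

Lemma exp_rate_Wgt a b k : odd b -> (4 * a < b)%N -> (1 <= k)%N ->
  exp_rate (fun m => Wgt R k (half2 a b m.*2.+1) (deg a b m.*2.+1)) (K1 a b k).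
Proof.
move=> ob ab k1.
have dbl (h N : nat) : h.*2.+1 = N -> h%:R = (N%:R - 1) / 2 :> R.
  by move=> <-; rewrite -[h.*2.+1%:R]natr1 -addnn natrD; field.
have h2 m : (half2 a b m.*2.+1).+1%:R = ((b - 2 * a)%:R * oddn m + 1) / 2 :> R.
  have [_ e _] := @halves a b m.*2.+1 ob (odd_double1 m) ab.
  by rewrite -natr1 (dbl _ _ e) natrM -/(oddn m); field.
have hK m : (deg a b m.*2.+1)%:R = (3 * (b - 2 * a)%:R * oddn m + 1) / 2 :> R.
  have [e1 e2 e3] := @halves a b m.*2.+1 ob (odd_double1 m) ab.
  have ab2 : (2 * a <= b)%N by move: ab; clear; lia.
  rewrite /deg !natrD (dbl _ _ e1) (dbl _ _ e2) (dbl _ _ e3) !natrM -/(oddn m) !natrB ?(ltnW ab) // !natrM.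
  by field.
pose s : R := if odd k then (ln 2 - ln k%:R) / 2 else - ln k./2%:R / 2.
suff -> : (fun m => Wgt R k (half2 a b m.*2.+1) (deg a b m.*2.+1)) =
    (fun m => expR (K1 a b k * oddn m + s)) by exact: exp_rate_expR.
apply/funext => m; rewrite /Wgt /K1 /s; case: ifP => ok.
  have k0 : 0 < k%:R :> R by rewrite ltr0n.
  rewrite -{1}(lnK (k0 : k%:R \is Num.pos)) -{1}(lnK (ltr0Sn R 1 : 2 \is Num.pos)).
  by rewrite -!expRM_natl -expRB h2 hK natrM; congr expR; field.
have k0 : 0 < k./2%:R :> R by rewrite ltr0n; move: k1 ok; case: (k) => [|[|]].
by rewrite -{1}(lnK (k0 : k./2%:R \is Num.pos)) -!expRM_natl -expRN h2; congr expR; field.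
Qed.
End WeightRate.

(** * The saddle point *)

Section ArctanCalculus.
Variable R : realType.
Implicit Types (x y t d e s : R) (f df : R -> R).

Lemma mvt_ex f df x y : x < y -> (forall t, x <= t <= y -> is_derive t (1 : R) f (df t)) ->
  exists2 c, x < c < y & f y - f x = df c * (y - x).
Proof.
move=> xy hf; have [||c hc e] := @MVT R f df x y xy.
- by move=> t; rewrite in_itv /= => /andP[/ltW h1 /ltW h2]; apply: hf; rewrite h1.
- apply: derivable_within_continuous => t; rewrite in_itv /= => ht.
  exact: (@ex_derive _ _ _ _ _ _ _ (hf t ht)).
- by exists c => //; move: hc; rewrite in_itv.
Qed.

Lemma le_of_derive f df x y : x <= y -> (forall t, x <= t <= y -> is_derive t (1 : R) f (df t)) ->
  (forall t, x < t < y -> 0 <= df t) -> f x <= f y.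
Proof.
rewrite le_eqVlt => /orP[/eqP -> //|xy] hf h0; have [c hc e] := mvt_ex xy hf.
by rewrite -subr_ge0 e mulr_ge0 ?h0 // subr_ge0 ltW.
Qed.

Lemma ge_of_derive f df x y : x <= y -> (forall t, x <= t <= y -> is_derive t (1 : R) f (df t)) ->
  (forall t, x < t < y -> df t <= 0) -> f y <= f x.
Proof.
rewrite le_eqVlt => /orP[/eqP -> //|xy] hf h0; have [c hc e] := mvt_ex xy hf.
by rewrite -subr_le0 e mulr_le0_ge0 ?h0 // subr_ge0 ltW.
Qed.

Lemma sumsq_gt0 d y : 0 < y -> 0 < d ^+ 2 + y ^+ 2.
Proof. by move=> y0; rewrite ltr_wpDl ?sqr_ge0 // exprn_gt0. Qed.

(** [Fat d y - d] is the integral of ln |s + i y| for s from 0 to d; its derivative in y is the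
    argument [atan (d / y)]. *)
Definition Fat d y : R := d / 2 * ln (d ^+ 2 + y ^+ 2) + y * atan (d / y).

Lemma is_derive_atan_div d y : 0 < y -> is_derive y (1 : R) (fun y => atan (d / y)) (- d / (d ^+ 2 + y ^+ 2)).
Proof.
move=> y0; have yn : y != 0 by rewrite gt_eqF.
have h1 : is_derive y (1 : R) (fun y => d / y) (- d / y ^+ 2).
  have h : is_derive y (1 : R) (fun y : R => y^-1) (- y ^- 2 *: 1) by apply: is_deriveV.
  by apply: trigger_derive; rewrite /GRing.scale /=; field.
have h2 := @is_derive1_comp R (@atan R) (fun y => d / y) y _ _ (is_derive1_atan (d / y)) h1.
apply: (@is_derive_eq _ _ _ _ _ _ _ _ h2).
have p := sumsq_gt0 d y0.
by field; rewrite yn gt_eqF.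
Qed.

Lemma is_derive_Fat d y : 0 < y -> is_derive y (1 : R) (Fat d) (atan (d / y)).
Proof.
move=> y0; have yn : y != 0 by rewrite gt_eqF.
have p := sumsq_gt0 d y0.
have h1 := is_derive_atan_div d y0.
have g1 : is_derive y (1 : R) (fun y => d ^+ 2 + y ^+ 2) (2 * y).
  by apply: trigger_derive; rewrite /GRing.scale /= ?expr1 ?mulr1; ring.
have h2 := @is_derive1_comp R (@ln R) (fun y => d ^+ 2 + y ^+ 2) y _ _ (is_derive1_ln p) g1.
have h3 : is_derive y (1 : R) (fun y => ln (d ^+ 2 + y ^+ 2)) ((d ^+ 2 + y ^+ 2)^-1 * (2 * y)) by [].
rewrite /Fat; apply: trigger_derive; rewrite /GRing.scale /=.
by field; rewrite gt_eqF.
Qed.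

(** The integral of ln |s + i y| for s from 0 to t, by which products of the moduli |l + i y| are
    estimated, as factorials are by Stirling's formula. *)
Definition Gam y t : R := t / 2 * ln (t ^+ 2 + y ^+ 2) - t + y * atan (t / y).

Lemma is_derive_Gam y t : 0 < y -> is_derive t (1 : R) (Gam y) (ln (t ^+ 2 + y ^+ 2) / 2).
Proof.
move=> y0; have yn : y != 0 by rewrite gt_eqF.
have p := sumsq_gt0 t y0.
have g0 : is_derive t (1 : R) (fun t => t / y) (y^-1).
  by apply: trigger_derive; rewrite /GRing.scale /= ?mulr1; ring.
have h1 : is_derive t (1 : R) (fun t => atan (t / y)) _ :=
  @is_derive1_comp R (@atan R) (fun t => t / y) t _ _ (is_derive1_atan (t / y)) g0.
have g1 : is_derive t (1 : R) (fun t => t ^+ 2 + y ^+ 2) (2 * t).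
  by apply: trigger_derive; rewrite /GRing.scale /= ?expr1 ?mulr1; ring.
have h3 : is_derive t (1 : R) (fun t => ln (t ^+ 2 + y ^+ 2)) _ :=
  @is_derive1_comp R (@ln R) (fun t => t ^+ 2 + y ^+ 2) t _ _ (is_derive1_ln p) g1.
rewrite /Gam; apply: trigger_derive; rewrite /GRing.scale /=.
by field; rewrite yn addrC gt_eqF //= addrC gt_eqF.
Qed.

Lemma GamN y t : Gam y (- t) = - Gam y t.
Proof. by rewrite /Gam sqrrN !mulNr atanN; ring. Qed.

Lemma Gam0 y : Gam y 0 = 0.
Proof. by rewrite /Gam !mul0r atan0; ring. Qed.

Lemma ln_sumsq_ge0 y t : 1 <= y -> 0 <= ln (t ^+ 2 + y ^+ 2) / 2.
Proof.
move=> y1; rewrite divr_ge0 // ln_ge0 // ler_wpDl ?sqr_ge0 //.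
by rewrite -(expr1n _ 2) lerXn2r // nnegrE; lra.
Qed.

Lemma le_Gam y s t : 1 <= y -> s <= t -> Gam y s <= Gam y t.
Proof.
move=> y1 st; have y0 : 0 < y by lra.
apply: (le_of_derive st (fun u _ => is_derive_Gam u y0)) => u _.
exact: ln_sumsq_ge0.
Qed.

Lemma Gam_ge0 y t : 1 <= y -> 0 <= t -> 0 <= Gam y t.
Proof. by move=> y1 t0; rewrite -(Gam0 y) le_Gam. Qed.

Lemma Gam_incr_ge y t : 1 <= y -> 0 <= t -> ln (t ^+ 2 + y ^+ 2) / 2 <= Gam y (t + 1) - Gam y t.
Proof.
move=> y1 t0; have y0 : 0 < y by lra.
have tt : t < t + 1 by rewrite ltrDl.
have [c /andP[c1 c2] ->] := @mvt_ex (Gam y) _ t (t + 1) tt (fun u _ => is_derive_Gam u y0).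
have -> : t + 1 - t = 1 by ring.
rewrite mulr1 ler_wpM2r ?invr_ge0 // ler_ln ?posrE ?sumsq_gt0 // lerD2r lerXn2r ?nnegrE //; lra.
Qed.

Lemma Gam_incr_le y t M : 1 <= y -> 0 <= t -> t + 1 + y <= M -> Gam y (t + 1) <= Gam y t + ln M.
Proof.
move=> y1 t0 hM; have y0 : 0 < y by lra.
have tt : t < t + 1 by rewrite ltrDl.
have [c /andP[c1 c2] h] := @mvt_ex (Gam y) _ t (t + 1) tt (fun u _ => is_derive_Gam u y0).
rewrite -lerBlDl h; have -> : t + 1 - t = 1 by ring.
have M0 : 0 < M by lra.
rewrite mulr1 ler_pdivrMr // mulr_natr -lnXn // ler_ln ?posrE ?sumsq_gt0 ?exprn_gt0 //.
have : (t + 1 + y) ^+ 2 <= M ^+ 2 by rewrite lerXn2r ?nnegrE //; lra.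
apply: le_trans; rewrite sqrrD.
have : c ^+ 2 <= (t + 1) ^+ 2 by rewrite lerXn2r ?nnegrE //; lra.
have : 0 <= (t + 1) * y by rewrite mulr_ge0 //; lra.
rewrite -mulr_natl; lra.
Qed.

Lemma Gam_scale (n y t : R) : 0 < n -> 0 < y -> Gam (n * y) (n * t) = n * Fat t y + n * t * ln n - n * t.
Proof.
move=> n0 y0; rewrite /Gam /Fat.
have -> : (n * t) ^+ 2 + (n * y) ^+ 2 = n ^+ 2 * (t ^+ 2 + y ^+ 2) by ring.
rewrite lnM ?posrE ?exprn_gt0 ?sumsq_gt0 // lnXn // -mulr_natl.
have -> : n * t / (n * y) = t / y by field; rewrite !gt_eqF.
by field.
Qed.
End ArctanCalculus.

(** * The maximum of the exponent on the vertical line *)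

Section MaximumPrinciple.
Variable R : realType.
Implicit Types (x y t d e s p : R) (ts : seq R).

Definition Phi ts y : R := \sum_(t <- ts) Fat t y.
Definition Theta ts y : R := \sum_(t <- ts) atan (t / y).

Lemma is_derive_Phi ts y : 0 < y -> is_derive y (1 : R) (Phi ts) (Theta ts y).
Proof.
move=> y0; elim: ts => [|t ts IH].
  rewrite /Theta big_nil (_ : Phi [::] = cst 0); first exact: is_derive_cst.
  by apply/funext => u; rewrite /Phi big_nil.
rewrite /Theta big_cons -/(Theta ts y) (_ : Phi (t :: ts) = Fat t + Phi ts); last first.
  by apply/funext => u; rewrite /Phi big_cons.
by apply: is_deriveD => //; apply: is_derive_Fat.
Qed.

Lemma atan_le x : 0 <= x -> atan x <= x.
Proof.
rewrite le_eqVlt => /orP[/eqP <-|x0]; first by rewrite atan0.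
have [c /andP[c0 _]] := @mvt_ex R (@atan R) _ 0 x x0 (fun u _ => is_derive1_atan u).
rewrite atan0 !subr0 => ->; rewrite ler_piMl ?(ltW x0) // invf_le1 ?lerDl ?sqr_ge0 //.
by rewrite ltr_pwDl // sqr_ge0.
Qed.

Lemma atan_gt0 x : 0 < x -> 0 < atan x.
Proof. by move=> x0; rewrite -(@atan0 R); apply: lt_atan. Qed.

Lemma atan_inv x : 0 < x -> atan x^-1 = pi / 2 - atan x.
Proof.
move=> x0; have a0 := atan_gt0 x0; have a1 := @atan_ltpi2 R x.
rewrite -[RHS]tanK; last by rewrite in_itv /=; apply/andP; split; lra.
congr atan; rewrite /tan.
have -> : pi / 2 - atan x = - atan x + pi / 2 by ring.
rewrite sinDpihalf cosDpihalf cosN sinN opprK -{1}[x]atanK /tan invf_div //.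
Qed.

Lemma Theta_le ts y s : 0 < y -> y <= s -> all (fun t => 0 <= t) ts -> Theta ts s <= Theta ts y.
Proof.
move=> y0 ys /allP h; rewrite /Theta big_seq [X in _ <= X]big_seq; apply: ler_sum => t ht.
apply: le_atan; rewrite ler_wpM2l ?h // lef_pV2 ?posrE //.
exact: lt_le_trans ys.
Qed.

Lemma Theta_lt1 ts y : \sum_(t <- ts) `|t| <= y -> 0 < y -> Theta ts y <= 1.
Proof.
move=> h y0; apply: le_trans (_ : \sum_(t <- ts) `|t| / y <= _); last first.
  by rewrite -mulr_suml ler_pdivrMr // mul1r.
apply: ler_sum => t _; apply: le_trans (@atan_le (`|t| / y) _); last by rewrite divr_ge0 // ltW.
by apply: le_atan; rewrite ler_wpM2r ?invr_ge0 ?(ltW y0) // ler_norm.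
Qed.

(** The deviation of the sum of arctangents from 2 pi when the sixth length is - p: the five
    positive lengths contribute 5 pi / 2 and the negative one - pi / 2. *)
Definition Dev p ts y : R := atan (y / p) - \sum_(t <- ts) atan (y / t).

Lemma Theta_Dev p ts y : 0 < p -> 0 < y -> all (fun t => 0 < t) ts -> size ts = 5 ->
  Theta (rcons ts (- p)) y - pi *+ 2 = Dev p ts y.
Proof.
move=> p0 y0 /allP h sz; rewrite /Theta -cats1 big_cat big_seq1 /=.
have ai t : 0 < t -> atan (t / y) = pi / 2 - atan (y / t).
  by move=> t0; rewrite -atan_inv ?divr_gt0 // invf_div.
have -> : \sum_(t <- ts) atan (t / y) = \sum_(t <- ts) (pi / 2 - atan (y / t)).
  by rewrite big_seq [RHS]big_seq; apply: eq_bigr => t /h; apply: ai.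
rewrite sumrB big_const_seq count_predT sz /= mulNr atanN ai // /Dev.
by field.
Qed.

Lemma is_derive_Dev p ts y : 0 < p -> all (fun t => 0 < t) ts ->
  is_derive y (1 : R) (Dev p ts) (p / (p ^+ 2 + y ^+ 2) - \sum_(t <- ts) t / (t ^+ 2 + y ^+ 2)).
Proof.
move=> p0 h.
have da t : 0 < t -> is_derive y (1 : R) (fun y => atan (y / t)) (t / (t ^+ 2 + y ^+ 2)).
  move=> t0; have tn : t != 0 by rewrite gt_eqF.
  have g0 : is_derive y (1 : R) (fun y => y / t) (t^-1).
    by apply: trigger_derive; rewrite /GRing.scale /= ?mulr1; ring.
  have h1 := @is_derive1_comp R (@atan R) (fun y => y / t) y _ _ (is_derive1_atan (y / t)) g0.
  apply: (@is_derive_eq _ _ _ _ _ _ _ _ h1).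
  have q : t ^+ 2 + y ^+ 2 != 0 by rewrite gt_eqF // addrC sumsq_gt0.
  by field; rewrite q tn.
have ds : is_derive y (1 : R) (fun y => \sum_(t <- ts) atan (y / t)) (\sum_(t <- ts) t / (t ^+ 2 + y ^+ 2)).
  elim: ts h => [_|t ts IH /= /andP[t0 /IH {}IH]].
    rewrite big_nil (_ : (fun _ => _) = cst 0); first exact: is_derive_cst.
    by apply/funext => u; rewrite big_nil.
  rewrite big_cons (_ : (fun _ => _) = (fun y => atan (y / t)) + (fun y => \sum_(t <- ts) atan (y / t))).
    by apply: is_deriveD => //; apply: da.
  by apply/funext => u; rewrite big_cons.
have dp := da p p0.
exact: is_deriveB.
Qed.

(** The derivative of [Dev] up to the positive factor p^2 + y^2; when p is below every t, each
    quotient increases with y, so this decreases. *)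
Definition kap p ts y : R := p - \sum_(t <- ts) t * ((p ^+ 2 + y ^+ 2) / (t ^+ 2 + y ^+ 2)).

Lemma kapE p ts y : 0 < p -> p / (p ^+ 2 + y ^+ 2) - \sum_(t <- ts) t / (t ^+ 2 + y ^+ 2) =
  kap p ts y / (p ^+ 2 + y ^+ 2).
Proof.
move=> p0; have q : p ^+ 2 + y ^+ 2 != 0 by rewrite gt_eqF // addrC sumsq_gt0.
rewrite /kap mulrBl; congr (_ - _); rewrite mulr_suml; apply: eq_bigr => t _.
by rewrite -!mulrA; congr (_ * _); rewrite mulrCA mulfV // mulr1.
Qed.

Lemma kap_anti p ts y s : 0 < p -> all (fun t => p < t) ts -> 0 <= y -> y <= s -> kap p ts s <= kap p ts y.
Proof.
move=> p0 /allP h y0 ys; rewrite /kap lerD2l lerN2 big_seq [X in _ <= X]big_seq.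
apply: ler_sum => t /h pt; have t0 : 0 < t by lra.
apply: ler_wpM2l; first exact: ltW.
have q u : 0 < t ^+ 2 + u ^+ 2 by rewrite addrC sumsq_gt0.
rewrite ler_pdivrMr // mulrAC ler_pdivlMr //.
have e1 : p ^+ 2 <= t ^+ 2 by rewrite lerXn2r ?nnegrE //; lra.
have e2 : y ^+ 2 <= s ^+ 2 by rewrite lerXn2r ?nnegrE //; lra.
have : 0 <= (t ^+ 2 - p ^+ 2) * (s ^+ 2 - y ^+ 2) by rewrite mulr_ge0 // subr_ge0.
by rewrite -subr_ge0 => hh; rewrite -subr_ge0; apply: le_trans hh _; rewrite le_eqVlt; apply/orP; left; apply/eqP; ring.
Qed.

(** The sign of the derivative changes at most once, from positive to negative. As [Dev] vanishes at
    0 and at y1, a wrong sign on either side would force [kap] to increase between two mean value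
    points. *)
Lemma Dev_sign p ts y1 : 0 < p -> all (fun t => p < t) ts -> 0 < y1 -> Dev p ts y1 = 0 ->
  (forall y, 0 < y <= y1 -> 0 <= Dev p ts y) /\ (forall y, y1 <= y -> Dev p ts y <= 0).
Proof.
move=> p0 hp y10 D1.
have ht : all (fun t => 0 < t) ts by apply: sub_all hp => t; apply: lt_trans.
have D0 : Dev p ts 0 = 0.
  by rewrite /Dev mul0r atan0 big1 ?subr0 // => t _; rewrite mul0r atan0.
have q u : 0 < p ^+ 2 + u ^+ 2 by rewrite addrC sumsq_gt0.
have mv u v : u < v -> exists2 c, u < c < v & Dev p ts v - Dev p ts u = kap p ts c / (p ^+ 2 + c ^+ 2) * (v - u).
  move=> uv; have [c hc e] := mvt_ex uv (fun t _ => is_derive_Dev t p0 ht).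
  by exists c => //; rewrite e kapE.
split=> [y /andP[y0 yy1]|y yy1]; rewrite leNgt; apply/negP => Dn.
  have ylt : y < y1 by rewrite lt_neqAle yy1 andbT; apply: contraTneq Dn => ->; rewrite D1 ltxx.
  have [c /andP[c0 cy] e1] := mv _ _ y0; have [c' /andP[yc c1] e2] := mv _ _ ylt.
  have k1 : kap p ts c < 0.
    move: e1 Dn; rewrite D0 subr0 => ->; rewrite pmulr_llt0 ?subr_gt0 //. rewrite pmulr_llt0 ?invr_gt0 //.
  have k2 : 0 < kap p ts c'.
    have : 0 < Dev p ts y1 - Dev p ts y by rewrite D1 sub0r oppr_gt0.
    by rewrite e2 (pmulr_lgt0 _ (_ : 0 < y1 - y)) ?[0 < y1 - y]subr_gt0 // pmulr_lgt0 ?invr_gt0 //.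
  have := kap_anti p0 hp (ltW c0) (ltW (lt_trans cy yc)); lra.
have ylt : y1 < y by rewrite lt_neqAle yy1 andbT; apply: contraTneq Dn => <-; rewrite D1 ltxx.
have [c /andP[c0 cy] e1] := mv _ _ y10; have [c' /andP[yc c1] e2] := mv _ _ ylt.
have k1 : kap p ts c = 0.
  move/eqP: e1; rewrite D0 D1 subrr eq_sym !mulf_eq0 invr_eq0 (gt_eqF (q c)) orbF.
  by rewrite (gt_eqF (_ : 0 < y1 - 0)) ?subr0 // orbF => /eqP.
have k2 : 0 < kap p ts c'.
  have : 0 < Dev p ts y - Dev p ts y1 by rewrite D1 subr0.
  by rewrite e2 (pmulr_lgt0 _ (_ : 0 < y - y1)) ?[0 < y - y1]subr_gt0 // pmulr_lgt0 ?invr_gt0 //.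
have := kap_anti p0 hp (ltW c0) (ltW (lt_trans cy yc)); lra.
Qed.

Lemma Theta_sign ts t6 y1 : size ts = 5 -> all (fun t => 0 < t) ts ->
  (t6 < 0 -> all (fun t => - t6 < t) ts) -> 0 < y1 -> Theta (rcons ts t6) y1 = pi *+ 2 ->
  (forall y, 0 < y <= y1 -> pi *+ 2 <= Theta (rcons ts t6) y) /\
  (forall y, y1 <= y -> Theta (rcons ts t6) y <= pi *+ 2).
Proof.
move=> sz tp hp y10 e; have [t60|t60] := leP 0 t6.
  have all0 : all (fun t => 0 <= t) (rcons ts t6).
    by rewrite all_rcons t60 /=; apply: sub_all tp => t; apply: ltW.
  by split=> [y /andP[y0 yy]|y yy]; rewrite -e; apply: Theta_le.
have p0 : 0 < - t6 by rewrite oppr_gt0.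
have TD y : 0 < y -> Theta (rcons ts t6) y - pi *+ 2 = Dev (- t6) ts y.
  by move=> y0; rewrite -Theta_Dev // opprK.
have D1 : Dev (- t6) ts y1 = 0 by rewrite -TD // e subrr.
have [h1 h2] := Dev_sign p0 (hp t60) y10 D1.
split=> [y /andP[y0 yy]|y yy]; first by rewrite -subr_ge0 TD // h1 // y0.
by rewrite -subr_le0 TD ?h2 // (lt_le_trans y10).
Qed.

(** Weakening 2 pi to 2 pi - e moves the maximum, but costs at most e times the sum H of the |t|: up
    to H the loss is e y, and beyond H the derivative is negative because the arctangents sum to at
    most 1. *)
Lemma Phi_max ts t6 y1 e y : size ts = 5 -> all (fun t => 0 < t) ts ->
  (t6 < 0 -> all (fun t => - t6 < t) ts) -> 0 < y1 -> Theta (rcons ts t6) y1 = pi *+ 2 ->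
  0 < e <= 1 -> 0 < y ->
  Phi (rcons ts t6) y - (pi *+ 2 - e) * y <=
  Phi (rcons ts t6) y1 - pi *+ 2 * y1 + e * \sum_(t <- rcons ts t6) `|t|.
Proof.
move=> sz tp hp y10 e1 /andP[e0 el1] y0; set us := rcons ts t6 in e1 *; set H := \sum_(t <- us) _.
have [s1 s2] := Theta_sign sz tp hp y10 e1; rewrite -/us in s1 s2.
have dPsi (c u : R) : 0 < u -> is_derive u (1 : R) (fun y => Phi us y - c * y) (Theta us u - c).
  move=> u0; have h := is_derive_Phi us u0.
  by apply: trigger_derive; rewrite /GRing.scale /= ?mulr1; ring.
have mx (u : R) : 0 < u -> Phi us u - pi *+ 2 * u <= Phi us y1 - pi *+ 2 * y1.
  move=> u0; have [uy|yu] := leP u y1.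
    apply: (@le_of_derive R (fun y => Phi us y - pi *+ 2 * y) (fun v => Theta us v - pi *+ 2)) => // v /andP[v1 v2].
      by apply: dPsi; apply: lt_le_trans v1.
    by rewrite subr_ge0 s1 // (lt_trans u0 v1) ltW.
  apply: (@ge_of_derive R (fun y => Phi us y - pi *+ 2 * y) (fun v => Theta us v - pi *+ 2)); first exact: ltW.
    by move=> v /andP[v1 v2]; apply: dPsi; apply: lt_le_trans v1.
  by move=> v /andP[v1 v2]; rewrite subr_le0 s2 // ltW.
have H0 : 0 < H.
  rewrite /H /us -cats1 big_cat big_seq1 /= ltr_pwDl //.
  case: ts sz tp {hp us e1 s1 s2 H dPsi mx} => [|t ts] // _ /= /andP[t0 _].
  by rewrite big_cons ltr_pwDl ?normr_gt0 ?gt_eqF // sumr_ge0.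
have small (u : R) : 0 < u -> u <= H -> Phi us u - (pi *+ 2 - e) * u <= Phi us y1 - pi *+ 2 * y1 + e * H.
  move=> u0 uH; have := mx u u0; have : e * u <= e * H by rewrite ler_wpM2l // ltW.
  lra.
have [yH|Hy] := leP y H; first exact: small.
apply: le_trans (small H H0 (lexx _)).
apply: (@ge_of_derive R (fun y => Phi us y - (pi *+ 2 - e) * y) (fun v => Theta us v - (pi *+ 2 - e))).
- exact: ltW.
- by move=> v /andP[v1 v2]; apply: dPsi; apply: lt_le_trans v1.
move=> v /andP[v1 v2]; have := Theta_lt1 (ltW v1) (lt_trans H0 v1).
have := pi_ge2 R; rewrite -mulr_natl; lra.
Qed.
End MaximumPrinciple.

(** * The position of z_1, read off its equation *)

Section SaddlePoint.
Variable R : realType.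
Local Notation normc := (@Normc.normc R).
Implicit Types (u y t : R).

Lemma normc_pair u y : normc (u +i* y)%C = Num.sqrt (u ^+ 2 + y ^+ 2).
Proof. by []. Qed.

Lemma polar u y : 0 < y ->
  (u +i* y)%C = (normc (u +i* y)%C)%:C%C * cexp 0 (pi / 2 - atan (u / y)).
Proof.
move=> y0; have yn : y != 0 by rewrite gt_eqF.
rewrite normc_pair; set r := Num.sqrt _.
have er : r = y * Num.sqrt (1 + (u / y) ^+ 2).
  have -> : y = Num.sqrt (y ^+ 2) by rewrite sqrtr_sqr gtr0_norm.
  rewrite -sqrtrM ?sqr_ge0 // sqrtr_sqr gtr0_norm // /r; congr Num.sqrt.
  by field.
have s0 : 0 < Num.sqrt (1 + (u / y) ^+ 2) by rewrite sqrtr_gt0 ltr_pwDl // sqr_ge0.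
have ec : cos (atan (u / y)) = (Num.sqrt (1 + (u / y) ^+ 2))^-1 by exact: cos_atan.
have es : sin (atan (u / y)) = u / y * (Num.sqrt (1 + (u / y) ^+ 2))^-1.
  by rewrite -ec -{2}(atanK (u / y)) /tan mulfVK // ec invr_eq0 gt_eqF.
rewrite /cexp; have -> : pi / 2 - atan (u / y) = - atan (u / y) + pi / 2 by ring.
rewrite cosDpihalf sinDpihalf sinN cosN opprK expR0 !mul1r ec es er; simpc.
move: s0; set s := Num.sqrt _ => s0.
by apply/eqP; rewrite eq_complex /=; apply/andP; split; apply/eqP; field; rewrite ?yn ?gt_eqF.
Qed.

Lemma cos_eq1 t : 0 < t < 3 * pi -> cos t = 1 -> t = pi *+ 2.
Proof.
move=> /andP[t0 t3] h; have p0 := @pi_gt0 R.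
have e : t = (t / 2) *+ 2 by rewrite -mulr_natr; field.
have s0 : sin (t / 2) = 0.
  move: h; rewrite {1}e cos_mulr2n cos2sin2 -mulr_natl => h.
  by apply/eqP; rewrite -sqrf_eq0; apply/eqP; lra.
rewrite e; congr (_ *+ 2); apply/eqP; rewrite eq_le; apply/andP; split; rewrite leNgt; apply/negP => lt.
  have : sin (t / 2 - pi) = 0 by rewrite sinB s0 sinpi mulr0 mul0r subrr.
  by apply/eqP; rewrite gt_eqF // sin_gt0_pi //; apply/andP; split; lra.
by move/eqP: s0; rewrite gt_eqF // sin_gt0_pi //; apply/andP; split; lra.
Qed.

Variables (a b c y x : R).
Hypotheses (a0 : 0 < a) (ab : 4 * a < b) (y0 : 0 < y) (x0 : 0 < x) (x1 : x < 1).
Let z : R[i] := ((- c) +i* y)%C.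
Let w t : R[i] := ((t - c) +i* y)%C.
Hypothesis zeq : w (2 * a) * w a * w 0 = (x^-1)%:C%C * (w (b - 2 * a) * w (b - a) * w b).

Let nw_gt0 t : 0 < normc (w t).
Proof. by rewrite normc_pair sqrtr_gt0 sumsq_gt0. Qed.

Lemma saddle_norm : normc (w (2 * a)) * normc (w a) * normc (w 0) =
  x^-1 * (normc (w (b - 2 * a)) * normc (w (b - a)) * normc (w b)).
Proof.
have := congr1 normc zeq; rewrite !Normc.normcM normc_real => ->.
by rewrite gtr0_norm ?invr_gt0.
Qed.

(** If z_1 were not to the left of - b/2, each |w t| with t <= b/2 would be at most |w (b - t)|,
    contradicting 1 / x > 1 in the equation of the moduli. *)
Lemma saddle_right : b / 2 < c.
Proof.
have A0 := a0; have AB := ab; have X1 := x1.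
rewrite ltNge; apply/negP => cb.
have le t : t <= b / 2 -> normc (w t) <= normc (w (b - t)).
  move=> tb; rewrite !normc_pair ler_sqrt ?(ltW (sumsq_gt0 _ _)) // lerD2r -subr_ge0.
  have -> : (b - t - c) ^+ 2 - (t - c) ^+ 2 = (b - 2 * t) * (b - 2 * c) by ring.
  by rewrite mulr_ge0 //; lra.
have l1 := le (2 * a); have l2 := le a; have l3 := le 0; rewrite subr0 in l3.
have pos t := ltW (nw_gt0 t).
have h : normc (w (2 * a)) * normc (w a) * normc (w 0) <= normc (w (b - 2 * a)) * normc (w (b - a)) * normc (w b).
  have h0 : 0 <= b / 2 by lra.
  have ha : a <= b / 2 by lra.
  have h2a : 2 * a <= b / 2 by lra.
  exact: (ler_pM (mulr_ge0 (pos _) (pos _)) (pos _) (ler_pM (pos _) (pos _) (l1 h2a) (l2 ha)) (l3 h0)).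
move: h; rewrite saddle_norm; set P := _ * normc (w b).
have P0 : 0 < P by rewrite !mulr_gt0.
by rewrite -ler_pdivlMr // divff ?gt_eqF // leNgt invf_gt1 // x1.
Qed.

Definition saddle_list : seq R := [:: c - 2 * a; c - a; c; b - c; b - a - c].

Let th t : R := atan ((c - t) / y) + atan ((b - t - c) / y).

Let th_bounds t : 2 * t < b -> 0 < th t < pi.
Proof.
have A0 := a0; have AB := ab; have X1 := x1.
move=> tb; rewrite /th; apply/andP; split.
  rewrite -ltrBlDr sub0r -atanN; apply: lt_atan; rewrite -mulNr ltr_pM2r ?invr_gt0 //; lra.
have := @atan_ltpi2 R ((c - t) / y); have := @atan_ltpi2 R ((b - t - c) / y); lra.
Qed.

Lemma Theta_saddleE : Theta (rcons saddle_list (b - 2 * a - c)) y = th (2 * a) + th a + th 0.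
Proof. by rewrite /Theta /saddle_list /= !big_cons big_nil /th !subr0; ring. Qed.

(** The arguments in the equation agree modulo 2 pi, and their difference regroups into three
    angles, each strictly between 0 and pi; the only multiple of 2 pi between 0 and 3 pi is 2 pi. *)
Lemma Theta_saddle : Theta (rcons saddle_list (b - 2 * a - c)) y = pi *+ 2.
Proof.
have A0 := a0; have AB := ab; have X1 := x1.
rewrite Theta_saddleE; apply: cos_eq1.
  have t1 : 2 * (2 * a) < b by lra.
  have t2 : 2 * a < b by lra.
  have t3 : 2 * 0 < b by lra.
  have /andP[h1 h2] := th_bounds t1; have /andP[h3 h4] := th_bounds t2; have /andP[h5 h6] := th_bounds t3.
  by apply/andP; split; lra.
have n t : (normc (w t))%:C%C != 0 :> R[i] by rewrite -(rmorph0 (real_complex R)) (inj_eq (@complexI R)) gt_eqF.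
have P t : w t = (normc (w t))%:C%C * cexp 0 (pi / 2 - atan ((t - c) / y)) by exact: polar.
have := zeq; rewrite (P (2 * a)) (P a) (P 0) (P (b - 2 * a)) (P (b - a)) (P b).
have sep (u1 u2 u3 v1 v2 v3 : R[i]) : u1 * v1 * (u2 * v2) * (u3 * v3) = (u1 * u2 * u3) * (v1 * v2 * v3) by ring.
rewrite !sep -!cexpD !addr0 -!rmorphM /= saddle_norm mulrA -rmorphM /=.
set A := (_ * _)%:C%C; set al := _ - _ + _ + _; set be := _ - _ + _ + _ => e.
have An0 : A != 0.
  rewrite /A -(rmorph0 (real_complex R)) (inj_eq (@complexI R)) gt_eqF //.
  by rewrite mulr_gt0 ?invr_gt0 ?mulr_gt0 ?nw_gt0.
have {}e : cexp 0 al = cexp 0 be := mulfI An0 e.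
have E : cexp 0 (al - be) = 1 :> R[i].
  by rewrite -[X in cexp X _](addr0 0) cexpD e -cexpD addrN addr0 cexp0.
have := congr1 (@complex.Re R) E; rewrite /= expR0 mul1r => h; apply: etrans h; congr cos.
rewrite /al /be /th !subr0 sub0r.
have an u v : v = - u -> atan (v / y) = - atan (u / y) by move=> ->; rewrite mulNr atanN.
rewrite (an (c - 2 * a) (2 * a - c)) ?opprB // (an (c - a) (a - c)) ?opprB // (an c (- c)) //.
ring.
Qed.

(** Otherwise two of the three angles would be below pi / 2 and the third below pi, too little for a
    sum of 2 pi. *)
Lemma saddle_left : c < b - a.
Proof.
have A0 := a0; have AB := ab; have X1 := x1.
rewrite ltNge; apply/negP => cb.
have := Theta_saddle; rewrite Theta_saddleE => e.
have neg t : b - t <= c -> th t < pi / 2.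
  move=> h; rewrite /th; have : atan ((b - t - c) / y) <= atan 0.
    by apply: le_atan; rewrite mulr_le0_ge0 ?invr_ge0 ?(ltW y0) //; lra.
  by rewrite atan0; have := @atan_ltpi2 R ((c - t) / y); lra.
have t3 : 2 * 0 < b by lra.
have /andP[_ h0] := th_bounds t3.
have n1 : th a < pi / 2 by apply: neg; lra.
have n2 : th (2 * a) < pi / 2 by apply: neg; lra.
by move: e n1 n2 h0; move: (th (2 * a)) (th a) (th 0) => t1 t2 t4; lra.
Qed.

Lemma saddle_list_gt0 : all (fun t => 0 < t) saddle_list.
Proof. have A0 := a0; have AB := ab. by have := saddle_right; have := saddle_left => h1 h2 /=; apply/and5P; split; try apply/andP; try split=> //; lra. Qed.

(** If the negative length were at least b - a - c in size, its arctangent in [Dev] would be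
    outweighed by that of b - a - c, leaving [Dev] negative although it must vanish; the other
    comparisons follow from c > b/2 and b > 4a. *)
Lemma saddle_list_lt : b - 2 * a - c < 0 -> all (fun t => - (b - 2 * a - c) < t) saddle_list.
Proof.
have A0 := a0; have AB := ab; have X1 := x1.
move=> neg; have h1 := saddle_left; have h2 := saddle_right.
have q0 : 0 < b - a - c by lra.
suff : - (b - 2 * a - c) < b - a - c.
  by move=> h /=; apply/and5P; split; try apply/andP; try split=> //; lra.
rewrite ltNge; apply/negP => le.
have p0 : 0 < - (b - 2 * a - c) by lra.
have := Theta_saddle; rewrite -[b - 2 * a - c]opprK.
have tp : all (fun t => 0 < t) saddle_list := saddle_list_gt0.
move/eqP; rewrite -subr_eq0 Theta_Dev //; apply/negP; rewrite lt_eqF //.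
rewrite /Dev /saddle_list !big_cons big_nil.
have ag t : 0 < t -> 0 < atan (y / t) by move=> t0; apply: atan_gt0; rewrite divr_gt0.
have l1 : atan (y / - (b - 2 * a - c)) <= atan (y / (b - a - c)).
  by apply: le_atan; rewrite ler_wpM2l ?(ltW y0) // lef_pV2 ?posrE.
have g1 := ag (c - 2 * a); have g2 := ag (c - a); have g3 := ag c; have g4 := ag (b - c).
have c1 : 0 < c - 2 * a by lra.
have c2 : 0 < c - a by lra.
have c3 : 0 < c by lra.
have c4 : 0 < b - c by lra.
have := g1 c1; have := g2 c2; have := g3 c3; have := g4 c4; lra.
Qed.
End SaddlePoint.

(** * Decay of the linear forms *)

Section VerticalProducts.
Variable R : realType.
Local Notation normc := (@Normc.normc R).
Implicit Types (y t X Z M B : R).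

Section Fixed_y.
Variable y : R.
Hypothesis y0 : 0 <= y.
(** Raising the height by 1 makes ln |s + i Y| nonnegative, so that [Gam Y] is monotone. *)
Let Y := y + 1.
Let Y1 : 1 <= Y. Proof. by rewrite lerDr. Qed.
Let Y0 : 0 < Y. Proof. exact: lt_le_trans Y1. Qed.

Definition vmod t : R := Num.sqrt (t ^+ 2 + y ^+ 2).
Definition vprod N A : R := \prod_(l < N) vmod (A%:R - l%:R).

Lemma vmod_ge0 t : 0 <= vmod t. Proof. exact: sqrtr_ge0. Qed.

Lemma vprod_ge0 N A : 0 <= vprod N A.
Proof. by apply: prodr_ge0 => l _; exact: vmod_ge0. Qed.

Lemma vmod_le t : 0 <= t -> vmod t <= expR (Gam Y (t + 1) - Gam Y t).
Proof.
move=> t0; apply: le_trans (_ : expR (ln (t ^+ 2 + Y ^+ 2) / 2) <= _); last first.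
  by rewrite ler_expR Gam_incr_ge.
rewrite -[X in _ <= X]ger0_norm ?expR_ge0 // -sqrtr_sqr -expRM_natl mulrC mulfVK ?pnatr_eq0 //.
rewrite lnK ?posrE ?sumsq_gt0 // ler_sqrt ?(ltW (sumsq_gt0 _ _)) // lerD2l lerXn2r ?nnegrE ?(ltW Y0) //.
by rewrite lerDl.
Qed.

Lemma vmodN t : vmod (- t) = vmod t.
Proof. by rewrite /vmod sqrrN. Qed.

Lemma vprod_upper N A : (N <= A)%N -> vprod N A <= expR (Gam Y (A%:R + 1) - Gam Y (A%:R + 1 - N%:R)).
Proof.
elim: N => [|N IH] NA; first by rewrite /vprod big_ord0 subr0 subrr expR0.
have NA' : (N <= A)%N := ltnW NA.
have t0 : 0 <= A%:R - N%:R :> R by rewrite subr_ge0 ler_nat.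
rewrite /vprod big_ord_recr /= -/(vprod N A).
apply: le_trans (ler_pM (vprod_ge0 _ _) (vmod_ge0 _) (IH NA') (vmod_le t0)) _.
rewrite -expRD ler_expR -natr1.
have -> : A%:R - N%:R + 1 = A%:R + 1 - N%:R :> R by ring.
have -> : A%:R + 1 - (N%:R + 1) = A%:R - N%:R :> R by ring.
by rewrite addrA subrK.
Qed.

(** When the zeros lie on both sides, the factor l = A has modulus exactly y. It is kept: two such
    factors give the y^2 that [poisson_bound] requires. *)
Lemma vprod_cross j A : vprod (A.+1 + j) A <= y * expR (Gam Y (A%:R + 1) + Gam Y (j%:R + 1)).
Proof.
elim: j => [|j IH].
  rewrite addn0 /vprod big_ord_recr /= -/(vprod A A) subrr add0r mulrC.
  have -> : vmod 0 = y by rewrite /vmod expr0n add0r sqrtr_sqr ger0_norm.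
  rewrite ler_wpM2l //; apply: le_trans (vprod_upper (leqnn A)) _; rewrite ler_expR.
  have -> : A%:R + 1 - A%:R = 1 :> R by ring.
  by have := @Gam_ge0 R Y 1 Y1 ler01; lra.
rewrite addnS /vprod big_ord_recr /= -/(vprod (A.+1 + j) A).
have -> : A%:R - (A.+1 + j)%:R = - (j%:R + 1) :> R by rewrite natrD -natr1; ring.
have j0 : 0 <= j%:R + 1 :> R by rewrite addr_ge0.
rewrite vmodN; apply: le_trans (ler_pM (vprod_ge0 _ _) (vmod_ge0 _) IH (vmod_le j0)) _.
rewrite -mulrA ler_wpM2l // -expRD ler_expR -[j.+1%:R]natr1; lra.
Qed.

Lemma vprod_bound_cross N A X Z M : (A < N)%N -> A%:R <= X -> N%:R - A%:R <= Z + 1 -> 0 <= Z ->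
  X + 1 + Y <= M -> Z + 1 + Y <= M ->
  vprod N A <= y * (M ^+ 2 * expR (Gam Y X + Gam Y Z)).
Proof.
move=> AN AX NX X0 h1 h2.
have A0 : 0 <= A%:R :> R by [].
have X00 : 0 <= X by lra.
have M0 : 0 < M by have := Y0; lra.
have e : N = (A.+1 + (N - A.+1))%N by rewrite subnKC.
rewrite e; apply: le_trans (vprod_cross _ _) _; rewrite ler_wpM2l //.
have -> : M ^+ 2 = expR (ln M + ln M) by rewrite expRD lnK ?posrE // expr2.
rewrite -expRD ler_expR.
have g1 : Gam Y (A%:R + 1) <= Gam Y X + ln M.
  by apply: le_trans (Gam_incr_le Y1 X00 h1); apply: le_Gam => //; lra.
have g2 : Gam Y ((N - A.+1)%:R + 1) <= Gam Y Z + ln M.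
  apply: le_trans (Gam_incr_le Y1 X0 h2); apply: le_Gam => //.
  by rewrite natr1 subnSK // natrB // ltnW.
lra.
Qed.

Lemma vprod_bound_upper N A X Z M : (N <= A)%N -> A%:R <= X -> - Z <= A%:R + 1 - N%:R ->
  X + 1 + Y <= M -> vprod N A <= M * expR (Gam Y X + Gam Y Z).
Proof.
move=> NA AX NX h1; have A0 : 0 <= A%:R :> R by [].
have X00 : 0 <= X by lra.
have M0 : 0 < M by have := Y0; lra.
apply: le_trans (vprod_upper NA) _.
rewrite -{1}[M]lnK ?posrE // -expRD ler_expR.
have g1 : Gam Y (A%:R + 1) <= Gam Y X + ln M.
  by apply: le_trans (Gam_incr_le Y1 X00 h1); apply: le_Gam => //; lra.
have : Gam Y (- Z) <= Gam Y (A%:R + 1 - N%:R) by apply: le_Gam.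
by rewrite GamN; lra.
Qed.

Lemma normc_cbin h m : normc (map_poly (real_complex R) (@cbin R h)).[m%:R + 'i%C * y%:C%C] =
  (h.*2.+1`!%:R)^-1 * vprod h.*2.+1 (m + h).
Proof.
rewrite /cbin map_comp_poly rmorphD /= map_polyX map_polyC /= horner_comp hornerD hornerX hornerC.
rewrite /binp map_polyZ hornerZ Normc.normcM normc_real ger0_norm ?invr_ge0 //; congr (_ * _).
rewrite /ffp rmorph_prod horner_prod /vprod.
rewrite (big_morph normc (@Normc.normcM R) (Normc.normc1 R)); apply: eq_bigr => l _.
rewrite rmorphB /= map_polyX map_polyC /= hornerXsubC /vmod.
suff -> : m%:R + 'i%C * y%:C%C + (h%:R)%:C%C - (l%:R)%:C%C = (((m + h)%:R - l%:R) +i* y)%C by [].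
by rewrite natrD -(rmorph_nat (real_complex R)) ; simpc; congr (_ +i* _)%C; ring.
Qed.
End Fixed_y.

Lemma inv_fact_le N : (0 < N)%N -> (N`!%:R)^-1 <= expR (N%:R - N%:R * ln N%:R) :> R.
Proof.
case: N => // N _; have N0 : 0 < N.+1%:R :> R by [].
have f0 : 0 < N.+1`!%:R :> R by rewrite ltr0n fact_gt0.
have := expR_ge1Dxn N (ltW N0) => h.
have {}h : N.+1%:R ^+ N.+1 / N.+1`!%:R <= expR N.+1%:R :> R by apply: le_trans h; rewrite lerDr.
rewrite expRB expRM_natl lnK ?posrE // ler_pdivlMr ?exprn_gt0 //.
by rewrite mulrC.
Qed.

(** The terms in n ln n and the linear terms from [Gam] cancel against those of 1 / N!, which leaves
    an exponent exactly proportional to n. *)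
Lemma Gam_fact_scale (n : R) e t t' N : 0 < n -> 0 < e -> (0 < N)%N -> N%:R = n * (t + t') ->
  (N`!%:R)^-1 * expR (Gam (n * e) (n * t) + Gam (n * e) (n * t')) <=
  expR (n * (Fat t e + Fat t' e - (t + t') * ln (t + t'))) :> R.
Proof.
move=> n0 e0 N0 eN; apply: le_trans (ler_wpM2r (expR_ge0 _) (inv_fact_le N0)) _.
have t0 : 0 < t + t' by rewrite -(pmulr_rgt0 _ n0) -eN ltr0n.
rewrite -expRD ler_expR eN lnM ?posrE // !Gam_scale // le_eqVlt; apply/orP; left; apply/eqP; ring.
Qed.
End VerticalProducts.

(** * Bounds for T on the vertical line through the starting zero *)

Section SmallForms.
Variable R : realType.
Local Notation normc := (@Normc.normc R).
Local Notation cbin := (@cbin R).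
Variables (a b : nat) (c : R).
Hypotheses (a0 : (0 < a)%N) (ob : odd b) (ab : (4 * a < b)%N).
Hypotheses (cr : b%:R / 2 < c) (cl : c < b%:R - a%:R).

Definition params : seq R := rcons (saddle_list a%:R b%:R c) (b%:R - 2 * a%:R - c).

Definition entropy : R := \sum_(d <- [:: (2 * a)%N; a; 0%N]) width R b d * ln (width R b d).

Section Fixed_n.
Variable n : nat.
Hypothesis on : odd n.

Definition nuc := absz (fl (c * n%:R)).
(** The integer at which the summation starts, close to n (c - b/2); it is a double zero of T
    because it does not exceed [half2] (see [mid_le]). *)
Definition mid := (nuc - half3 b n)%N.

Let n1 : 1 <= n%:R :> R. Proof. by rewrite ler1n; case: (n) on. Qed.
Let n0 : 0 < n%:R :> R. Proof. by have := n1; lra. Qed.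
Let b0 : 0 <= b%:R :> R. Proof. by []. Qed.
Let aR : 1 <= a%:R :> R. Proof. by rewrite ler1n. Qed.

Lemma nuc_bounds : nuc%:R <= c * n%:R /\ c * n%:R < nuc%:R + 1.
Proof.
have h : 0 <= c * n%:R by rewrite mulr_ge0 //; have := b0; have := cr; lra.
have e : nuc%:R = (fl (c * n%:R))%:~R :> R by rewrite -[nuc%:R]/(nuc%:Z%:~R) /nuc gez0_abs // floor_ge0.
by rewrite e; have /andP[h1 h2] := floor_itv (c * n%:R); split=> //; move: h2; rewrite rmorphD.
Qed.

Lemma half3R : (half3 b n)%:R = (b%:R * n%:R - 1) / 2 :> R.
Proof.
have [_ _ e] := halves ob on ab.
have : (half3 b n).*2.+1%:R = (b * n)%:R :> R by rewrite e.
by rewrite -natr1 -addnn natrD natrM => h; lra.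
Qed.

Lemma half3_nuc : (half3 b n <= nuc)%N.
Proof.
rewrite -ltnS -(@ltr_nat R) -natr1 half3R; have [_] := nuc_bounds; apply: le_lt_trans.
have : b%:R / 2 * n%:R <= c * n%:R by rewrite ler_wpM2r // ltW.
lra.
Qed.

Lemma midR : mid%:R = nuc%:R - (half3 b n)%:R :> R.
Proof. by rewrite /mid natrB // half3_nuc. Qed.

Lemma mid_le : (mid <= half2 a b n)%N.
Proof.
rewrite /mid leq_subLR -ltnS -(@ltr_nat R) -natr1 natrD half3R.
have [_ e _] := halves ob on ab.
have ab2 : (2 * a <= b)%N by move: ab; clear; lia.
have : (half2 a b n).*2.+1%:R = ((b - 2 * a) * n)%:R :> R by rewrite e.
rewrite -natr1 -addnn natrD natrM natrB // natrM => h.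
have [h1 _] := nuc_bounds.
have : c * n%:R < (b%:R - a%:R) * n%:R by rewrite ltr_pM2r.
lra.
Qed.

(** The factor y appears when [mid] is a zero of this [cbin h], which c < b - d ensures. For d = 2a
    it may fail to be one, whence the second bound; the powers of M absorb the roundings. *)
Lemma factor_bound y d h : 0 <= y -> (2 * d < b)%N -> (h.*2.+1 = (b - 2 * d) * n)%N ->
  (half3 b n = h + d * n)%N -> d%:R <= c ->
  let M := b%:R * n%:R + 1 + (y + 1) in
  let E := expR (n%:R * (Fat (c - d%:R) ((y + 1) / n%:R) + Fat (b%:R - d%:R - c) ((y + 1) / n%:R)
      - width R b d * ln (width R b d))) in
  let F := normc (map_poly (real_complex R) (cbin h)).[mid%:R + 'i%C * y%:C%C] in
  (c < b%:R - d%:R -> F <= y * M ^+ 2 * E) /\ F <= M ^+ 3 * E.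
Proof.
move=> y0 db eh e3 dc M E F.
have [nu1 nu2] := nuc_bounds.
have y1 : 0 < y + 1 by lra.
have eN : h.*2.+1%:R = n%:R * (b%:R - 2 * d%:R) :> R.
  by rewrite eh natrM natrB ?(ltnW db) // natrM mulrC.
have eA : (mid + h)%:R = nuc%:R - d%:R * n%:R :> R.
  by rewrite natrD midR e3 natrD natrM; ring.
have dn : 0 <= d%:R * n%:R :> R by rewrite mulr_ge0.
set t := c - d%:R; set t' := b%:R - d%:R - c.
have tt : t + t' = width R b d by rewrite /t /t' /width; ring.
have eX : n%:R * t = c * n%:R - d%:R * n%:R by rewrite /t; ring.
have eZ : n%:R * t' = b%:R * n%:R - d%:R * n%:R - c * n%:R by rewrite /t'; ring.
have cn : c * n%:R < b%:R * n%:R by rewrite ltr_pM2r //; have := cl; have := aR; lra.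
have cn0 : 0 <= c * n%:R by rewrite mulr_ge0 //; have := b0; have := cr; lra.
have N0 : 0 < h.*2.+1%:R :> R by [].
have yn : 0 < (y + 1) / n%:R by rewrite divr_gt0.
have sc := @Gam_fact_scale R n%:R _ t t' h.*2.+1 n0 yn isT.
have {}sc := sc _; rewrite tt eN in sc; have {}sc := sc erefl.
have ny : n%:R * ((y + 1) / n%:R) = y + 1 by rewrite mulrC divfK // gt_eqF.
rewrite ny -/E in sc.
have FE : F = (h.*2.+1`!%:R)^-1 * vprod y h.*2.+1 (mid + h) by exact: normc_cbin.
have i0 : 0 <= (h.*2.+1`!%:R)^-1 :> R by rewrite invr_ge0.
have E0 : 0 < E by apply: expR_gt0.
have bn0 : 0 <= b%:R * n%:R :> R by rewrite mulr_ge0.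
have M1 : 1 <= M by rewrite /M; lra.
have yM : y <= M by rewrite /M; lra.
have cross : (mid + h < h.*2.+1)%N -> F <= y * M ^+ 2 * E.
  move=> lt; have ltR : (mid + h)%:R + 1 <= h.*2.+1%:R :> R by rewrite natr1 ler_nat.
  have h1 : vprod y h.*2.+1 (mid + h) <= y * (M ^+ 2 * expR (Gam (y + 1) (n%:R * t) + Gam (y + 1) (n%:R * t'))).
    apply: vprod_bound_cross => //; rewrite ?eX ?eZ /M; move: ltR; rewrite eA eN; lra.
  rewrite FE; apply: le_trans (ler_wpM2l i0 h1) _.
  have -> u v w s : u * (v * (w * s)) = v * w * (u * s) :> R by ring.
  by rewrite ler_wpM2l // mulr_ge0 // exprn_ge0 //; lra.
have ycM : y * M ^+ 2 * E <= M ^+ 3 * E.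
  by rewrite ler_wpM2r ?(ltW E0) // [M ^+ 3]exprS ler_wpM2r // exprn_ge0 //; lra.
have [lt|ge] := ltnP (mid + h) h.*2.+1.
  by split=> [_|]; [apply: cross|apply: le_trans ycM; apply: cross].
have geR : h.*2.+1%:R <= (mid + h)%:R :> R by rewrite ler_nat.
split=> [cd|].
  have : c * n%:R < (b%:R - d%:R) * n%:R by rewrite ltr_pM2r.
  by move: geR; rewrite eN eA; lra.
have h1 : vprod y h.*2.+1 (mid + h) <= M * expR (Gam (y + 1) (n%:R * t) + Gam (y + 1) (n%:R * t')).
  apply: vprod_bound_upper => //; rewrite ?eX ?eZ ?eA ?eN /M; move: nu1 nu2; lra.
rewrite FE; apply: le_trans (ler_wpM2l i0 h1) _.
have -> u v w : u * (v * w) = v * (u * w) :> R by ring.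
apply: ler_pM; rewrite ?mulr_ge0 ?expR_ge0 //; first lra.
by rewrite -[X in X <= _]mulr1 [M ^+ 3]exprS ler_wpM2l ?exprn_ege1 //; lra.
Qed.

Lemma Tpol_vertical y : 0 <= y ->
  normc (map_poly (real_complex R) (Tpol R a b n)).[mid%:R + 'i%C * y%:C%C] <=
  y ^+ 2 * (b%:R * n%:R + 1 + (y + 1)) ^+ 7 *
    expR (n%:R * (Phi params ((y + 1) / n%:R) - entropy)).
Proof.
move=> y0; have [e1 e2 e3] := halves ob on ab.
have h2a : (2 * a < b)%N by move: ab; clear; lia.
have h22a : (2 * (2 * a) < b)%N by rewrite mulnA.
have h0 : (2 * 0 < b)%N by move: ab; clear; lia.
have ab' : 4 * a%:R < b%:R :> R by rewrite -natrM ltr_nat.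
have s1 : half3 b n = (half1 a b n + 2 * a * n)%N.
  by rewrite /half3 (half_shift n (ltnW h22a)) mulnA.
have s2 : half3 b n = (half2 a b n + a * n)%N by rewrite /half3 (half_shift n (ltnW h2a)).
have c1 : (2 * a)%:R <= c by rewrite natrM; have := cr; lra.
have c2 : a%:R <= c by have := cr; have := aR; lra.
have c3 : 0%:R <= c by have := cr; have := b0; lra.
have E1 : (half1 a b n).*2.+1 = ((b - 2 * (2 * a)) * n)%N by rewrite mulnA.
have E3 : (half3 b n).*2.+1 = ((b - 2 * 0) * n)%N by rewrite muln0 subn0.
have s3 : half3 b n = (half3 b n + 0 * n)%N by rewrite mul0n addn0.
have [_ f1] := factor_bound y0 h22a E1 s1 c1.
have [f2 _] := factor_bound y0 h2a e2 s2 c2.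
have [f3 _] := factor_bound y0 h0 E3 s3 c3.
have {}f2 := f2 cl.
have cb : c < b%:R - 0%:R by have := cl; have := aR; rewrite subr0; lra.
have {}f3 := f3 cb.
move: f1 f2 f3; set M := _ + (y + 1); set eta := (y + 1) / _.
set G1 := expR _; set G2 := expR _; set G3 := expR _ => f1 f2 f3.
have -> : expR (n%:R * (Phi params eta - entropy)) = G1 * G2 * G3.
  rewrite /G1 /G2 /G3 -!expRD; congr expR.
  rewrite /Phi /params /saddle_list /= /entropy !big_cons !big_nil natrM !subr0.
  have -> : b%:R - a%:R - c = b%:R - a%:R - c :> R by [].
  ring.
have M0 : 0 <= M by rewrite /M !addr_ge0 // mulr_ge0.
rewrite /Tpol !rmorphM /= !hornerM !Normc.normcM.
have -> : y ^+ 2 * M ^+ 7 * (G1 * G2 * G3) = (M ^+ 3 * G1) * (y * M ^+ 2 * G2) * (y * M ^+ 2 * G3) by ring.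
exact: (ler_pM (mulr_ge0 (normc_ge0 _) (normc_ge0 _)) (normc_ge0 _) (ler_pM (normc_ge0 _) (normc_ge0 _) f1 f2) f3).
Qed.
End Fixed_n.
End SmallForms.

Lemma exp_ge_pow (R : realType) (k : nat) (s M : R) : 0 < s -> 0 <= M ->
  M ^+ k.+1 <= k.+1`!%:R / s ^+ k.+1 * expR (s * M).
Proof.
move=> s0 M0; have := expR_ge1Dxn k (mulr_ge0 (ltW s0) M0) => h.
have f0 : 0 < k.+1`!%:R :> R by rewrite ltr0n fact_gt0.
have {}h : (s * M) ^+ k.+1 / k.+1`!%:R <= expR (s * M) by apply: le_trans h; rewrite lerDr.
rewrite mulrAC ler_pdivlMr ?exprn_gt0 // -exprMn [M * s]mulrC [X in _ <= X]mulrC.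
by rewrite -ler_pdivrMr.
Qed.

Section SmallBound.
Variable R : realType.
Local Notation normc := (@Normc.normc R).
Variables (a b : nat) (c x y1 : R).
Hypotheses (a0 : (0 < a)%N) (ob : odd b) (ab : (4 * a < b)%N).
Hypotheses (cr : b%:R / 2 < c) (cl : c < b%:R - a%:R) (x0 : 0 < x) (x1 : x < 1) (y10 : 0 < y1).
Hypothesis hpos : all (fun t => 0 < t) (saddle_list a%:R b%:R c).
Hypothesis hlt : b%:R - 2 * a%:R - c < 0 ->
  all (fun t => - (b%:R - 2 * a%:R - c) < t) (saddle_list a%:R b%:R c).
Hypothesis hTheta : Theta (params a b c) y1 = pi *+ 2.

(** The last summand is the rate of x^[mid], produced by shifting the start of the sum. *)
Definition saddle_rate : R :=
  Phi (params a b c) y1 - pi *+ 2 * y1 - entropy R a b + (c - b%:R / 2) * ln x.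

Let H : R := \sum_(t <- params a b c) `|t|.

Lemma Tpol_eq0 n mu : (mu <= half2 a b n)%N ->
  (Tpol R a b n).[mu%:R] = 0 /\ (Tpol R a b n)^`().[mu%:R] = 0.
Proof.
move=> h2; have /andP[_ h23] := half_le a b n.
rewrite /Tpol !derivM !hornerE /= (cbin_eq0 R h2) (cbin_eq0 R (leq_trans h2 h23)).
by split; ring.
Qed.

Lemma zsum_mid n : odd n ->
  zsum x (ln x *: Tpol R a b n + (Tpol R a b n)^`()) =
  x ^+ mid b c n * zsum x (ln x *: (Tpol R a b n \Po ('X + (mid b c n)%:R%:P)) +
     (Tpol R a b n \Po ('X + (mid b c n)%:R%:P))^`()).
Proof.
move=> on; set T := Tpol R a b n; set m := mid b c n.
have mh : (m <= half2 a b n)%N by apply: (mid_le ob ab cr cl on).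
rewrite (zsum_shift m) ?lt_eqF // big1 ?add0r => [|l _].
  congr (_ * zsum _ _); rewrite comp_polyD comp_polyZ deriv_comp derivD derivX derivC addr0 mulr1.
  by [].
have [t0 t1] := Tpol_eq0 (leq_trans (ltnW (ltn_ord l)) mh).
by rewrite hornerD hornerZ t0 t1 mulr0 addr0 mul0r.
Qed.

Lemma vertical_bound (e : R) n (y : R) : 0 < e <= 1 -> odd n -> 0 <= y ->
  normc (map_poly (real_complex R) (Tpol R a b n \Po ('X + (mid b c n)%:R%:P))).['i%C * y%:C%C] <=
  (7`!%:R / (e / 2) ^+ 7 * expR (pi *+ 2 + e / 2 * 2) *
    expR (n%:R * (Phi (params a b c) y1 - pi *+ 2 * y1 - entropy R a b + e * (H + b%:R / 2)))) *
  y ^+ 2 * expR ((pi *+ 2 - e / 2) * y).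
Proof.
move=> e01 on y0; have /andP[e0 e1] := e01.
have n1 : 1 <= n%:R :> R by rewrite ler1n; case: (n) on.
have n0 : 0 < n%:R :> R by lra.
have -> : (map_poly (real_complex R) (Tpol R a b n \Po ('X + (mid b c n)%:R%:P))).['i%C * y%:C%C] =
    (map_poly (real_complex R) (Tpol R a b n)).[(mid b c n)%:R + 'i%C * y%:C%C].
  rewrite map_comp_poly rmorphD /= map_polyX map_polyC /= horner_comp hornerD hornerX hornerC.
  by rewrite addrC; congr (_.[_ + _]); rewrite -(rmorph_nat (real_complex R)).
apply: le_trans (Tpol_vertical a0 ob ab cr cl on y0) _.
set M := _ + (y + 1); set et := (y + 1) / _.
have et0 : 0 < et by rewrite divr_gt0 //; lra.
have M0 : 0 <= M by rewrite /M !addr_ge0 // mulr_ge0.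
have e20 : 0 < e / 2 by lra.
(* Half of the margin e absorbs the polynomial factor M^7; the half that concerns y leaves 2 pi - e
   / 2, and the part in n gives the slack e b / 2. *)
have h1 := @exp_ge_pow R 6 (e / 2) M e20 M0.
have h2 := @Phi_max R (saddle_list a%:R b%:R c) _ y1 e et erefl hpos hlt y10 hTheta e01 et0.
rewrite -/(params a b c) -/H in h2.
have ne : n%:R * et = y + 1 by rewrite /et mulrC divfK // gt_eqF.
have h3 : expR (n%:R * (Phi (params a b c) et - entropy R a b)) <=
   expR (n%:R * (Phi (params a b c) y1 - pi *+ 2 * y1 - entropy R a b + e * H) + (pi *+ 2 - e) * (y + 1)).
  rewrite ler_expR -ne.
  have -> : (pi *+ 2 - e) * (n%:R * et) = n%:R * ((pi *+ 2 - e) * et) by ring.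
  by rewrite -mulrDr ler_wpM2l ?(ltW n0) //; lra.
have y2 : 0 <= y ^+ 2 by rewrite sqr_ge0.
apply: le_trans (ler_pM _ (expR_ge0 _) (ler_wpM2l y2 h1) h3) _; first by rewrite mulr_ge0 // exprn_ge0.
set K := _ / _; have K0 : 0 <= K by rewrite divr_ge0 // exprn_ge0 // ltW.
set P := Phi _ _ - _ - _.
have -> : y ^+ 2 * (K * expR (e / 2 * M)) * expR (n%:R * (P + e * H) + (pi *+ 2 - e) * (y + 1)) =
  K * y ^+ 2 * expR (e / 2 * M + (n%:R * (P + e * H) + (pi *+ 2 - e) * (y + 1))).
  by rewrite [expR (e / 2 * M + _)]expRD; ring.
have -> : K * expR (pi *+ 2 + e / 2 * 2) * expR (n%:R * (P + e * (H + b%:R / 2))) * y ^+ 2 *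
   expR ((pi *+ 2 - e / 2) * y) =
  K * y ^+ 2 * expR (pi *+ 2 + e / 2 * 2 + n%:R * (P + e * (H + b%:R / 2)) + (pi *+ 2 - e / 2) * y).
  by rewrite !expRD; ring.
apply: ler_wpM2l; first by rewrite mulr_ge0.
rewrite ler_expR /M; lra.
Qed.

Lemma small_bound (e : R) : 0 < e <= 1 -> {C : R | 0 < C & forall n, odd n ->
  `|zsum x (ln x *: Tpol R a b n + (Tpol R a b n)^`())| <=
    C * expR (n%:R * (saddle_rate + e * (H + b%:R / 2)))}.
Proof.
move=> e01; have /andP[e0 e1] := e01.
have e20 : 0 < e / 2 by lra.
have u0 : ln x < 0 by rewrite ln_lt0 // x0.
pose K := 7`!%:R / (e / 2) ^+ 7 * expR (pi *+ 2 + e / 2 * 2).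
have K0 : 0 < K by rewrite mulr_gt0 ?expR_gt0 // divr_gt0 // exprn_gt0.
pose L := pi *+ 2 / (e / 2) ^+ 3 + 2.
have L0 : 0 < L by rewrite addr_gt0 // divr_gt0 ?exprn_gt0 // mulrn_wgt0 // pi_gt0.
exists (4 * K * L * expR (- ln x)).
  by apply: mulr_gt0 (expR_gt0 _); apply: mulr_gt0 L0; apply: mulr_gt0 K0.
move=> n on; rewrite zsum_mid // normrM.
set m := mid b c n; set Q := Tpol R a b n \Po _.
have Q0 : Q.[0] = 0.
  rewrite /Q horner_shift add0r; apply: (Tpol_eq0 _).1.
  exact: (mid_le ob ab cr cl on).
have Q1 : Q^`().[0] = 0.
  rewrite /Q deriv_comp derivD derivX derivC addr0 mulr1 horner_shift add0r; apply: (Tpol_eq0 _).2.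
  exact: (mid_le ob ab cr cl on).
set P := Phi (params a b c) y1 - pi *+ 2 * y1 - entropy R a b.
pose S := K * expR (n%:R * (P + e * (H + b%:R / 2))).
have S0 : 0 <= S by rewrite mulr_ge0 ?expR_ge0 // ltW.
have pb : `|zsum x (ln x *: Q + Q^`())| <= 4 * S * L.
  rewrite -{1}[x]lnK ?posrE //; apply: poisson_bound => // y y0.
  exact: vertical_bound.
have xm : `|x ^+ m| <= expR (n%:R * ((c - b%:R / 2) * ln x) - ln x).
  rewrite ger0_norm ?exprn_ge0 ?(ltW x0) // -{1}[x]lnK ?posrE // -expRM_natl ler_expR.
  have [_ h] := nuc_bounds cr n.
  have hm : (c - b%:R / 2) * n%:R - 1 <= m%:R.
    by rewrite /m (midR ob ab cr on) (half3R R ob ab on); lra.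
  have -> : n%:R * ((c - b%:R / 2) * ln x) - ln x = ((c - b%:R / 2) * n%:R - 1) * ln x by ring.
  by rewrite ler_wnM2r // ltW.
apply: le_trans (ler_pM (normr_ge0 _) (normr_ge0 _) xm pb) _.
rewrite /S le_eqVlt; apply/orP; left; apply/eqP.
have -> : n%:R * (saddle_rate + e * (H + b%:R / 2)) =
  n%:R * ((c - b%:R / 2) * ln x) + n%:R * (P + e * (H + b%:R / 2)) by rewrite /saddle_rate -/P; ring.
rewrite !expRD; ring.
Qed.
End SmallBound.

(** At the critical height the arctangent terms of [Phi] add up to exactly 2 pi y and disappear,
    leaving only logarithms of moduli; the equation of the moduli then eliminates |z_1|, as in
    [growthE]. *)
Lemma saddle_rateE (R : realType) (a b : nat) (c x y : R) :
  (0 < a)%N -> (4 * a < b)%N -> 0 < x -> 0 < y ->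
  let m t := Normc.normc ((t - c) +i* y)%C in
  m (2 * a%:R) * m a%:R * m 0 = x^-1 * (m (b%:R - 2 * a%:R) * m (b%:R - a%:R) * m b%:R) ->
  Theta (params a b c) y = pi *+ 2 ->
  saddle_rate a b c x y =
    ln (m (b%:R - 2 * a%:R) ^+ (b - 2 * a) * m (b%:R - a%:R) ^+ (b - a) * m b%:R ^+ b
        / (m (2 * a%:R) ^+ (2 * a) * m a%:R ^+ a
           * (b - 4 * a)%:R ^+ (b - 4 * a) * (b - 2 * a)%:R ^+ (b - 2 * a)
           * b%:R ^+ b))
    - b%:R / 2 * ln x.
Proof.
move=> a0 ab x0 y0 m hm hT.
have b2a : (2 * a < b)%N by move: ab; clear; lia.
have ba : (a < b)%N by move: ab; clear; lia.
have b0 : (0 < b)%N by move: ab; clear; lia.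
have mp t : 0 < m t by rewrite /m normc_pair sqrtr_gt0 sumsq_gt0.
have lm t : ln ((t - c) ^+ 2 + y ^+ 2) = 2 * ln (m t).
  have -> : (t - c) ^+ 2 + y ^+ 2 = m t ^+ 2 by rewrite /m normc_pair sqr_sqrtr // ltW // sumsq_gt0.
  by rewrite (lnXn _ (mp t)) mulr_natl.
have lmN t : ln ((c - t) ^+ 2 + y ^+ 2) = 2 * ln (m t) by rewrite -lm -sqrrN opprB.
have p6 : 0 < (b - 4 * a)%:R :> R by rewrite ltr0n subn_gt0.
have p7 : 0 < (b - 2 * a)%:R :> R by rewrite ltr0n subn_gt0.
have p8 : 0 < b%:R :> R by rewrite ltr0n.
have lnx : ln x = ln (m (b%:R - 2 * a%:R)) + ln (m (b%:R - a%:R)) + ln (m b%:R)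
    - (ln (m (2 * a%:R)) + ln (m a%:R) + ln (m 0)).
  have xi : 0 < x^-1 by rewrite invr_gt0.
  have q1 := mulr_gt0 (mp (2 * a%:R)) (mp a%:R).
  have q2 := mulr_gt0 (mp (b%:R - 2 * a%:R)) (mp (b%:R - a%:R)).
  have := congr1 (@ln R) hm.
  rewrite (lnM xi (mulr_gt0 q2 (mp b%:R))) (lnM q2 (mp _)) (lnM (mp _) (mp _)) (lnM q1 (mp _)) (lnM (mp _) (mp _)).
  rewrite lnV ?posrE // => h; rewrite -[LHS]opprK.
  have -> : - ln x = - ln x + (ln (m (b%:R - 2 * a%:R)) + ln (m (b%:R - a%:R)) + ln (m b%:R)) - (ln (m (b%:R - 2 * a%:R)) + ln (m (b%:R - a%:R)) + ln (m b%:R)) by rewrite addrK.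
  by rewrite -h opprB.
have P (u : R) j : 0 < u -> 0 < u ^+ j by move=> u0; exact: exprn_gt0.
have n1 := mulr_gt0 (P _ (b - 2 * a)%N (mp (b%:R - 2 * a%:R))) (P _ (b - a)%N (mp (b%:R - a%:R))).
have n2 := mulr_gt0 n1 (P _ b (mp b%:R)).
have d1 := mulr_gt0 (P _ (2 * a)%N (mp (2 * a%:R))) (P _ a (mp a%:R)).
have d2 := mulr_gt0 d1 (P _ (b - 4 * a)%N p6).
have d3 := mulr_gt0 d2 (P _ (b - 2 * a)%N p7).
have d4 := mulr_gt0 d3 (P _ b p8).
rewrite (ln_div n2 d4) (lnM n1 (P _ _ (mp b%:R))) (lnM (P _ _ (mp _)) (P _ _ (mp _))).
rewrite (lnM d3 (P _ b p8)) (lnM d2 (P _ _ p7)) (lnM d1 (P _ _ p6)) (lnM (P _ _ (mp _)) (P _ _ (mp _))).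
rewrite !lnXn //.
have hP : Phi (params a b c) y - pi *+ 2 * y = \sum_(t <- params a b c) t / 2 * ln (t ^+ 2 + y ^+ 2).
  rewrite -hT /Theta mulr_suml /Phi -sumrB; apply: eq_bigr => t _.
  by rewrite /Fat [y * _]mulrC addrK.
rewrite /saddle_rate hP /entropy /params /saddle_list /= !big_cons !big_nil.
have l0 : ln (c ^+ 2 + y ^+ 2) = 2 * ln (m 0) by rewrite -lmN subr0.
rewrite l0 (lmN (2 * a%:R)) (lmN a%:R) (lm b%:R) (lm (b%:R - a%:R)) (lm (b%:R - 2 * a%:R)).
have w1 : width R b (2 * a) = (b - 4 * a)%:R by rewrite natrB ?(ltnW ab) // /width !natrM; ring.
have w2 : width R b a = (b - 2 * a)%:R by rewrite natrB ?(ltnW b2a) // /width !natrM.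
have w3 : width R b 0 = b%:R by rewrite /width mulr0 subr0.
rewrite w1 w2 w3 lnx -![ln _ *+ _]mulr_natr.
move: (ln (m (2 * a%:R))) (ln (m a%:R)) (ln (m 0)) (ln (m (b%:R - 2 * a%:R))) (ln (m (b%:R - a%:R))) (ln (m b%:R))
  (ln (b - 4 * a)%:R) (ln (b - 2 * a)%:R) (ln b%:R) => u1 u2 u3 u4 u5 u6 u7 u8 u9.
rewrite !natrB ?(ltnW ab) ?(ltnW ba) ?(ltnW b2a) // !natrM; by field.
Qed.

Lemma saddle_upper (R : realType) (a b : nat) (c x y : R) :
  (0 < a)%N -> odd b -> (4 * a < b)%N -> 0 < x -> x < 1 -> 0 < y ->
  let w t := ((t - c) +i* y)%C in
  w (2 * a%:R) * w a%:R * w 0 =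
    (x^-1)%:C%C * (w (b%:R - 2 * a%:R) * w (b%:R - a%:R) * w b%:R) ->
  forall d, 0 < d -> \forall m \near \oo,
    `|zsum x (ln x *: Tpol R a b m.*2.+1 + (Tpol R a b m.*2.+1)^`())|
      <= expR ((saddle_rate a b c x y + d) * oddn R m).
Proof.
move=> a0 ob ab x0 x1 y0 w zeq d d0.
have A0 : 0 < a%:R :> R by rewrite ltr0n.
have AB : 4 * a%:R < b%:R :> R by rewrite -natrM ltr_nat.
have T := Theta_saddle A0 AB y0 x0 x1 zeq.
have cr := saddle_right A0 AB y0 x0 x1 zeq.
have cl := saddle_left A0 AB y0 x0 x1 zeq.
have pos := saddle_list_gt0 A0 AB y0 x0 x1 zeq.
have bnd := saddle_list_lt A0 AB y0 x0 x1 zeq.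
pose H := \sum_(t <- params a b c) `|t| + b%:R / 2.
have H0 : 0 <= H by rewrite addr_ge0 ?sumr_ge0 // divr_ge0.
(* Small enough that e <= 1 and e H <= d / 2, so that the slack of [small_bound] uses half of d; the
   other half absorbs the constant C. *)
pose e := d / 2 / (H + d / 2 + 1).
have D0 : 0 < H + d / 2 + 1 by lra.
have e01 : 0 < e <= 1.
  by apply/andP; split; [apply: divr_gt0; lra | rewrite /e ler_pdivrMr // mul1r; lra].
have eH : e * H <= d / 2.
  rewrite /e mulrAC ler_pdivrMr //; nra.
have [C C0 hC] := small_bound a0 ob ab cr cl x0 x1 y0 pos bnd T e01.
have d2 : 0 < d / 2 by lra.
near=> m.
have h : C * oddn R m ^+ 0 <= expR (d / 2 * oddn R m) by near: m; apply: near_poly_exp.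
apply: le_trans (hC _ (odd_double1 m)) _.
have om := @oddn_gt0 R m.
apply: le_trans (_ : _ <= expR (d / 2 * oddn R m) * expR ((saddle_rate a b c x y + d / 2) * oddn R m)) _.
  rewrite expr0 mulr1 in h; apply: ler_pM h _; rewrite ?(ltW C0) ?expR_ge0 //.
  by rewrite ler_expR [X in _ <= X]mulrC ler_wpM2l ?(ltW om) // lerD2l.
by rewrite -expRD ler_expR le_eqVlt; apply/orP; left; apply/eqP; field.
Unshelve. all: by end_near. Qed.

Theorem theorem1 (R : realType) (k a b : nat) (z0 : R) (z1 : R[i]) (N1 : R) :
  (1 <= k)%N -> (0 < a)%N -> (0 < b)%N -> odd b -> (4 * a < b)%N ->
  (* z0 is the unique real solution, and z0 > b *)
  b%:R < z0 ->
  z0 * (z0 - a%:R) * (z0 - (2 * a)%:R)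
    / ((z0 - (b - 2 * a)%:R) * (z0 - (b - a)%:R) * (z0 - b%:R)) = (xk k)^-1 ->
  (forall z : R, z * (z - a%:R) * (z - (2 * a)%:R)
    / ((z - (b - 2 * a)%:R) * (z - (b - a)%:R) * (z - b%:R)) = (xk k)^-1 ->
    z = z0) ->
  (* z1 is a root of the second equation with Im z1 > 0 *)
  0 < complex.Im z1 ->
  (z1 + (2 * a)%:R) * (z1 + a%:R) * z1
    / ((z1 + (b - 2 * a)%:R) * (z1 + (b - a)%:R) * (z1 + b%:R)) = (((xk k)^-1)%:C)%C ->
  (* N1 = limit over odd n of (1/n) ln (d_{bn} / Delta(n)) *)
  ((fun m : nat => (((m.*2.+1)%:R : R)^-1 *
      ln ((dlcm (b * m.*2.+1))%:R / (Delta R a b m.*2.+1)%:R)) : R) @ \oo --> N1) ->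
  let M1 : R :=
    ln ((z0 - (b - 2 * a)%:R) ^+ (b - 2 * a) * (z0 - (b - a)%:R) ^+ (b - a)
          * (z0 - b%:R) ^+ b
        / ((z0 - (2 * a)%:R) ^+ (2 * a) * (z0 - a%:R) ^+ a
           * (b - 4 * a)%:R ^+ (b - 4 * a) * (b - 2 * a)%:R ^+ (b - 2 * a)
           * b%:R ^+ b))
    - b%:R / 2 * ln (xk k) in
  let M2 : R :=
    ln (Normc.normc (z1 + (b - 2 * a)%:R) ^+ (b - 2 * a)
          * Normc.normc (z1 + (b - a)%:R) ^+ (b - a)
          * Normc.normc (z1 + b%:R) ^+ b
        / (Normc.normc (z1 + (2 * a)%:R) ^+ (2 * a) * Normc.normc (z1 + a%:R) ^+ a
           * (b - 4 * a)%:R ^+ (b - 4 * a) * (b - 2 * a)%:R ^+ (b - 2 * a)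
           * b%:R ^+ b))
    - b%:R / 2 * ln (xk k) in
  M2 + K1 a b k + N1 < 0 ->
  (irr_measure (alphak k : R) <= (1 - (M1 + K1 a b k + N1) / (M2 + K1 a b k + N1))%:E)%E.
Proof.
move=> k1 a0 b0 ob ab zb zeq0 _ y0 zeq1 hN M1 M2 hM.
have x0 := xk_gt0 R k1; have x1 := xk_lt1 R k1.
(* With z1 = - c + i y, the numbers z1 + t become the [w t] of the saddle point lemmas. *)
pose x : R := xk k; pose c := - complex.Re z1; pose y := complex.Im z1.
pose w t := ((t - c) +i* y)%C.
have wE (t : R) j : t = j%:R -> z1 + j%:R = w t.
  move=> ->; apply/eqP; rewrite eq_complex /w /c /y; case: (z1) => u v /=.
  by rewrite -[j%:R](rmorph_nat (real_complex R)) /= addr0 opprK addrC !eqxx.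
have w0 t : w t != 0.
  by rewrite eq_complex /= negb_and (gt_eqF y0) orbT.
have A4 : (b - 4 * a)%:R = b%:R - 4 * a%:R :> R by rewrite natrB ?(ltnW ab) // natrM.
have A2 : (b - 2 * a)%:R = b%:R - 2 * a%:R :> R.
  by rewrite natrB ?natrM //; move: ab; clear; lia.
have A1 : (b - a)%:R = b%:R - a%:R :> R by rewrite natrB //; move: ab; clear; lia.
have e2a := wE (2 * a%:R) (2 * a)%N (esym (natrM _ _ _)).
have ea := wE a%:R a erefl.
have e0 : z1 = w 0 by rewrite -(wE 0 0%N) ?addr0.
have eb2 := wE (b%:R - 2 * a%:R) (b - 2 * a)%N (esym A2).
have eb1 := wE (b%:R - a%:R) (b - a)%N (esym A1).
have eb := wE b%:R b erefl.
rewrite e2a ea eb2 eb1 eb [X in _ * X / _]e0 in zeq1.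
have zeq : w (2 * a%:R) * w a%:R * w 0 =
    (x^-1)%:C%C * (w (b%:R - 2 * a%:R) * w (b%:R - a%:R) * w b%:R).
  by rewrite -zeq1 mulfVK // !mulf_neq0.
have A0 : 0 < a%:R :> R by rewrite ltr0n.
have AB : 4 * a%:R < b%:R :> R by rewrite -natrM ltr_nat.
have rateE : saddle_rate a b c x y = M2.
  rewrite /M2 e2a ea eb2 eb1 eb.
  exact: saddle_rateE a0 ab x0 y0 (saddle_norm x0 zeq) (Theta_saddle A0 AB y0 x0 x1 zeq).
have gE : growth a b z0 = M1 by exact: growthE.
set s := M1 + K1 a b k + N1; set t := M2 + K1 a b k + N1.
pose L m : R := Lam R a b m.*2.+1 * Wgt R k (half2 a b m.*2.+1) (deg a b m.*2.+1).
have rL : exp_rate L (N1 + K1 a b k).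
  by apply: exp_rateM; [exact: exp_rate_Lam | exact: exp_rate_Wgt].
have [qp hqp] := @choice _ _ _ (fun m => @linear_form R k a b m.*2.+1 k1 ob (odd_double1 m) ab).
(* In the lemma of Hata, sigma is the rate s of q and tau = - t > 0 is the rate of decay of q alpha
   - p. *)
have -> : 1 - s / t = 1 + s / - t by rewrite invrN mulrN.
apply: (@hata R _ s (- t) (fun m => (qp m).1) (fun m => (qp m).2)).
- by rewrite oppr_gt0.
- move=> d d0.
  have := exp_rateM rL (exp_rate_zsum ob ab zb x0 x1 zeq0) d0.
  apply: filterS => m; rewrite gE (hqp m).1 -/(L m) => /andP[h1 h2].
  have -> : s = N1 + K1 a b k + M1 by rewrite /s; ring.
  by rewrite ger0_norm ?h1 // (le_trans _ h1) // expR_ge0.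
move=> d d0; have d3 : 0 < d / 3 by lra.
near=> m.
have om := @oddn_gt0 R m.
have h1 : L m <= expR ((N1 + K1 a b k + d / 3) * oddn R m).
  by near: m; apply: filterS (rL _ d3) => m /andP[].
have h2 : sqrtk R k * oddn R m ^+ 0 <= expR (d / 3 * oddn R m) by near: m; apply: near_poly_exp.
have h3 : `|zsum x (ln x *: Tpol R a b m.*2.+1 + (Tpol R a b m.*2.+1)^`())|
      <= expR ((saddle_rate a b c x y + d / 3) * oddn R m).
  by near: m; apply: saddle_upper.
have L0 : 0 <= L m by rewrite mulr_ge0 // ltW ?Lam_gt0 ?Wgt_gt0.
have s0 : 0 <= sqrtk R k by rewrite sqrtr_ge0.
rewrite (hqp m).2 -/(L m) (normrM (L m * _)) (normrM (L m)) (ger0_norm L0) (ger0_norm s0).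
have -> : - ((- t - d) * oddn R m) = (N1 + K1 a b k + d / 3) * oddn R m + d / 3 * oddn R m
    + (saddle_rate a b c x y + d / 3) * oddn R m by rewrite rateE /t; field.
rewrite !expRD; rewrite expr0 mulr1 in h2.
apply: ler_pM (ler_pM _ _ h1 h2) h3 => //; exact: mulr_ge0.
Unshelve. all: by end_near. Qed.
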